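(* Let $k\in\mathbb{N}$, $k\ge 2$. There is a constant $A=A(k)$ such that for all $0<\delta<1$ and all Schwartz functions $F\in\mathcal{S}(\mathbb{R}^2)$ with $\operatorname{supp}(\hat F)\subseteq \mathcal{N}_\delta(\gamma_k)$, where $\gamma_k=\{(\xi,\xi^k):\xi\in[-1,1]\}$, $$\|F\|_{L^4(\mathbb{R}^2)}\le A\,\Big\|\Big(\sum_{\theta\in\Theta_{\delta,k}}|F_\theta|^2\Big)^{1/2}\Big\|_{L^4(\mathbb{R}^2)} .$$
   Context: $\mathcal{N}_\delta(E)$ denotes the $\delta$-neighbourhood of a set $E$, and $\hat F$ the Fourier transform of $F$. Canonical covering $\Theta_{\delta,k}$: it is a finitely overlapping covering (overlap bounded in terms of $k$ only) of $\mathcal{N}_\delta(\gamma_k)$ by the following rectangles, where $C=C(k)\ge1$ is a fixed constant, chosen large enough that they cover $\mathcal{N}_\delta(\gamma_k)$. (i) One rectangle centered at the origin, of length $C\delta^{1/k}$ in the direction $(1,0)$ and $C\delta$ in the direction $(0,1)$. (ii) For each dyadic $K\in 2^{\mathbb{Z}}$ with $\delta^{1/k}\lesssim K\le 1$, choose a set of points $\xi$ with $K/2\le|\xi|\le K$, maximally separated at distance $\delta^{1/2}/K^{(k-2)/2}$; for each chosen $\xi$ take the rectangle centered at $(\xi,\xi^k)$ of length $C\delta^{1/2}/|\xi|^{(k-2)/2}$ in the direction tangential to $\gamma_k$ at $(\xi,\xi^k)$ and of length $C\delta$ in the normal direction. $F_\theta$ denotes the mollified Fourier projection of $F$ to $\theta$: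 $\hat F_\theta=\chi_\theta\hat F$, where $(\chi_\theta)_{\theta\in\Theta_{\delta,k}}$ are smooth functions, $\chi_\theta$ supported in $\theta$ and adapted to $\theta$, with $\sum_\theta\chi_\theta=1$ on $\mathcal{N}_\delta(\gamma_k)$. Thus $F=\sum_\theta F_\theta$. *)

(* Defs.v *)
From HB Require Import structures.
From mathcomp Require Import all_boot all_order all_algebra.
From mathcomp Require Export complex.
From mathcomp Require Import all_classical all_reals all_analysis.

Set Implicit Arguments.
Unset Strict Implicit.
Unset Printing Implicit Defensive.

Import Order.TTheory GRing.Theory Num.Theory numFieldNormedType.Exports.
Local Open Scope classical_set_scope.
Local Open Scope ring_scope.
Local Open Scope complex_scope.

(* The Euclidean structure of R^2 is spelled out, because the
   library norm on R * R is the maximum norm. *)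
Definition dot2 (R : realType) (x y : R * R) : R := x.1 * y.1 + x.2 * y.2.

Definition norm2 (R : realType) (x : R * R) : R := Num.sqrt (dot2 x x).

Definition nbhd2 (R : realType) (delta : R) (E : set (R * R)) : set (R * R) :=
  [set x | exists2 p, E p & norm2 (x - p) < delta].

(* 'D_{v_1} ... 'D_{v_m} f for s = [:: v_1; ...; v_m] *)
Definition iter_derive (R : realType) (s : seq (R * R)) (f : R * R -> R) :
  R * R -> R := foldr (fun v (g : R * R -> R) => 'D_v g) f s.

Definition smooth2 (R : realType) (f : R * R -> R) : Prop :=
  forall s : seq (R * R),
    continuous (iter_derive s f) /\
    forall x v : R * R, derivable (iter_derive s f) x v.

Definition csmooth2 (R : realType) (f : R * R -> R[i]) : Prop :=
  smooth2 (fun x => complex.Re (f x)) /\ smooth2 (fun x => complex.Im (f x)).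

Definition iter_cderive (R : realType) (s : seq (R * R)) (f : R * R -> R[i])
    (x : R * R) : R[i] :=
  iter_derive s (fun y => complex.Re (f y)) x
    +i* iter_derive s (fun y => complex.Im (f y)) x.

Definition schwartz2 (R : realType) (f : R * R -> R[i]) : Prop :=
  csmooth2 f /\
  forall (m : nat) (s : seq (R * R)), exists M : R, forall x : R * R,
    (1 + norm2 x) ^+ m * Normc.normc (iter_cderive s f x) <= M.

Definition lebesgue2 (R : realType) :
    {measure set (measurableTypeR R * measurableTypeR R) -> \bar R} :=
  (@lebesgue_measure R \x @lebesgue_measure R)%E.
Arguments lebesgue2 : clear implicits.

Definition cintegral2 (R : realType) (f : R * R -> R[i]) : R[i] :=
  (\int[lebesgue2 R]_x complex.Re (f x))
    +i* (\int[lebesgue2 R]_x complex.Im (f x)).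

Definition cis (R : realType) (t : R) : R[i] := cos t +i* sin t.

Definition fourier2 (R : realType) (f : R * R -> R[i]) (xi : R * R) : R[i] :=
  cintegral2 (fun x => cis (- (2 * pi * dot2 x xi)) * f x).

Definition inv_fourier2 (R : realType) (g : R * R -> R[i]) (x : R * R) : R[i] :=
  cintegral2 (fun xi => cis (2 * pi * dot2 x xi) * g xi).

Definition csupport (R : realType) (f : R * R -> R[i]) : set (R * R) :=
  closure [set x | f x != 0].

Definition L4norm (R : realType) (f : R * R -> R) : \bar R :=
  'N[lebesgue2 R]_(4%:E)[EFin \o f]%E.

Definition gammak (R : realType) (k : nat) : set (R * R) :=
  [set (xi, xi ^+ k) | xi in `[-1, 1]].
Arguments gammak : clear implicits.

Definition tangent (R : realType) (k : nat) (xi : R) : R * R :=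
  let d := k%:R * xi ^+ k.-1 in
  let n := Num.sqrt (1 + d ^+ 2) in (1 / n, d / n).

Definition normal (R : realType) (k : nat) (xi : R) : R * R :=
  (- (tangent k xi).2, (tangent k xi).1).

(* delta^{1/2} / r^{(k-2)/2} *)
Definition spacing (R : realType) (k : nat) (delta r : R) : R :=
  Num.sqrt delta / r `^ ((k%:R - 2) / 2).

(* The rectangles of the covering are indexed by the abscissa xi of their
   centre; xi = 0, which is never one of the points chosen at a dyadic scale,
   indexes the rectangle at the origin. *)
Definition rect_length (R : realType) (k : nat) (C delta xi : R) : R :=
  C * (if xi == 0 then delta `^ (k%:R^-1) else spacing k delta `|xi|).

Definition rect_width (R : realType) (C delta : R) : R := C * delta.

Definition rect (R : realType) (k : nat) (C delta xi : R) : set (R * R) :=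
  [set x | `|dot2 (x - (xi, xi ^+ k)) (tangent k xi)|
             <= rect_length k C delta xi / 2 /\
           `|dot2 (x - (xi, xi ^+ k)) (normal k xi)|
             <= rect_width C delta / 2].

Definition maximal_separated (R : realType) (E : set R) (r : R) (P : set R) :
    Prop :=
  [/\ P `<=` E,
      forall x y, P x -> P y -> x != y -> r <= `|x - y| &
      forall x, E x -> exists2 y, P y & `|x - y| < r].

(* The j with c * delta^{1/k} <= 2^j <= 1; here c is the constant implicit in
   delta^{1/k} <~ K. *)
Definition dyadic_scales (R : realType) (k : nat) (c delta : R) : set int :=
  [set j | c * delta `^ (k%:R^-1) <= (2 : R) ^ j <= 1].

(* X enumerates without repetition the abscissae of the centres.  That the
   rectangles overlap boundedly, with a bound depending only on k, C and c,
   follows from the separation of the points, so it is not required here. *)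
Definition canonical_covering (R : realType) (k : nat) (C c delta : R)
    (X : seq R) : Prop :=
  [/\ uniq X,
      exists P : int -> set R,
        (forall j, dyadic_scales k c delta j ->
           maximal_separated
             [set xi : R | (2 : R) ^ j / 2 <= `|xi| <= (2 : R) ^ j]
             (spacing k delta ((2 : R) ^ j)) (P j)) /\
        [set` X] = [set 0] `|` \bigcup_(j in dyadic_scales k c delta) P j &
      nbhd2 delta (gammak R k) `<=` \bigcup_(xi in [set` X]) rect k C delta xi].

(* The derivatives are taken along the sides of the rectangle, scaled by the
   side lengths: this bounds the derivatives of chi after the affine change of
   variables that maps the rectangle to the unit square. *)
Definition adapted (R : realType) (k : nat) (C delta xi : R)
    (B : nat -> nat -> R) (chi : R * R -> R[i]) : Prop :=
  forall (a b : nat) (x : R * R),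
    Normc.normc
      (iter_cderive (nseq a (rect_length k C delta xi *: tangent k xi) ++
                     nseq b (rect_width C delta *: normal k xi)) chi x)
    <= B a b.

Definition adapted_partition (R : realType) (k : nat) (C delta : R)
    (X : seq R) (B : nat -> nat -> R) (chi : R -> R * R -> R[i]) : Prop :=
  (forall xi, xi \in X ->
     [/\ csmooth2 (chi xi),
         csupport (chi xi) `<=` rect k C delta xi &
         adapted k C delta xi B (chi xi)]) /\
  (forall x, nbhd2 delta (gammak R k) x -> \sum_(xi <- X) chi xi x = 1).

Definition fourier_proj (R : realType) (chi F : R * R -> R[i]) :
  R * R -> R[i] := inv_fourier2 (fun xi => chi xi * fourier2 F xi).

Definition square_function (R : realType) (X : seq R)
    (chi : R -> R * R -> R[i]) (F : R * R -> R[i]) (x : R * R) : R :=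
  Num.sqrt (\sum_(xi <- X) Normc.normc (fourier_proj (chi xi) F x) ^+ 2).

(* Main.v *)
Require Import Defs.
From HB Require Import structures.
From mathcomp Require Import all_boot all_order all_algebra.
From mathcomp Require Import all_classical all_reals all_analysis.
From mathcomp Require Import measurable_realfun.
From mathcomp Require Import ring lra zify.

(** Away from the flat point at the origin the curve is convex, and the estimate
    there is the Cordoba-Fefferman argument.  Expand the fourth power of
    [|sum F_theta|] as a sum over pairs of pairs of rectangles, and integrate.
    The term belonging to [(theta1, theta2)] and [(theta3, theta4)] vanishes
    unless the sumsets [theta1 + theta2] and [theta3 + theta4] nearly meet.  If
    they do, there are points of the curve with abscissae satisfying
    [x1 + x2 = x3 + x4], whose [k]-th powers satisfy the same relation up to
    [O(delta)].  At the midpoint [s], convexity gives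
    [|s|^(k-2) |x1 - x3| |x1 - x4| = O(delta)] ([power_sum_gap]), which is
    exactly the relation between the curvature and the length of the
    rectangles: up to the order of the pair, [theta3] is one of boundedly many
    neighbours of [theta1], and [theta4] one of those of [theta2]
    ([sum_rect_overlap], [count_close]).  What survives of the expansion is
    then at most a constant times the integral of [(sum |F_theta|^2)^2]
    ([biorthogonal_square_function]).

    For odd [k] all pairs of opposite points of the curve have the same sum, so
    the rectangles with positive and with negative abscissae are treated
    separately.  The rectangles at distance [O(delta^(1/k))] from
    the origin, whose length is not small compared with that distance, are
    boundedly many ([count_not_far]), and the triangle inequality is enough for
    them.

    Two facts of Fourier analysis are used: [F] is the sum of its projections
    ([fourier_inversion]), and functions with separated frequencies are
    orthogonal ([biorthogonality]).  Both are obtained by inserting the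
    integrable weight [(1 + e |x|) exp (- e |x|)] in each variable and letting
    [e] tend to [0].  By Fubini the Fourier integrals can be moved onto the
    weight ([osc_duality]), whose transform [4 e^3 / (e^2 + v^2)^2] is explicit:
    it is an approximate identity, which gives inversion; and the product of its
    values at two frequencies, one of which is bounded away from [0], is
    [O(e^2)], which gives orthogonality. *)

Set Implicit Arguments.
Unset Strict Implicit.
Unset Printing Implicit Defensive.

Import Order.TTheory GRing.Theory Num.Theory numFieldNormedType.Exports.
Local Open Scope classical_set_scope.
Local Open Scope ring_scope.

(** * Convexity of the power function *)

(** The sums [(s + a)^n + (s - a)^n] and [a ((s + a)^n - (s - a)^n)] satisfy a
    recursion in [n] whose coefficients [1], [s] and [a^2] are nonnegative, so
    both of them increase with [a^2]. *)
Lemma symmetric_power_gap (R : realType) (m : nat) (s a b : R) :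
  0 <= s -> b ^+ 2 <= a ^+ 2 ->
  2 * s ^+ m * (a ^+ 2 - b ^+ 2) <=
  ((s + a) ^+ m.+2 + (s - a) ^+ m.+2) - ((s + b) ^+ m.+2 + (s - b) ^+ m.+2).
Proof.
move=> s0 ab.
pose u n (x : R) := (s + x) ^+ n + (s - x) ^+ n.
pose v n (x : R) := x * ((s + x) ^+ n - (s - x) ^+ n).
have uS n x : u n.+1 x = s * u n x + v n x by rewrite /u /v !exprS; ring.
have vS n x : v n.+1 x = s * v n x + x ^+ 2 * u n x by rewrite /u /v !exprS; ring.
have u0 x : u 0%N x = 2 by rewrite /u !expr0.
have v0 x : v 0%N x = 0 by rewrite /v !expr0 subrr mulr0.
suff : 2 * s ^+ m * (a ^+ 2 - b ^+ 2) <= u m.+2 a - u m.+2 b by [].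
clearbody u v.
have uv0 n x : 0 <= u n x /\ 0 <= v n x.
  elim: n => [|n [IHu IHv]]; first by rewrite u0 v0.
  by rewrite uS vS; split; rewrite addr_ge0 // mulr_ge0 // sqr_ge0.
have key n : [/\ 0 <= u n.+1 a - u n.+1 b,
    2 * s ^+ n * (a ^+ 2 - b ^+ 2) <= v n.+1 a - v n.+1 b &
    2 * s ^+ n * (a ^+ 2 - b ^+ 2) <= u n.+2 a - u n.+2 b].
  elim: n => [|n [IHu IHv IHu2]].
    by rewrite !(uS, vS, u0, v0) expr0; split; lra.
  have sn : 0 <= s ^+ n by rewrite exprn_ge0.
  have u2 : 0 <= u n.+2 a - u n.+2 b.
    by apply: le_trans IHu2; rewrite !mulr_ge0 // subr_ge0.
  have v2 : 2 * s ^+ n.+1 * (a ^+ 2 - b ^+ 2) <= v n.+2 a - v n.+2 b.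
    rewrite (vS n.+1) (vS n.+1 b) exprS.
    have := ler_wpM2l s0 IHv.
    have [ub _] := uv0 n.+1 b.
    have : a ^+ 2 * u n.+1 b <= a ^+ 2 * u n.+1 a.
      by rewrite ler_wpM2l ?sqr_ge0 // -subr_ge0.
    have : b ^+ 2 * u n.+1 b <= a ^+ 2 * u n.+1 b by rewrite ler_wpM2r.
    lra.
  split=> //; rewrite (uS n.+2) (uS n.+2 b).
  have : 0 <= s * (u n.+2 a - u n.+2 b) by rewrite mulr_ge0.
  lra.
by have [] := key m.
Qed.

(** Two pairs with the same sum [2 s] are [s + a, s - a] and [s + b, s - b],
    and [a^2 - b^2] is, up to sign, [(x1 - x3) (x1 - x4)]. *)
Lemma power_sum_gap (R : realType) (m : nat) (x1 x2 x3 x4 : R) :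
  x1 + x2 = x3 + x4 ->
  2 * `|(x1 + x2) / 2| ^+ m * (`|x1 - x3| * `|x1 - x4|) <=
  `|x1 ^+ m.+2 + x2 ^+ m.+2 - x3 ^+ m.+2 - x4 ^+ m.+2|.
Proof.
wlog s0 : x1 x2 x3 x4 / 0 <= (x1 + x2) / 2 => [H e|].
  have [s0|s0] := leP 0 ((x1 + x2) / 2); first exact: H.
  have := H (- x1) (- x2) (- x3) (- x4); rewrite -!opprD mulNr.
  rewrite !normrN.
  have -> : (- x1) ^+ m.+2 + (- x2) ^+ m.+2 - (- x3) ^+ m.+2 - (- x4) ^+ m.+2
     = (-1) ^+ m.+2 * (x1 ^+ m.+2 + x2 ^+ m.+2 - x3 ^+ m.+2 - x4 ^+ m.+2).
    rewrite (exprNn x1) (exprNn x2) (exprNn x3) (exprNn x4).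
    by move: ((-1) ^+ m.+2) => e1; ring.
  rewrite normrMsign; apply;
    last by rewrite e.
  by rewrite oppr_ge0 ltW.
wlog ab : x1 x2 x3 x4 s0 / ((x3 - x4) / 2) ^+ 2 <= ((x1 - x2) / 2) ^+ 2
    => [H e|].
  have [ab|/ltW ab] := leP (((x3 - x4) / 2) ^+ 2) (((x1 - x2) / 2) ^+ 2).
    exact: H.
  have e2 : (x3 + x4) / 2 = (x1 + x2) / 2 by rewrite e.
  have := H x3 x4 x1 x2; rewrite e2 => /(_ s0 ab (esym e)).
  have -> : `|x3 - x1| * `|x3 - x2| = `|x1 - x3| * `|x1 - x4|.
    have -> : x3 - x2 = x1 - x4 by lra.
    by rewrite (distrC x3).
  congr (_ <= _); rewrite -normrN; congr `|_|; ring.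
move=> e; rewrite (ger0_norm s0).
have := symmetric_power_gap m s0 ab.
have -> : (x1 + x2) / 2 + (x1 - x2) / 2 = x1 by field.
have -> : (x1 + x2) / 2 - (x1 - x2) / 2 = x2 by field.
have -> : (x1 + x2) / 2 + (x3 - x4) / 2 = x3 by rewrite e; field.
have -> : (x1 + x2) / 2 - (x3 - x4) / 2 = x4 by rewrite e; field.
have eq2 : ((x1 - x2) / 2) ^+ 2 - ((x3 - x4) / 2) ^+ 2 = (x1 - x3) * (x1 - x4).
  have -> : x2 = x3 + x4 - x1 by lra.
  by field.
have p0 : 0 <= (x1 - x3) * (x1 - x4) by rewrite -eq2 subr_ge0.
rewrite eq2 => H; rewrite -normrM (ger0_norm p0).
by apply: le_trans H _; rewrite opprD addrA ler_norm.
Qed.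

(** Up to the factor [y], the remainder grows by [n x^(n-1) (y - x)^2] when the
    exponent [n] increases by one. *)
Lemma power_taylor (R : realType) (m : nat) (x y : R) : `|y - x| <= `|x| ->
  `|y ^+ m.+2 - x ^+ m.+2 - m.+2%:R * x ^+ m.+1 * (y - x)|
    <= 4 ^+ m.+2 * `|x| ^+ m * (y - x) ^+ 2.
Proof.
move=> yx; have y2 : `|y| <= 2 * `|x|.
  have -> : y = x + (y - x) by ring.
  by apply: le_trans (ler_normD _ _) _; lra.
elim: m => [|m IH].
  have -> : y ^+ 2 - x ^+ 2 - 2%:R * x ^+ 1 * (y - x) = (y - x) ^+ 2 by ring.
  rewrite expr0 ger0_norm ?sqr_ge0 // mulr1.
  have := sqr_ge0 (y - x); lra.
have -> : y ^+ m.+3 - x ^+ m.+3 - m.+3%:R * x ^+ m.+2 * (y - x)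
   = y * (y ^+ m.+2 - x ^+ m.+2 - m.+2%:R * x ^+ m.+1 * (y - x))
     + m.+2%:R * x ^+ m.+1 * (y - x) ^+ 2.
  by rewrite !exprS -[m.+3]addn1 natrD; ring.
apply: le_trans (ler_normD _ _) _.
set D := _ - _ in IH *.
have n0 : 0 <= `|x| ^+ m by rewrite exprn_ge0.
have h0 := sqr_ge0 (y - x).
have k4 : m.+2%:R <= (4 : R) ^+ m.+2.
  by rewrite -natrX ler_nat ltnW // ltn_expl.
have : `|y * D| <= 2 * `|x| * (4 ^+ m.+2 * `|x| ^+ m * (y - x) ^+ 2).
  by rewrite normrM ler_pM.
have : `|m.+2%:R * x ^+ m.+1 * (y - x) ^+ 2|
    <= 4 ^+ m.+2 * (`|x| * `|x| ^+ m * (y - x) ^+ 2).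
  rewrite normrM (ger0_norm h0) normrM normrX normr_nat -exprS -mulrA.
  by rewrite ler_wpM2r // mulr_ge0 // exprn_ge0.
rewrite [4 ^+ m.+3]exprS [`|x| ^+ m.+1]exprS.
have : 0 <= 4 ^+ m.+2 * (`|x| * `|x| ^+ m * (y - x) ^+ 2).
  by apply: mulr_ge0; [rewrite exprn_ge0 | rewrite mulr_ge0 // mulr_ge0].
set P := 4 ^+ m.+2; move=> h1 h2 h3.
have -> : 4 * P * (`|x| * `|x| ^+ m) * (y - x) ^+ 2 =
  4 * (P * (`|x| * `|x| ^+ m * (y - x) ^+ 2)) by ring.
have : 2 * `|x| * (P * `|x| ^+ m * (y - x) ^+ 2) =
  2 * (P * (`|x| * `|x| ^+ m * (y - x) ^+ 2)) by ring.
lra.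
Qed.

(** * Rectangles far from the flat point *)

Lemma power_lipschitz (R : realType) (n : nat) (x y : R) :
  `|x| <= 3 -> `|y| <= 3 -> `|x ^+ n - y ^+ n| <= n%:R * 3 ^+ n * `|x - y|.
Proof.
move=> x3 y3; elim: n => [|n IH]; first by rewrite !expr0 subrr normr0 !mul0r.
have -> : x ^+ n.+1 - y ^+ n.+1 = x * (x ^+ n - y ^+ n) + y ^+ n * (x - y).
  by rewrite !exprS; ring.
apply: le_trans (ler_normD _ _) _; rewrite !normrM normrX.
have h1 : `|x| * `|x ^+ n - y ^+ n| <= 3 * (n%:R * 3 ^+ n * `|x - y|).
  by rewrite ler_pM.
have h2 : `|y| ^+ n * `|x - y| <= 3 ^+ n * `|x - y|.
  by rewrite ler_wpM2r // lerXn2r // nnegrE.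
have h3 : 0 <= 3 ^+ n * `|x - y| by rewrite mulr_ge0 // exprn_ge0.
rewrite exprS -[n.+1]addn1 natrD mulrDl; lra.
Qed.

Lemma ler_of_sqr (R : realType) (x y : R) : 0 <= y -> x ^+ 2 <= y ^+ 2 -> x <= y.
Proof.
move=> y0 xy; have [x0|/ltW x0] := leP 0 x; last exact: le_trans x0 y0.
by move: xy; rewrite ler_sqr // nnegrE.
Qed.

Lemma spacing_gt0 (R : realType) (k : nat) (delta r : R) :
  0 < delta -> 0 < r -> 0 < spacing k delta r.
Proof. by move=> d0 r0; rewrite /spacing divr_gt0 ?sqrtr_gt0 ?powR_gt0. Qed.

(** The spacing at [r] is the length over which a curve whose curvature is of the
    order of [r ^ (k - 2)] deviates from its tangent by about [delta]. *)
Lemma spacing_sqr (R : realType) (m : nat) (delta r : R) :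
  0 < delta -> 0 < r -> spacing m.+2 delta r ^+ 2 * r ^+ m = delta.
Proof.
move=> d0 r0; rewrite /spacing expr_div_n sqr_sqrtr ?ltW //.
have -> : (r `^ ((m.+2%:R - 2) / 2)) ^+ 2 = r ^+ m.
  rewrite -[LHS]powR_mulrn ?powR_ge0 // -powRrM -powR_mulrn ?ltW //.
  by congr (_ `^ _); rewrite -[m.+2]addn2 natrD; field.
by rewrite divfK // lt0r_neq0 // exprn_gt0.
Qed.

Lemma spacing_compare (R : realType) (m : nat) (delta q r r' : R) :
  0 < delta -> 1 <= q -> 0 < r -> 0 < r' -> r <= q * r' ->
  spacing m.+2 delta r' <= q ^+ m * spacing m.+2 delta r.
Proof.
move=> d0 q1 r0 r'0 rr'.
have q0 : 0 <= q by apply: le_trans q1.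
have sr := spacing_sqr m d0 r0; have sr' := spacing_sqr m d0 r'0.
have s0 := spacing_gt0 m.+2 d0 r0.
set s := spacing _ _ r in sr s0 *; set s' := spacing _ _ r' in sr' *.
clearbody s s'.
have qm1 : 1 <= q ^+ m by rewrite exprn_ege1.
apply: ler_of_sqr; first by rewrite mulr_ge0 ?exprn_ge0 // ltW.
rewrite -(ler_pM2r (exprn_gt0 m r'0)) sr' -sr.
apply: (@le_trans _ _ (s ^+ 2 * (q * r') ^+ m)).
  by rewrite ler_wpM2l ?sqr_ge0 // lerXn2r ?nnegrE // ?ltW // mulr_gt0 //; lra.
have -> : s ^+ 2 * (q * r') ^+ m = q ^+ m * (s ^+ 2 * r' ^+ m).
  by rewrite exprMn; ring.
have -> : (q ^+ m * s) ^+ 2 * r' ^+ m = q ^+ m * (q ^+ m * (s ^+ 2 * r' ^+ m)).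
  by ring.
have p0 : 0 <= s ^+ 2 * r' ^+ m by rewrite mulr_ge0 ?sqr_ge0 ?exprn_ge0 ?ltW.
by rewrite ler_wpM2l ?exprn_ge0 // ler_peMl.
Qed.

Lemma le_spacing (R : realType) (k : nat) (delta r : R) :
  (2 <= k)%N -> 0 < delta < 1 -> 0 < r <= 1 -> delta <= spacing k delta r.
Proof.
case: k => [|[|m]] // _ /andP[d0 d1] /andP[r0 r1].
have s0 := spacing_gt0 m.+2 d0 r0; have ss := spacing_sqr m d0 r0.
apply: ler_of_sqr; first exact: ltW.
have rm : r ^+ m <= 1 by rewrite exprn_ile1 // ltW.
have := sqr_ge0 (spacing m.+2 delta r); nra.
Qed.

(** The last condition makes the rectangle short compared with the distance of
    its centre to the flat point. *)
Definition far (R : realType) (k : nat) (M delta xi : R) : bool :=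
  [&& 0 < `|xi|, `|xi| <= 1 & M * spacing k delta `|xi| <= `|xi|].

(** The constant of the vertical deviation in [rect_near_curve]: the first term
    comes from the width of the rectangle, the second from its length. *)
Definition thickness (R : realType) (m : nat) (C : R) : R :=
  C * (1 + m.+2%:R) + 4 ^+ m.+2 * C ^+ 2.

(** Over the length of the rectangle the curve leaves its tangent by [O(delta)],
    because [spacing ^ 2 * |xi| ^ (k - 2) = delta]. *)
Lemma rect_near_curve (R : realType) (m : nat) (C delta xi : R) (x : R * R) :
  0 < delta < 1 -> 1 <= C -> far m.+2 (4 * C) delta xi ->
  rect m.+2 C delta xi x ->
  `|x.1 - xi| <= C * spacing m.+2 delta `|xi| /\
  `|x.2 - x.1 ^+ m.+2| <= thickness m C * delta.
Proof.
move=> d01 C1 /and3P[xi0 xi1 xiM]; have /andP[d0 d1] := d01.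
rewrite /rect /= /rect_length /rect_width /dot2 /normal /tangent /=.
have -> : xi == 0 = false by apply/negbTE; rewrite -normr_gt0.
have s0 := spacing_gt0 m.+2 d0 xi0.
have ss := spacing_sqr m d0 xi0.
have ds : delta <= spacing m.+2 delta `|xi| by apply: le_spacing; rewrite ?xi0.
set s := spacing _ _ _ in s0 ss ds xiM *.
clearbody s.
set d := m.+2%:R * xi ^+ m.+1.
set n := Num.sqrt _.
have dm : `|d| <= m.+2%:R.
  rewrite /d normrM normrX normr_nat ler_piMr // exprn_ile1 //.
have n2 : n ^+ 2 = 1 + d ^+ 2 by rewrite sqr_sqrtr //; have := sqr_ge0 d; lra.
have n1 : 1 <= n.
  by apply: ler_of_sqr; rewrite ?sqrtr_ge0 // n2; have := sqr_ge0 d; lra.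
have n0 : n != 0 by rewrite lt0r_neq0 //; lra.
have dn : `|d| <= n.
  apply: ler_of_sqr; first lra.
  by rewrite n2 real_normK ?num_real //; lra.
have nm : n <= 1 + m.+2%:R.
  apply: ler_of_sqr; first by have := ler0n R m.+2; lra.
  rewrite n2 -(real_normK (num_real d)).
  have : `|d| ^+ 2 <= m.+2%:R ^+ 2 by rewrite lerXn2r // nnegrE.
  have := ler0n R m.+2; lra.
set w1 := x.1 - xi; set w2 := x.2 - xi ^+ m.+2.
set a := w1 * (1 / n) + w2 * (d / n); set b := w1 * - (d / n) + w2 * (1 / n).
move=> [ha hb].
have bE : w2 - d * w1 = b * n by rewrite /b; field.
have aE : w1 * n = a - d * b.
  have -> : w1 * n = w1 * n ^+ 2 / n by field.
  by rewrite n2 /a /b; field.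
have hw1 : `|w1| <= C * s.
  have : `|w1| * n <= (C * s) * n.
    have -> : `|w1| * n = `|w1 * n| by rewrite normrM (ger0_norm (x := n)) //; lra.
    rewrite aE; apply: le_trans (ler_normB _ _) _; rewrite normrM.
    have : `|d| * `|b| <= n * (C * delta / 2) by rewrite ler_pM.
    have : `|a| <= n * (C * s / 2).
      by apply: le_trans ha _; rewrite ler_peMl // divr_ge0 // mulr_ge0 //; lra.
    have : n * (C * delta) <= n * (C * s) by rewrite !ler_wpM2l //; lra.
    lra.
  by rewrite ler_pM2r //; lra.
split=> //.
have w1xi : `|w1| <= `|xi|.
  by apply: le_trans hw1 _; apply: le_trans xiM; nra.
have := power_taylor m w1xi; rewrite -/d -/w1.
set D := _ - _ => hD.
have -> : x.2 - x.1 ^+ m.+2 = b * n - D by rewrite -bE /D /w2 /w1 /d; ring.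
apply: le_trans (ler_normB _ _) _; rewrite /thickness [leRHS]mulrDl; apply: lerD.
  rewrite normrM (ger0_norm (x := n)); last lra.
  apply: (@le_trans _ _ (C * delta / 2 * (1 + m.+2%:R))).
    by rewrite ler_pM //; lra.
  have : 0 <= C * delta * (1 + m.+2%:R).
    by rewrite !mulr_ge0 //; have := ler0n R m.+2; lra.
  lra.
apply: le_trans hD _.
have -> : 4 ^+ m.+2 * C ^+ 2 * delta = 4 ^+ m.+2 * `|xi| ^+ m * (C * s) ^+ 2.
  by rewrite -ss; ring.
have p0 : 0 <= (4 : R) ^+ m.+2 * `|xi| ^+ m.
  by apply: mulr_ge0; rewrite exprn_ge0.
rewrite ler_wpM2l // -(real_normK (num_real w1)) lerXn2r ?nnegrE //.
by rewrite mulr_ge0 //; lra.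
Qed.

Lemma sub_far (R : realType) (k : nat) (M M' delta xi : R) :
  0 < delta -> M' <= M -> far k M delta xi -> far k M' delta xi.
Proof.
move=> d0 MM /and3P[xi0 xi1 xiM]; apply/and3P; split=> //.
by apply: le_trans xiM; rewrite ler_wpM2r // ltW // spacing_gt0.
Qed.

(** Both local scales occur, which makes the relation symmetric although the
    spacing depends on the position. *)
Definition close (R : realType) (k : nat) (D delta x y : R) : bool :=
  [&& `|x - y| <= D * spacing k delta `|x|,
      `|x - y| <= D * spacing k delta `|y|,
      `|x| <= 2 * `|y| & `|y| <= 2 * `|x|].

Lemma close_sym (R : realType) (k : nat) (D delta x y : R) :
  close k D delta x y = close k D delta y x.
Proof.
by rewrite /close distrC; apply/and4P/and4P => -[].
Qed.

(** A distance of a few spacings is small compared with the far centres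
    themselves, so their sizes, and then their spacings, are comparable. *)
Lemma close_of_dist (R : realType) (m : nat) (a delta x y : R) :
  0 < delta -> 1 <= a ->
  far m.+2 (4 * a) delta x -> far m.+2 (4 * a) delta y ->
  `|x - y| <= a * (spacing m.+2 delta `|x| + spacing m.+2 delta `|y|) ->
  close m.+2 (a * (1 + 2 ^+ m)) delta x y.
Proof.
move=> d0 a1 /and3P[x0 _ xM] /and3P[y0 _ yM] xy.
have h1 : `|x| <= `|y| + `|x - y|.
  by rewrite -{1}(subrK y x) addrC; exact: ler_normD.
have h2 : `|y| <= `|x| + `|x - y|.
  by rewrite distrC -{1}(subrK x y) addrC; exact: ler_normD.
have xy2 : `|x| <= 2 * `|y| by lra.
have yx2 : `|y| <= 2 * `|x| by lra.
have c1 := spacing_compare m d0 (ler1n R 2) x0 y0 xy2.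
have c2 := spacing_compare m d0 (ler1n R 2) y0 x0 yx2.
apply/and4P; split=> //; apply: le_trans xy _; rewrite -mulrA ler_wpM2l //; lra.
Qed.

Lemma ler_norm_sum4 (R : realType) (u v w e a b c d : R) :
  `|u| <= a -> `|v| <= b -> `|w| <= c -> `|e| <= d ->
  `|u + v + w + e| <= a + b + c + d.
Proof.
move=> ua vb wc ed; do 3 (apply: le_trans (ler_normD _ _) _; apply: lerD => //).
Qed.

(** This is where convexity enters, through [power_sum_gap].  Only the first pair
    has to lie on one side of the origin: it alone determines the midpoint, and
    the curvature there is at least comparable to that at [xi1] and at [xi2]. *)
Lemma sum_rect_overlap (R : realType) (m : nat) (C : R) : 1 <= C ->
  exists2 a : R, C <= a & forall (delta xi1 xi2 xi3 xi4 : R)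
    (x1 x2 x3 x4 : R * R), 0 < delta < 1 ->
  far m.+2 (4 * a) delta xi1 -> far m.+2 (4 * a) delta xi2 ->
  far m.+2 (4 * a) delta xi3 -> far m.+2 (4 * a) delta xi4 ->
  0 < xi1 * xi2 ->
  rect m.+2 C delta xi1 x1 -> rect m.+2 C delta xi2 x2 ->
  rect m.+2 C delta xi3 x3 -> rect m.+2 C delta xi4 x4 ->
  `|x1.1 + x2.1 - x3.1 - x4.1| < delta ->
  `|x1.2 + x2.2 - x3.2 - x4.2| < delta ->
  close m.+2 (a * (1 + 2 ^+ m)) delta xi1 xi3 &&
    close m.+2 (a * (1 + 2 ^+ m)) delta xi2 xi4 ||
  close m.+2 (a * (1 + 2 ^+ m)) delta xi1 xi4 &&
    close m.+2 (a * (1 + 2 ^+ m)) delta xi2 xi3.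
Proof.
move=> C1; pose C2 := 1 + 4 * thickness m C + m.+2%:R * 3 ^+ m.+2.
pose T := 1 + 4 ^+ m * C2.
have th0 : 0 <= thickness m C.
  rewrite /thickness addr_ge0 //; last first.
    by apply: mulr_ge0; [exact: exprn_ge0 | exact: sqr_ge0].
  by rewrite mulr_ge0 //; have := ler0n R m.+2; lra.
have C20 : 0 <= C2.
  have : 0 <= m.+2%:R * (3 : R) ^+ m.+2 by apply: mulr_ge0; rewrite // exprn_ge0.
  rewrite /C2; lra.
have T1 : 1 <= T by rewrite /T lerDl mulr_ge0 // exprn_ge0.
have T0 : 0 <= T by lra.
exists (C + T + 1); first lra.
set a := C + T + 1; move=> delta xi1 xi2 xi3 xi4 x1 x2 x3 x4 d01 f1 f2 f3 f4.
have /andP[d0 d1] := d01; move=> same r1 r2 r3 r4 e1 e2.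
have Ca : 4 * C <= 4 * a by rewrite /a; lra.
have n1 := rect_near_curve d01 C1 (sub_far d0 Ca f1) r1; have p1 := n1.1.
have n2 := rect_near_curve d01 C1 (sub_far d0 Ca f2) r2; have p2 := n2.1.
have n3 := rect_near_curve d01 C1 (sub_far d0 Ca f3) r3; have p3 := n3.1.
have n4 := rect_near_curve d01 C1 (sub_far d0 Ca f4) r4; have p4 := n4.1.
have a1 : 1 <= a by rewrite /a; lra.
have spfar xi : far m.+2 (4 * a) delta xi -> [/\ 0 < spacing m.+2 delta `|xi|,
    delta <= spacing m.+2 delta `|xi|,
    spacing m.+2 delta `|xi| ^+ 2 * `|xi| ^+ m = delta, 0 < `|xi| <= 1 &
    C * spacing m.+2 delta `|xi| <= `|xi| / 4].
  move=> /and3P[xi0 xi1' xiM]; have s0 := spacing_gt0 m.+2 d0 xi0; split=> //.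
  - by apply: le_spacing; rewrite ?xi0.
  - exact: spacing_sqr.
  - by rewrite xi0.
  - have : C * spacing m.+2 delta `|xi| <= a * spacing m.+2 delta `|xi|.
      by rewrite ler_wpM2r ?ltW // /a; lra.
    lra.
have [s1 ds1 ss1 /andP[z1 u1] w1] := spfar _ f1.
have [s2 ds2 ss2 /andP[z2 u2] w2] := spfar _ f2.
have [s3 ds3 ss3 /andP[z3 u3] w3] := spfar _ f3.
have [s4 ds4 ss4 /andP[z4 u4] w4] := spfar _ f4.
have D13 : `|xi1 - xi3| <= a * (spacing m.+2 delta `|xi1| + spacing m.+2 delta `|xi3|) ->
  close m.+2 (a * (1 + 2 ^+ m)) delta xi1 xi3 by exact: close_of_dist.
have D24 : `|xi2 - xi4| <= a * (spacing m.+2 delta `|xi2| + spacing m.+2 delta `|xi4|) ->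
  close m.+2 (a * (1 + 2 ^+ m)) delta xi2 xi4 by exact: close_of_dist.
have D14 : `|xi1 - xi4| <= a * (spacing m.+2 delta `|xi1| + spacing m.+2 delta `|xi4|) ->
  close m.+2 (a * (1 + 2 ^+ m)) delta xi1 xi4 by exact: close_of_dist.
have D23 : `|xi2 - xi3| <= a * (spacing m.+2 delta `|xi2| + spacing m.+2 delta `|xi3|) ->
  close m.+2 (a * (1 + 2 ^+ m)) delta xi2 xi3 by exact: close_of_dist.
(* moving one abscissa by at most [delta] makes the sums of abscissae equal *)
pose y4 := x1.1 + x2.1 - x3.1.
have esum : x1.1 + x2.1 = x3.1 + y4 by rewrite /y4; ring.
have y4x4 : `|y4 - x4.1| < delta by rewrite /y4.
have b4 : `|x4.1| <= 2.
  have -> : x4.1 = xi4 + (x4.1 - xi4) by ring.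
  by apply: le_trans (ler_normD _ _) _; clear -p4 w4 u4; lra.
have by4 : `|y4| <= 3.
  have -> : y4 = x4.1 + (y4 - x4.1) by ring.
  by apply: le_trans (ler_normD _ _) _; clear -b4 y4x4 d1; lra.
have l4 : `|x4.1 ^+ m.+2 - y4 ^+ m.+2| <= m.+2%:R * 3 ^+ m.+2 * delta.
  apply: le_trans (power_lipschitz _ _ _) _ => //.
    by rewrite (le_trans b4) // ler_nat.
  rewrite distrC; apply: ler_wpM2l; last exact: ltW.
  by apply: mulr_ge0; rewrite ?ler0n // exprn_ge0.
have n0 : `|0 : R| <= 0 by rewrite normr0.
have hsum : `|x1.1 ^+ m.+2 + x2.1 ^+ m.+2 - x3.1 ^+ m.+2 - y4 ^+ m.+2|
    <= C2 * delta.
  have -> : x1.1 ^+ m.+2 + x2.1 ^+ m.+2 - x3.1 ^+ m.+2 - y4 ^+ m.+2 =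
    ((x1.2 + x2.2 - x3.2 - x4.2) + (x1.1 ^+ m.+2 - x1.2) + (x2.1 ^+ m.+2 - x2.2)
     + (x3.2 - x3.1 ^+ m.+2)) + (x4.2 - x4.1 ^+ m.+2)
    + (x4.1 ^+ m.+2 - y4 ^+ m.+2) + 0.
    move: (x1.1 ^+ m.+2) (x2.1 ^+ m.+2) (x3.1 ^+ m.+2) (x4.1 ^+ m.+2).
    by move: (y4 ^+ m.+2) => *; ring.
  have q1 := n1.2; rewrite distrC in q1; have q2 := n2.2; rewrite distrC in q2.
  apply: le_trans (ler_norm_sum4 (ler_norm_sum4 (ltW e2) q1 q2 n3.2) n4.2 l4 n0) _.
  by rewrite /C2; move: (m.+2%:R * 3 ^+ m.+2) (thickness m C) => L th; clear -d0; lra.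
clear n1 n2 n3 n4 l4.
set s := (x1.1 + x2.1) / 2.
have sgt : 3 / 4 * (`|xi1| + `|xi2|) <= 2 * `|s|.
  have -> : 2 * `|s| = `|x1.1 + x2.1|.
    by rewrite /s normrM [`|2^-1|]ger0_norm ?invr_ge0 //; field.
  have : `|xi1 + xi2| <= `|x1.1 + x2.1| + `|x1.1 - xi1| + `|x2.1 - xi2|.
    have -> : xi1 + xi2 = (x1.1 + x2.1) - (x1.1 - xi1) - (x2.1 - xi2) by ring.
    by apply: le_trans (ler_normB _ _) _; rewrite lerD2r; exact: ler_normB.
  have e12 : `|xi1| + `|xi2| = `|xi1 + xi2|.
    have [xi10|xi10] := leP 0 xi1.
      have xi20 : 0 <= xi2.
        by rewrite leNgt; apply/negP => ?; move: same; rewrite ltNge mulr_ge0_le0 // ltW.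
      by rewrite !ger0_norm // addr_ge0.
    have xi20 : xi2 <= 0.
      rewrite leNgt; apply/negP => ?; move: same.
      by rewrite ltNge mulr_le0_ge0 // ltW.
    by rewrite !ler0_norm ?opprD //; clear -xi10 xi20; lra.
  move=> h; clear -h e12 w1 w2 p1 p2; lra.
(* [|s|] dominates both [|xi1|] and [|xi2|], so that one bound serves both scales *)
have small u : `|u| ^+ 2 * `|s| ^+ m <= C2 * delta ->
    `|u| <= T * spacing m.+2 delta `|xi1| /\ `|u| <= T * spacing m.+2 delta `|xi2|.
  move=> hu.
  have gen xi : 0 < `|xi| -> `|xi| <= 4 * `|s| ->
      0 < spacing m.+2 delta `|xi| ->
      spacing m.+2 delta `|xi| ^+ 2 * `|xi| ^+ m = delta ->
      `|u| <= T * spacing m.+2 delta `|xi|.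
    move=> xi0 xis; set t := spacing _ _ _; clearbody t => t0 tt.
    apply: ler_of_sqr; first exact: (mulr_ge0 T0 (ltW t0)).
    rewrite -(ler_pM2r (exprn_gt0 m xi0)).
    apply: (@le_trans _ _ (`|u| ^+ 2 * (4 * `|s|) ^+ m)).
      by rewrite ler_wpM2l ?sqr_ge0 // lerXn2r ?nnegrE // mulr_ge0.
    have -> : `|u| ^+ 2 * (4 * `|s|) ^+ m = 4 ^+ m * (`|u| ^+ 2 * `|s| ^+ m).
      by rewrite exprMn; ring.
    apply: le_trans (ler_wpM2l (exprn_ge0 m _) hu) _ => //.
    have -> : (T * t) ^+ 2 * `|xi| ^+ m = T ^+ 2 * delta by rewrite -tt; ring.
    have -> : 4 ^+ m * (C2 * delta) = (4 ^+ m * C2) * delta by ring.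
    rewrite ler_wpM2r ?(ltW d0) //.
    apply: (@le_trans _ _ T); first by rewrite /T lerDr.
    by rewrite expr2 ler_peMl // (le_trans _ T1).
  by split; apply: gen => //; clear -sgt; have := normr_ge0 xi1; have := normr_ge0 xi2; lra.
have p1' := p1; rewrite distrC in p1'.
have p2' := p2; rewrite distrC in p2'.
have gap := power_sum_gap m esum; rewrite -/s in gap.
have {hsum} gap := le_trans gap hsum.
have sm0 : 0 <= `|s| ^+ m by rewrite exprn_ge0.
have [h|/ltW h] := leP `|x1.1 - x3.1| `|x1.1 - y4|.
  have /small[h1 h2] : `|x1.1 - x3.1| ^+ 2 * `|s| ^+ m <= C2 * delta.
    apply: le_trans gap.
    have : `|x1.1 - x3.1| ^+ 2 <= `|x1.1 - x3.1| * `|x1.1 - y4|.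
      by rewrite expr2 ler_wpM2l.
    move/(ler_wpM2l sm0).
    have : 0 <= `|s| ^+ m * (`|x1.1 - x3.1| * `|x1.1 - y4|) by rewrite !mulr_ge0.
    move=> h1 h2; clear -h1 h2; lra.
  apply/orP; left; apply/andP; split; [apply: D13 | apply: D24].
    have t0 : 0 <= T * spacing m.+2 delta `|xi3| by exact: (mulr_ge0 T0 (ltW s3)).
    have -> : xi1 - xi3 =
        (xi1 - x1.1) + (x1.1 - x3.1) + (x3.1 - xi3) + 0 by rewrite /y4; ring.
    apply: le_trans (ler_norm_sum4 p1' h1 p3 n0) _.
    by rewrite /a; clear -t0 s1 s2 s3 s4 ds1 ds2 ds3 ds4; lra.
  rewrite distrC in h2.
  have t0 : 0 <= T * spacing m.+2 delta `|xi4| by exact: (mulr_ge0 T0 (ltW s4)).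
  have -> : xi2 - xi4 =
      (xi2 - x2.1) + (x3.1 - x1.1) + (x4.1 - xi4) + (y4 - x4.1) by rewrite /y4; ring.
  apply: le_trans (ler_norm_sum4 p2' h2 p4 (ltW y4x4)) _.
  by rewrite /a; clear -t0 s1 s2 s3 s4 ds1 ds2 ds3 ds4; lra.
have /small[h1 h2] : `|x1.1 - y4| ^+ 2 * `|s| ^+ m <= C2 * delta.
    apply: le_trans gap.
  have : `|x1.1 - y4| ^+ 2 <= `|x1.1 - x3.1| * `|x1.1 - y4|.
    by rewrite expr2 ler_wpM2r.
  move/(ler_wpM2l sm0).
  have : 0 <= `|s| ^+ m * (`|x1.1 - x3.1| * `|x1.1 - y4|) by rewrite !mulr_ge0.
  move=> h1 h2; clear -h1 h2; lra.
apply/orP; right; apply/andP; split; [apply: D14 | apply: D23].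
  have t0 : 0 <= T * spacing m.+2 delta `|xi4| by exact: (mulr_ge0 T0 (ltW s4)).
  have -> : xi1 - xi4 =
      (xi1 - x1.1) + (x1.1 - y4) + (x4.1 - xi4) + (y4 - x4.1) by rewrite /y4; ring.
  apply: le_trans (ler_norm_sum4 p1' h1 p4 (ltW y4x4)) _.
  by rewrite /a; clear -t0 s1 s2 s3 s4 ds1 ds2 ds3 ds4; lra.
rewrite distrC in h2.
have t0 : 0 <= T * spacing m.+2 delta `|xi3| by exact: (mulr_ge0 T0 (ltW s3)).
have -> : xi2 - xi3 =
    (xi2 - x2.1) + (y4 - x1.1) + (x3.1 - xi3) + 0 by rewrite /y4; ring.
apply: le_trans (ler_norm_sum4 p2' h2 p3 n0) _.
by rewrite /a; clear -t0 s1 s2 s3 s4 ds1 ds2 ds3 ds4; lra.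
Qed.

(** * Counting centres *)

Lemma size_grid (T : eqType) (s : seq T) (f : T -> nat * nat) (n1 n2 : nat) :
  uniq s -> {in s &, injective f} ->
  {in s, forall x, (f x).1 < n1 /\ (f x).2 < n2}%N -> (size s <= n1 * n2)%N.
Proof.
move=> us fi fb; rewrite -(size_map f).
have -> : (n1 * n2 = size [seq (i, j) | i <- iota 0 n1, j <- iota 0 n2])%N.
  by rewrite size_allpairs !size_iota.
apply: uniq_leq_size; first by rewrite map_inj_in_uniq.
move=> _ /mapP[x xs ->]; have [h1 h2] := fb x xs.
by rewrite (surjective_pairing (f x)); apply: allpairs_f; rewrite mem_iota.
Qed.

(** The centres of one dyadic scale are separated, and only boundedly many
    dyadic scales meet a range of comparable sizes. *)
Lemma size_separated (R : realType) (m : nat) (C c delta : R) (X S : seq R)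
    (n L : nat) (u l h : R) :
  0 < delta -> canonical_covering m.+2 C c delta X -> uniq S ->
  {subset S <= X} -> 0 < u -> 0 < h ->
  h <= spacing m.+2 delta (2 ^+ n.+1 * u) ->
  {in S, forall x, u <= `|x| <= 2 ^+ n * u} ->
  {in S, forall x, l <= x <= l + L%:R * h} ->
  (size S <= (2 * n + 3) * L.+1)%N.
Proof.
move=> d0 [_ [P [sepP XP]] _] uS SX u0 h0 hs Su Sl.
have j_ex x : exists j : int, x \in S -> [/\ dyadic_scales m.+2 c delta j, P j x &
    u <= 2 ^ j <= 2 ^+ n.+1 * u].
  have [xS|xS] := boolP (x \in S); last by exists 0.
  have : [set` X] x by exact: SX.
  have /andP[ux xu] := Su x xS.
  rewrite XP => -[/= x0|[j /= jD jP]].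
    by move: ux; rewrite x0 normr0 leNgt u0.
  exists j => _; split=> //; have [/(_ x jP) /= /andP[a1 a2] _ _] := sepP j jD.
  by rewrite (le_trans ux a2) exprS /=; lra.
pose jj x := projT1 (cid (j_ex x)).
have jjP x : x \in S -> _ := projT2 (cid (j_ex x)).
rewrite -/(jj _) in jjP.
have [S0|[x0 x0S]] : S = [::] \/ exists x, x \in S.
- by case: (S) => [|x ?]; [left | right; exists x; rewrite mem_head].
- by rewrite S0.
have jle x y : x \in S -> y \in S -> jj x <= jj y + n.+1%:Z.
  move=> /jjP[_ _ /andP[_ h1]] /jjP[_ _ /andP[h2 _]].
  have : (2 : R) ^ (jj x) <= 2 ^ (jj y + n.+1%:Z).
    rewrite expfzDr ?pnatr_eq0 // mulrC; apply: le_trans h1 _.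
    by rewrite -exprnP ler_wpM2l // exprn_ge0.
  by rewrite ler_eXz2l // ltr1n.
(* a centre is determined by its scale and by its cell of length [h] *)
pose f x := (absz (jj x - jj x0 + n.+1%:Z)%R, Num.truncn ((x - l) / h)).
apply: (size_grid (f := f)) => // [x y xS yS [fj ft]|x xS /=].
  apply/eqP; apply: contraT => xy.
  have jxy : jj x = jj y.
    have := jle x x0 xS x0S; have := jle x0 x x0S xS.
    have := jle y x0 yS x0S; have := jle x0 y x0S yS; lia.
  have [jD jP /andP[_ ju]] := jjP x xS; have [_ jP' _] := jjP y yS.
  rewrite -/(jj _) -jxy in jP'.
  have [_ /(_ x y jP jP' xy) sep _] := sepP _ jD.
  have : spacing m.+2 delta (2 ^+ n.+1 * u) <= spacing m.+2 delta (2 ^ jj x).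
    have r0 : 0 < 2 ^+ n.+1 * u by rewrite mulr_gt0 // exprn_gt0.
    have r'0 : 0 < (2 : R) ^ jj x by rewrite exprz_gt0.
    have := spacing_compare m d0 (lexx 1) r'0 r0.
    by rewrite expr1n !mul1r; apply.
  move/le_trans => /(_ _ sep) /(le_trans hs) hxy.
  have /andP[lx _] := Sl x xS; have /andP[ly _] := Sl y yS.
  have /truncn_itv/andP : 0 <= (x - l) / h by rewrite divr_ge0 ?subr_ge0 ?(ltW h0).
  have /truncn_itv/andP : 0 <= (y - l) / h by rewrite divr_ge0 ?subr_ge0 ?(ltW h0).
  rewrite ft; set t := Num.truncn _; rewrite !ler_pdivlMr // !ltr_pdivrMr //.
  rewrite -[t.+1]addn1 natrD mulrDl mul1r => -[a1 a2] [a3 a4].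
  exfalso; move: hxy; rewrite leNgt => /negP; apply;
    by rewrite ltr_norml; clear -a1 a2 a3 a4; lra.
split.
  have := jle x x0 xS x0S; have := jle x0 x x0S xS; lia.
have /andP[lx xl] := Sl x xS.
rewrite ltnS truncn_le_nat ltr_pdivrMr //.
by rewrite -[L.+1]addn1 natrD mulrDl mul1r; lra.
Qed.

(** Their sizes lie within a factor [4] of each other, and they lie in an interval
    of boundedly many spacings. *)
Lemma count_close (R : realType) (m : nat) (D : R) : 0 <= D ->
  exists N : nat, forall (C c delta : R) (X : seq R) (x : R),
  0 < delta -> canonical_covering m.+2 C c delta X -> x != 0 ->
  (size [seq y <- X | close m.+2 D delta x y] <= N)%N.
Proof.
move=> D0; pose L := (Num.truncn (2 * D * 4 ^+ m)).+1.
exists ((2 * 2 + 3) * L.+1)%N => C c delta X x d0 cX x0.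
have xp : 0 < `|x| by rewrite normr_gt0.
set s := spacing m.+2 delta `|x|.
have s0 : 0 < s by exact: spacing_gt0.
have q0 : 0 < (4 : R) ^+ m by rewrite exprn_gt0.
have [uX _ _] := cX.
apply: (@size_separated _ m C c delta X _ 2 L (`|x| / 2) (x - D * s) (s / 4 ^+ m)) => //.
- by rewrite filter_uniq.
- by move=> y; rewrite mem_filter => /andP[].
- by rewrite divr_gt0.
- by rewrite divr_gt0.
- rewrite ler_pdivrMr // mulrC; apply: spacing_compare => //; rewrite ?ler1n //.
    by rewrite mulr_gt0 ?exprn_gt0 ?divr_gt0.
  by rewrite exprS expr2; lra.
- move=> y; rewrite mem_filter => /andP[/and4P[_ _ h1 h2] _].
  by rewrite expr2; apply/andP; split; lra.
- move=> y; rewrite mem_filter => /andP[/and4P[h1 _ _ _] _].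
  have hL : 2 * D * s <= L%:R * (s / 4 ^+ m).
    rewrite mulrA ler_pdivlMr // mulrAC ler_wpM2r ?(ltW s0) //.
    by apply/ltW; exact: truncnS_gt.
  move: h1; rewrite -/s ler_norml => /andP[h1 h2].
  by apply/andP; split; lra.
Qed.

(** The centres that are not far from the origin lie within [M delta^(1/k)] of
    it, and hence in boundedly many dyadic scales. *)
Lemma count_not_far (R : realType) (m : nat) (M c : R) : 1 <= M -> 0 < c ->
  exists N : nat, forall (C delta : R) (X : seq R),
  0 < delta -> canonical_covering m.+2 C c delta X ->
  (size [seq y <- X | ~~ far m.+2 M delta y] <= N)%N.
Proof.
move=> M1 c0.
pose n := (Num.truncn (2 * M / c)).+1.
pose q : R := 1 + 2 ^+ n * c.
pose L := (Num.truncn (2 * M * q ^+ m)).+1.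
exists ((2 * n + 3) * L.+1).+1 => C delta X d0 cX.
pose r := delta `^ (m.+2%:R^-1).
have r0 : 0 < r by rewrite powR_gt0.
have rk : r ^+ m.+2 = delta.
  by rewrite -powR_mulrn ?ltW // -powRrM mulVf ?pnatr_eq0 // powRr1 // ltW.
have sr : spacing m.+2 delta r = r.
  apply/eqP; rewrite -(eqrXn2 (n := 2)) ?ltW ?spacing_gt0 //; apply/eqP.
  apply: (mulIf (lt0r_neq0 (exprn_gt0 m r0))).
  by rewrite spacing_sqr // -exprD.
have q1 : 1 <= q by rewrite /q lerDl mulr_ge0 ?exprn_ge0 // ltW.
have qm : 0 < q ^+ m by rewrite exprn_gt0 //; lra.
have [uX [P [sepP XP]] _] := cX.
set S := [seq y <- X | (y != 0) && ~~ far m.+2 M delta y].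
have sizeS : (size S <= (2 * n + 3) * L.+1)%N.
  have memS y : y \in S -> [/\ y \in X, c * r / 2 <= `|y| & `|y| <= M * r].
    rewrite mem_filter => /andP[/andP[y0 yfar] yX]; split=> //.
      have : [set` X] y by [].
      rewrite XP => -[/= /eqP|[j /= jD jP]]; first by rewrite (negbTE y0).
      have [/(_ y jP) /= /andP[a1 a2] _ _] := sepP j jD.
      move: jD => /= /andP[a3 _]; apply: le_trans a1.
      by rewrite ler_pM2r ?invr_gt0 //.
    have yp : 0 < `|y| by rewrite normr_gt0.
    have y1 : `|y| <= 1.
      have : [set` X] y by [].
      rewrite XP => -[/= /eqP|[j /= jD jP]]; first by rewrite (negbTE y0).
      have [/(_ y jP) /= /andP[a1 a2] _ _] := sepP j jD.
      by move: jD => /= /andP[_ a3]; apply: le_trans a3.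
    move: yfar; rewrite /far yp y1 /= -ltNge => yM.
    have s0 := spacing_gt0 m.+2 d0 yp; have ss := spacing_sqr m d0 yp.
    rewrite leNgt; apply/negP => My.
    have : spacing m.+2 delta `|y| <= spacing m.+2 delta r.
      have ry : r <= 1 * `|y| by nra.
      by have := spacing_compare m d0 (lexx 1) r0 yp ry; rewrite expr1n mul1r.
    rewrite sr => sy.
    have : M * spacing m.+2 delta `|y| <= M * r by rewrite ler_wpM2l //; lra.
    lra.
  apply: (@size_separated _ m C c delta X _ n L (c * r / 2) (- (M * r)) (r / q ^+ m)) => //.
  - by rewrite filter_uniq.
  - by move=> y /memS[].
  - by rewrite divr_gt0 // mulr_gt0.
  - by rewrite divr_gt0.
  - rewrite ler_pdivrMr // mulrC -{1}sr; apply: spacing_compare => //.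
      by apply: mulr_gt0; rewrite ?exprn_gt0 ?divr_gt0 ?mulr_gt0.
    have -> : 2 ^+ n.+1 * (c * r / 2) = (2 ^+ n * c) * r.
      by rewrite exprS; field.
    by rewrite ler_wpM2r ?ltW // /q; lra.
  - move=> y /memS[_ h1 h2]; rewrite h1 /=; apply: le_trans h2 _.
    have : 2 * M / c <= 2 ^+ n.
      apply: le_trans (ltW (truncnS_gt _)) _.
      by rewrite -/n -natrX ler_nat ltnW // ltn_expl.
    rewrite ler_pdivrMr // => h.
    have := ler_wpM2r (ltW r0) h; lra.
  - move=> y /memS[_ _]; rewrite ler_norml => /andP[h1 h2].
    have hL : 2 * M * r <= L%:R * (r / q ^+ m).
      rewrite mulrA ler_pdivlMr // mulrAC ler_wpM2r ?(ltW r0) //.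
      by apply/ltW; exact: truncnS_gt.
    by apply/andP; split; lra.
apply: (@leq_trans (size (0 :: S))); last by rewrite /= ltnS.
apply: uniq_leq_size; first by rewrite filter_uniq.
move=> y; rewrite mem_filter in_cons mem_filter => /andP[-> ->].
by case: eqVneq.
Qed.

(** * Integration of complex functions on the plane *)

Definition cmeasurable (R : realType) d (T : measurableType d) (f : T -> R[i]) : Prop :=
  measurable_fun setT (fun x => complex.Re (f x)) /\
  measurable_fun setT (fun x => complex.Im (f x)).

Definition cintegrable (R : realType)
    (f : measurableTypeR R * measurableTypeR R -> R[i]) : Prop :=
  (lebesgue2 R).-integrable setT (fun x => (complex.Re (f x))%:E) /\
  (lebesgue2 R).-integrable setT (fun x => (complex.Im (f x))%:E).

Lemma ReM (R : realType) (x y : R[i]) :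
  complex.Re (x * y) = complex.Re x * complex.Re y - complex.Im x * complex.Im y.
Proof. by case: x; case: y. Qed.

Lemma ImM (R : realType) (x y : R[i]) :
  complex.Im (x * y) = complex.Re x * complex.Im y + complex.Im x * complex.Re y.
Proof. by case: x; case: y. Qed.

Lemma ReD (R : realType) (x y : R[i]) :
  complex.Re (x + y) = complex.Re x + complex.Re y.
Proof. by case: x; case: y. Qed.

Lemma ImD (R : realType) (x y : R[i]) :
  complex.Im (x + y) = complex.Im x + complex.Im y.
Proof. by case: x; case: y. Qed.

Lemma normr_Re_le (R : realType) (z : R[i]) : `|complex.Re z| <= Normc.normc z.
Proof.
case: z => a b /=; rewrite -sqrtr_sqr ler_wsqrtr // lerDl sqr_ge0 //.
Qed.

Lemma normr_Im_le (R : realType) (z : R[i]) : `|complex.Im z| <= Normc.normc z.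
Proof.
case: z => a b /=; rewrite -sqrtr_sqr ler_wsqrtr // lerDr sqr_ge0 //.
Qed.

Lemma normc_ge0 (R : realType) (z : R[i]) : 0 <= Normc.normc z.
Proof. by case: z => a b /=; exact: sqrtr_ge0. Qed.

Lemma normc_le_ReIm (R : realType) (z : R[i]) :
  Normc.normc z <= `|complex.Re z| + `|complex.Im z|.
Proof.
case: z => a b /=; rewrite -[leRHS]ger0_norm ?addr_ge0 // -sqrtr_sqr.
rewrite ler_wsqrtr // sqrrD !real_normK ?num_real //.
have := mulr_ge0 (normr_ge0 a) (normr_ge0 b); lra.
Qed.

Section CMeasurable.
Context {R : realType} {d} {T : measurableType d}.
Implicit Types f g : T -> R[i].

Lemma cmeasurableM f g : cmeasurable f -> cmeasurable g ->
  cmeasurable (fun x => f x * g x).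
Proof.
move=> [fr fi] [gr gi]; split.
  under eq_fun do rewrite ReM.
  by apply: measurable_funB; apply: measurable_funM.
under eq_fun do rewrite ImM.
by apply: measurable_funD; apply: measurable_funM.
Qed.

Lemma cmeasurableD f g : cmeasurable f -> cmeasurable g ->
  cmeasurable (fun x => f x + g x).
Proof.
move=> [fr fi] [gr gi]; split.
  by under eq_fun do rewrite ReD; apply: measurable_funD.
by under eq_fun do rewrite ImD; apply: measurable_funD.
Qed.

Lemma cmeasurable_cst (z : R[i]) : cmeasurable (fun _ : T => z).
Proof. by split; exact: measurable_cst. Qed.

Lemma cmeasurable_conj f : cmeasurable f -> cmeasurable (fun x => conjc (f x)).
Proof.
move=> [fr fi]; split.
  by rewrite (_ : (fun _ => _) = fun x => complex.Re (f x)) //; apply/funext => x; case: (f x).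
rewrite (_ : (fun _ => _) = fun x => - complex.Im (f x)); first exact: measurable_funN.
by apply/funext => x; case: (f x).
Qed.

Lemma cmeasurable_cis (f : T -> R) : measurable_fun setT f ->
  cmeasurable (fun x => cis (f x)).
Proof.
move=> mf; split => /=.
  apply: (@measurableT_comp _ _ _ _ _ _ (@cos R)) => //.
  by apply: continuous_measurable_fun; exact: continuous_cos.
apply: (@measurableT_comp _ _ _ _ _ _ (@sin R)) => //.
by apply: continuous_measurable_fun; exact: continuous_sin.
Qed.

Lemma cmeasurable_real (f : T -> R) : measurable_fun setT f ->
  cmeasurable (fun x => real_complex R (f x)).
Proof. by move=> mf; split. Qed.

Lemma measurable_normc f : cmeasurable f ->
  measurable_fun setT (fun x => Normc.normc (f x)).
Proof.
move=> [fr fi].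
rewrite (_ : (fun _ => _) = fun x => Num.sqrt (complex.Re (f x) ^+ 2 + complex.Im (f x) ^+ 2)).
  apply: (@measurableT_comp _ _ _ _ _ _ (@Num.sqrt R)) => //.
    by apply: continuous_measurable_fun; exact: sqrt_continuous.
  by apply: measurable_funD; apply: measurable_funX.
by apply/funext => x; case: (f x).
Qed.

Lemma cmeasurable_comp d' (T' : measurableType d') (h : T' -> T) f :
  measurable_fun setT h -> cmeasurable f -> cmeasurable (fun x => f (h x)).
Proof.
move=> mh [fr fi].
by split; [exact: (measurableT_comp fr mh) | exact: (measurableT_comp fi mh)].
Qed.

End CMeasurable.

Section CIntegrable.
Context {R : realType}.
Local Notation mu := (lebesgue2 R).
Local Notation plane := (measurableTypeR R * measurableTypeR R)%type.
Implicit Types f g : plane -> R[i].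

Lemma cintegrable_measurable f : cintegrable f -> cmeasurable f.
Proof.
by move=> [/measurable_int/measurable_EFinP fr /measurable_int/measurable_EFinP fi].
Qed.

Lemma integrable_le (f g : plane -> R) : measurable_fun setT f ->
  mu.-integrable setT (fun x => (g x)%:E) -> (forall x, `|f x| <= g x) ->
  mu.-integrable setT (fun x => (f x)%:E).
Proof.
move=> mf ig fg; apply: le_integrable ig => //; first exact/measurable_EFinP.
by move=> x _ /=; rewrite lee_fin (le_trans (fg x)) // ler_norm.
Qed.

Lemma cintegrable_le f (g : plane -> R) : cmeasurable f ->
  mu.-integrable setT (fun x => (g x)%:E) ->
  (forall x, Normc.normc (f x) <= g x) -> cintegrable f.
Proof.
move=> [mr mi] ig fg; split; apply: (integrable_le _ ig) => // x.
  exact: le_trans (normr_Re_le _) (fg x).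
exact: le_trans (normr_Im_le _) (fg x).
Qed.

Lemma integrable_normc f : cintegrable f ->
  mu.-integrable setT (fun x => (Normc.normc (f x))%:E).
Proof.
move=> cf; have [ir ii] := cf.
apply: (@integrable_le _ (fun x => `|complex.Re (f x)| + `|complex.Im (f x)|)).
- exact/measurable_normc/cintegrable_measurable.
- under eq_fun do rewrite EFinD; apply: integrableD => //.
    exact: integrable_abse ir.
  exact: integrable_abse ii.
- by move=> x; rewrite ger0_norm ?normc_ge0 // normc_le_ReIm.
Qed.

Lemma cintegrableD f g : cintegrable f -> cintegrable g ->
  cintegrable (fun x => f x + g x).
Proof.
move=> [fr fi] [gr gi]; split.
  by under eq_fun do rewrite ReD EFinD; exact: integrableD.
by under eq_fun do rewrite ImD EFinD; exact: integrableD.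
Qed.

Lemma cintegralD f g : cintegrable f -> cintegrable g ->
  cintegral2 (fun x => f x + g x) = cintegral2 f + cintegral2 g.
Proof.
move=> [fr fi] [gr gi]; rewrite /cintegral2.
under eq_Rintegral do rewrite ReD.
under [in X in Complex _ X]eq_Rintegral do rewrite ImD.
by rewrite !RintegralD.
Qed.

Lemma cintegrableZ (z : R[i]) f : cintegrable f -> cintegrable (fun x => z * f x).
Proof.
move=> [fr fi]; split.
  under eq_fun do rewrite ReM EFinB EFinM [in X in (_ - X)%E]EFinM.
  by apply: integrableB => //; apply: integrableZl.
under eq_fun do rewrite ImM EFinD EFinM [in X in (_ + X)%E]EFinM.
by apply: integrableD => //; apply: integrableZl.
Qed.

Lemma integrable_scale (r : R) (h : plane -> R) : mu.-integrable setT (fun x => (h x)%:E) ->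
  mu.-integrable setT (fun x => (r * h x)%:E).
Proof. by move=> ih; under eq_fun do rewrite EFinM; exact: integrableZl. Qed.

Lemma cintegralZ (z : R[i]) f : cintegrable f ->
  cintegral2 (fun x => z * f x) = z * cintegral2 f.
Proof.
move=> [fr fi]; rewrite /cintegral2.
under eq_Rintegral do rewrite ReM.
under [in X in Complex _ X]eq_Rintegral do rewrite ImM.
rewrite RintegralB //; [|exact: integrable_scale..].
rewrite RintegralD //; [|exact: integrable_scale..].
by rewrite !RintegralZl //; case: z.
Qed.

Lemma cintegrable_sum (I : eqType) (s : seq I) (f : I -> plane -> R[i]) :
  {in s, forall i, cintegrable (f i)} -> cintegrable (fun x => \sum_(i <- s) f i x).
Proof.
elim: s => [|i s IH] cf.
  by under eq_fun do rewrite big_nil; split; exact: integrable0.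
under eq_fun do rewrite big_cons.
apply: cintegrableD; first by apply: cf; exact: mem_head.
by apply: IH => j js; apply: cf; rewrite in_cons js orbT.
Qed.

Lemma cintegral_sum (I : eqType) (s : seq I) (f : I -> plane -> R[i]) :
  {in s, forall i, cintegrable (f i)} ->
  cintegral2 (fun x => \sum_(i <- s) f i x) = \sum_(i <- s) cintegral2 (f i).
Proof.
elim: s => [|i s IH] cf.
  under [in LHS]eq_fun do rewrite big_nil.
  by rewrite big_nil /cintegral2 /Rintegral /= !integral0.
have cfs : {in s, forall i, cintegrable (f i)}.
  by move=> j js; apply: cf; rewrite in_cons js orbT.
under [in LHS]eq_fun do rewrite big_cons.
rewrite big_cons cintegralD ?IH //; last exact: cintegrable_sum.
by apply: cf; exact: mem_head.
Qed.

Lemma cintegral_conj f : cintegrable f ->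
  cintegral2 (fun x => conjc (f x)) = conjc (cintegral2 f).
Proof.
move=> [fr fi]; rewrite /cintegral2 /=; congr Complex.
  by apply: eq_Rintegral => x _; case: (f x).
rewrite -mulN1r -RintegralZl //; apply: eq_Rintegral => x _.
by case: (f x) => a b; rewrite mulN1r.
Qed.

(** The constant [2] comes from estimating the two parts separately. *)
Lemma normc_cintegral_le f (g : plane -> R) : cintegrable f ->
  mu.-integrable setT (fun x => (g x)%:E) ->
  (forall x, Normc.normc (f x) <= g x) ->
  Normc.normc (cintegral2 f) <= 2 * \int[mu]_x g x.
Proof.
move=> [fr fi] ig fg; apply: le_trans (normc_le_ReIm _) _ => /=.
rewrite mulrDl mul1r; apply: lerD; apply: le_trans (le_normr_Rintegral _ _) _ => //.
  apply: le_Rintegral => //; first exact: integrable_abse fr.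
  by move=> x _; exact: le_trans (normr_Re_le _) (fg x).
apply: le_Rintegral => //; first exact: integrable_abse fi.
by move=> x _; exact: le_trans (normr_Im_le _) (fg x).
Qed.

End CIntegrable.

(** * Products and iterated integrals *)

Section Tensor.
Context {R : realType} d1 d2 (T1 : measurableType d1) (T2 : measurableType d2).
Variables (m1 : {sigma_finite_measure set T1 -> \bar R})
          (m2 : {sigma_finite_measure set T2 -> \bar R}).

Lemma integrable_tensor (f : T1 -> R) (g : T2 -> R) :
  m1.-integrable setT (fun x => (f x)%:E) ->
  m2.-integrable setT (fun y => (g y)%:E) ->
  (m1 \x m2)%E.-integrable setT (fun z => (f z.1 * g z.2)%:E).
Proof.
move=> intf intg.
have mf : measurable_fun setT f by exact/measurable_EFinP/(measurable_int _ intf).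
have mg : measurable_fun setT g by exact/measurable_EFinP/(measurable_int _ intg).
apply/integrable12ltyP.
  apply/measurable_EFinP; apply: measurable_funM.
    exact: (measurableT_comp mf measurable_fst).
  exact: (measurableT_comp mg measurable_snd).
have fing := integrable_fin_num measurableT (integrable_abse intg).
under eq_integral => x _.
  under eq_integral => y _ do rewrite /= normrM EFinM.
  rewrite ge0_integralZl //=; last exact: measurable_int (integrable_abse intg).
  rewrite -(fineK fing) muleC; over.
rewrite /= ge0_integralZl //=.
- apply: lte_mul_pinfty; rewrite ?lee_fin ?fine_ge0 ?integral_ge0 //.
  by have /integrableP[_] := intf.
- exact: measurable_int (integrable_abse intf).
- by rewrite lee_fin fine_ge0 ?integral_ge0 //.
Qed.

Lemma Rintegral_tensor (f : T1 -> R) (g : T2 -> R) :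
  m1.-integrable setT (fun x => (f x)%:E) ->
  m2.-integrable setT (fun y => (g y)%:E) ->
  \int[(m1 \x m2)%E]_z (f z.1 * g z.2) = (\int[m1]_x f x) * (\int[m2]_y g y).
Proof.
move=> intf intg; have intfg := integrable_tensor intf intg.
rewrite /Rintegral -integral12_prod_meas1 // /fubini_F /=.
have fing := integrable_fin_num measurableT intg.
have finf := integrable_fin_num measurableT intf.
under eq_integral => x _.
  under eq_integral => y _ do rewrite /= EFinM.
  rewrite integralZl // -(fineK fing) muleC; over.
by rewrite /= integralZl // fineM // mulrC.
Qed.

Lemma Rintegral_Fubini (f : T1 * T2 -> R) :
  (m1 \x m2)%E.-integrable setT (fun z => (f z)%:E) ->
  (forall x, m2.-integrable setT (fun y => (f (x, y))%:E)) ->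
  (forall y, m1.-integrable setT (fun x => (f (x, y))%:E)) ->
  \int[m1]_x (\int[m2]_y f (x, y)) = \int[m2]_y (\int[m1]_x f (x, y)).
Proof.
move=> intf int2 int1; have := Fubini intf; rewrite {1 2}/Rintegral => fub.
under eq_integral => x _ do rewrite fineK ?(integrable_fin_num measurableT (int2 x)) //.
rewrite /= fub; congr fine; apply: eq_integral => y _.
by rewrite fineK // (integrable_fin_num measurableT (int1 y)).
Qed.

(** Adding the integrable majorant makes the integrand nonnegative, so that
    Tonelli's theorem applies. *)
Lemma measurable_section_integral (f : T1 * T2 -> R) (g : T2 -> R) :
  measurable_fun setT f -> m2.-integrable setT (fun y => (g y)%:E) ->
  (forall z, `|f z| <= g z.2) ->
  measurable_fun setT (fun x => \int[m2]_y f (x, y)).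
Proof.
move=> mf intg fg.
have mg : measurable_fun setT g by exact/measurable_EFinP/(measurable_int _ intg).
have mf2 x : measurable_fun setT (fun y => f (x, y)).
  exact: (measurableT_comp mf (pair1_measurable x)).
have intf x : m2.-integrable setT (fun y => (f (x, y))%:E).
  apply: le_integrable intg => //; first exact/measurable_EFinP.
  by move=> y _ /=; rewrite lee_fin (le_trans (fg (x, y))) // ler_norm.
rewrite (_ : (fun _ => _) = fun x =>
    fine (\int[m2]_y (f (x, y) + g y)%:E)%E - \int[m2]_y g y); last first.
  apply/funext => x; rewrite -[fine _]/(\int[m2]_y (f (x, y) + g y)).
  by rewrite RintegralD //; [rewrite addrK | exact: intf].
apply: measurable_funB => //.
apply: (measurableT_comp (@fine_measurable R _ measurableT)) => //.
apply: (measurable_fun_fubini_tonelli_F (m2 := m2) (fun z => (f z + g z.2)%:E)).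
  apply/measurable_EFinP; apply: measurable_funD => //.
  exact: (measurableT_comp mg measurable_snd).
by move=> z; rewrite lee_fin; have := fg z; rewrite ler_norml => /andP[]; lra.
Qed.

End Tensor.

(** * Oscillatory integrals *)

Lemma lebesgue2_sigma_finite (R : realType) : sigma_finite setT (lebesgue2 R).
Proof.
have /sigma_finiteP[F [TF ndF Foo]] := sigma_finiteT (@lebesgue_measure R).
exists (fun n => F n `*` F n).
  rewrite -setXTT TF predeqE => -[x y]; split.
    move=> [/= [n _ Fnx] [k _ Fky]]; exists (maxn n k) => //; split.
      by move: x Fnx; exact/subsetPset/ndF/leq_maxl.
    by move: y Fky; exact/subsetPset/ndF/leq_maxr.
  by move=> [n _ []/= ? ?]; split; exists n.
move=> n; have [mF Foon] := Foo n; split; first exact: measurableX.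
have -> : lebesgue2 R (F n `*` F n) =
    (@lebesgue_measure R (F n) * @lebesgue_measure R (F n))%E.
  exact: product_measure1E.
by rewrite lte_mul_pinfty // ge0_fin_numE.
Qed.

(** The same measure, as a sigma-finite one: this is what Fubini's theorem on the
    product of two planes asks for. *)
Definition plane_fun (R : realType) : set (measurableTypeR R * measurableTypeR R)%type -> \bar R :=
  lebesgue2 R.
HB.instance Definition _ (R : realType) := Measure.copy (@plane_fun R) (lebesgue2 R).
HB.instance Definition _ (R : realType) :=
  Measure_isSigmaFinite.Build _ _ _ (@plane_fun R) (@lebesgue2_sigma_finite R).
Definition plane_measure (R : realType) :
  {sigma_finite_measure set (measurableTypeR R * measurableTypeR R)%type -> \bar R} :=
  @plane_fun R.

Lemma normc_cis (R : realType) (t : R) : Normc.normc (cis t) = 1.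
Proof. by rewrite /cis /= cos2Dsin2 sqrtr1. Qed.

Lemma cisD (R : realType) (s t : R) : cis (s + t) = cis s * cis t.
Proof.
rewrite /cis cosD sinD; congr Complex.
by rewrite addrC [cos s * _]mulrC [sin s * _]mulrC addrC mulrC [_ * cos s]mulrC.
Qed.

Lemma conjc_cis (R : realType) (t : R) : conjc (cis t) = cis (- t).
Proof. by rewrite /cis cosN sinN. Qed.

Lemma dot2C (R : realType) (x y : R * R) : dot2 x y = dot2 y x.
Proof. by rewrite /dot2; ring. Qed.

(** One definition for the Fourier transform, [s = - 2 pi], and its inverse,
    [s = 2 pi]. *)
Definition osc (R : realType) (s : R) (f : R * R -> R[i]) (x : R * R) : R[i] :=
  cintegral2 (fun y => cis (s * dot2 x y) * f y).

Lemma inv_fourier2E (R : realType) (f : R * R -> R[i]) :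
  inv_fourier2 f = osc (2 * pi) f.
Proof. by []. Qed.

Lemma fourier2E (R : realType) (f : R * R -> R[i]) :
  fourier2 f = osc (- (2 * pi)) f.
Proof.
apply/funext => x; rewrite /fourier2 /osc; congr cintegral2.
by apply/funext => y; rewrite mulNr dot2C.
Qed.

Section Osc.
Context {R : realType}.
Local Notation mu := (lebesgue2 R).
Local Notation plane := (measurableTypeR R * measurableTypeR R)%type.
Implicit Types f g h : plane -> R[i].

Lemma measurable_dot2 d (T : measurableType d) (u v : T -> plane) :
  measurable_fun setT u -> measurable_fun setT v ->
  measurable_fun setT (fun x => dot2 (u x) (v x)).
Proof.
move=> mu mv; apply: measurable_funD; apply: measurable_funM;
  by [exact: (measurableT_comp measurable_fst) | exact: (measurableT_comp measurable_snd)].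
Qed.

Lemma cmeasurable_osc_kernel (s : R) d (T : measurableType d) (u v : T -> plane) :
  measurable_fun setT u -> measurable_fun setT v ->
  cmeasurable (fun x => cis (s * dot2 (u x) (v x))).
Proof.
by move=> mu mv; apply: cmeasurable_cis; apply: measurable_funM => //; exact: measurable_dot2.
Qed.

Lemma cintegrable_osc s f x : cintegrable f ->
  cintegrable (fun y => cis (s * dot2 x y) * f y).
Proof.
move=> cf; apply: cintegrable_le (integrable_normc cf) _.
  by apply: cmeasurableM (cintegrable_measurable cf); exact: cmeasurable_osc_kernel.
by move=> y; rewrite Normc.normcM normc_cis mul1r.
Qed.

Lemma normc_osc_le s f x : cintegrable f ->
  Normc.normc (osc s f x) <= 2 * \int[mu]_y Normc.normc (f y).
Proof.
move=> cf; apply: normc_cintegral_le (cintegrable_osc _ _ cf) (integrable_normc cf) _.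
by move=> y; rewrite Normc.normcM normc_cis mul1r.
Qed.

Lemma cmeasurable_osc s f : cintegrable f -> cmeasurable (osc s f).
Proof.
move=> cf; have mf := cintegrable_measurable cf.
pose F (z : plane * plane) := cis (s * dot2 z.1 z.2) * f z.2.
have [mr mi] : cmeasurable F.
  apply: cmeasurableM; first exact: cmeasurable_osc_kernel.
  exact: cmeasurable_comp mf.
have Ff z : Normc.normc (F z) <= Normc.normc (f z.2).
  by rewrite Normc.normcM normc_cis mul1r.
split.
  apply: (measurable_section_integral (m2 := plane_measure R) mr (integrable_normc cf)).
  by move=> z; exact: le_trans (normr_Re_le _) (Ff z).
apply: (measurable_section_integral (m2 := plane_measure R) mi (integrable_normc cf)).
by move=> z; exact: le_trans (normr_Im_le _) (Ff z).
Qed.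

(** The multiplication formula: the kernel is symmetric, so by Fubini the
    oscillatory integral can be moved from one factor to the other. *)
Lemma osc_duality s f h : cintegrable f -> cintegrable h ->
  cintegral2 (fun x => osc s f x * h x) = cintegral2 (fun y => f y * osc s h y).
Proof.
move=> cf ch; have mf := cintegrable_measurable cf.
have mh := cintegrable_measurable ch.
pose F (z : plane * plane) := h z.1 * (cis (s * dot2 z.1 z.2) * f z.2).
have [mr mi] : cmeasurable F.
  apply: cmeasurableM; first exact: cmeasurable_comp mh.
  apply: cmeasurableM; first exact: cmeasurable_osc_kernel.
  exact: cmeasurable_comp mf.
have Fb z : Normc.normc (F z) <= Normc.normc (h z.1) * Normc.normc (f z.2).
  by rewrite !Normc.normcM normc_cis mul1r.
have intb := integrable_tensor (m1 := plane_measure R) (m2 := plane_measure R)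
  (integrable_normc ch) (integrable_normc cf).
have [ir ii] : (plane_measure R \x plane_measure R)%E.-integrable setT
    (fun z => (complex.Re (F z))%:E) /\
  (plane_measure R \x plane_measure R)%E.-integrable setT
    (fun z => (complex.Im (F z))%:E).
  split; apply: le_integrable intb => //; try exact/measurable_EFinP;
    move=> z _ /=; rewrite lee_fin (le_trans _ (ler_norm _)) //;
    apply: le_trans _ (Fb z); [exact: normr_Re_le | exact: normr_Im_le].
have c1 x : cintegrable (fun y => F (x, y)).
  exact: (cintegrableZ (h x) (cintegrable_osc s x cf)).
have FE x y : F (x, y) = f y * (cis (s * dot2 y x) * h x).
  by rewrite /F /= (dot2C x); ring.
have c2 y : cintegrable (fun x => F (x, y)).
  under eq_fun do rewrite FE.
  exact: (cintegrableZ (f y) (cintegrable_osc s y ch)).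
have -> : (fun x => osc s f x * h x) = fun x => cintegral2 (fun y => F (x, y)).
  by apply/funext => x; rewrite mulrC -(cintegralZ (h x) (cintegrable_osc s x cf)).
have -> : (fun y => f y * osc s h y) = fun y => cintegral2 (fun x => F (x, y)).
  apply/funext => y; under [in RHS]eq_fun do rewrite FE.
  by rewrite (cintegralZ (f y) (cintegrable_osc s y ch)).
have hr := Rintegral_Fubini (m1 := plane_measure R) (m2 := plane_measure R) ir
  (fun x => (c1 x).1) (fun y => (c2 y).1).
have hi := Rintegral_Fubini (m1 := plane_measure R) (m2 := plane_measure R) ii
  (fun x => (c1 x).2) (fun y => (c2 y).2).
exact: (f_equal2 (@Complex R) hr hi).
Qed.

(** By duality only the frequencies [y] with [f y != 0] matter.  Repeated use
    peels the factors off a product of transforms, one by one. *)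
Lemma osc_multiplier_bound s t f h (M : R) (eta : plane) :
  cintegrable f -> cintegrable h ->
  (forall y, f y != 0 -> Normc.normc
     (cintegral2 (fun x => cis (t * dot2 x eta + s * dot2 x y) * h x)) <= M) ->
  Normc.normc (cintegral2 (fun x => cis (t * dot2 x eta) * (osc s f x * h x)))
    <= 2 * (\int[mu]_y Normc.normc (f y)) * M.
Proof.
move=> cf ch hM.
have ch' : cintegrable (fun x => cis (t * dot2 x eta) * h x).
  by under eq_fun do rewrite dot2C; exact: cintegrable_osc.
have -> : (fun x => cis (t * dot2 x eta) * (osc s f x * h x)) =
    fun x => osc s f x * (cis (t * dot2 x eta) * h x).
  by apply/funext => x; rewrite mulrCA.
rewrite osc_duality //.
have bnd y : Normc.normc (f y * osc s (fun x => cis (t * dot2 x eta) * h x) y)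
    <= M * Normc.normc (f y).
  have [->|fy] := eqVneq (f y) 0; first by rewrite mul0r Normc.normc0 mulr0.
  rewrite Normc.normcM mulrC ler_wpM2r ?normc_ge0 //.
  apply: le_trans (hM y fy); rewrite le_eqVlt; apply/orP; left; apply/eqP.
  congr Normc.normc; rewrite /osc; congr cintegral2; apply/funext => x.
  by rewrite mulrA -cisD addrC (dot2C y).
have inM : mu.-integrable setT (fun y => (M * Normc.normc (f y))%:E).
  exact/integrable_scale/integrable_normc.
apply: le_trans (normc_cintegral_le _ inM bnd) _.
  apply: cintegrable_le inM bnd; apply: cmeasurableM.
    exact: cintegrable_measurable.
  exact: cmeasurable_osc.
by rewrite RintegralZl //; [rewrite mulrA mulrAC | exact: integrable_normc].
Qed.

End Osc.

(** * A summability kernel on the line *)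

Section LineIntegral.
Context {R : realType}.
Local Notation leb := (@lebesgue_measure R).

(** Folding at the origin reduces integrals over the line to antiderivatives on a
    half-line, and shows that the integral of an odd function vanishes. *)
Lemma ge0_integral_fold (f : R -> R) : (forall x, 0 <= f x) -> continuous f ->
  (\int[leb]_x (f x)%:E = \int[leb]_(x in `[0%R, +oo[) (f x)%:E +
    \int[leb]_(x in `[0%R, +oo[) (f (- x))%:E)%E.
Proof.
move=> f0 cf.
have mf : measurable_fun [set: R] f by exact: continuous_measurable_fun.
have mpos : measurable (`[0, +oo[%classic : set R) by [].
rewrite -{1}(setUv (`[0, +oo[%classic : set R)) ge0_integral_setU //=; last 4 first.
- exact: measurableC.
- by apply/measurable_EFinP; rewrite setUv.
- by move=> x _; rewrite lee_fin.
- exact/disj_setPCl.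
congr (_ + _)%E; rewrite setCitvr.
rewrite integral_itv_bndo_bndc; last exact/measurable_EFinP/measurable_funTS.
by rewrite -{1}oppr0 ge0_integration_by_substitutionNy //; exact: continuous_subspaceT.
Qed.

Lemma ge0_integral_half (f G : R -> R) (l : R) :
  (forall x, 0 <= x -> 0 <= f x) -> continuous f ->
  (forall x : R, is_derive x (1 : R) G (f x)) -> G x @[x --> +oo] --> l ->
  (\int[leb]_(x in `[0%R, +oo[) (f x)%:E = (l - G 0)%:E)%E.
Proof.
move=> f0 cf dG Gl; rewrite EFinB; apply: ge0_continuous_FTC2y => //.
- exact: continuous_subspaceT.
- by apply: cvg_at_right_filter; apply: differentiable_continuous; apply/derivable1_diffP.
- by move=> x _; rewrite derive1E derive_val.
Qed.

Lemma ge0_integral_line (f G : R -> R) (l m : R) :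
  (forall x, 0 <= f x) -> continuous f ->
  (forall x : R, is_derive x (1 : R) G (f x)) ->
  G x @[x --> +oo] --> l -> G (- x) @[x --> +oo] --> m ->
  (\int[leb]_x (f x)%:E = (l - m)%:E)%E.
Proof.
move=> f0 cf dG Gl Gm; rewrite ge0_integral_fold // (ge0_integral_half _ _ dG Gl) //.
have dGm (x : R) : is_derive x (1 : R) (fun x => - G (- x)) (f (- x)).
  have dGx := dG (- x).
  rewrite (_ : (fun _ => _) = - (G \o -%R)) //.
  by apply: is_derive_eq; rewrite mulrN1 opprK.
rewrite (ge0_integral_half _ _ dGm (cvgN Gm)) //.
  by rewrite -EFinD oppr0; congr EFin; ring.
by move=> x; apply: continuous_comp; [exact: opp_continuous | exact: cf].
Qed.

Lemma ge0_integrable_line (f : R -> R) (l : R) : (forall x, 0 <= f x) -> continuous f ->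
  (\int[leb]_x (f x)%:E = l%:E)%E -> leb.-integrable setT (fun x => (f x)%:E).
Proof.
move=> f0 cf fl; apply/integrableP; split.
  by apply/measurable_EFinP; exact: continuous_measurable_fun.
under eq_integral do rewrite gee0_abs ?lee_fin //.
by rewrite fl ltry.
Qed.

End LineIntegral.

Section Kernel.
Context {R : realType}.
Local Notation leb := (@lebesgue_measure R).
Implicit Types e v x : R.

(** Compared with [exp (- e |x|)], the first factor makes the transform decay like
    [e^3 / v^4] instead of [e / v^2].  This compensates the size [4 / e] of the
    transform of the weight in the other variable at a vanishing frequency. *)
Definition weight e x : R := (1 + e * `|x|) * expR (- (e * `|x|)).

Definition weight_ft e v : R := 4 * e ^+ 3 / (e ^+ 2 + v ^+ 2) ^+ 2.

Lemma expR_linear_cvg0 e : 0 < e -> x * expR (- (e * x)) @[x --> +oo] --> (0 : R).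
Proof.
move=> e0.
apply: (squeeze_cvgr (f := cst 0) (h := fun x => 2 / e ^+ 2 / x)).
- near=> x; have x0 : 0 < x by near: x; exact: nbhs_pinfty_gt.
  apply/andP; split; first by rewrite mulr_ge0 ?expR_ge0 // ltW.
  rewrite expRN ler_pdivrMr ?expR_gt0 //.
  have h : (e * x) ^+ 2 / 2 <= expR (e * x).
    have ex0 : 0 <= e * x by rewrite mulr_ge0 // ltW.
    have := expR_ge1Dxn 1 ex0; rewrite /= => h; apply: le_trans h.
    by rewrite lerDr.
  have xE : 2 / e ^+ 2 / x * ((e * x) ^+ 2 / 2) = x.
    by field; rewrite (lt0r_neq0 x0) (lt0r_neq0 e0).
  have k0 : 0 < 2 / e ^+ 2 / x by rewrite !divr_gt0 // exprn_gt0.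
  by have := ler_wpM2l (ltW k0) h; rewrite xE.
- exact: cvg_cst.
- rewrite -[X in _ --> X](mulr0 (2 / e ^+ 2)); apply: cvgM; first exact: cvg_cst.
  apply: (gtr0_cvgV0 (f := id) _).2; last exact: cvg_id.
  exact: nbhs_pinfty_gt.
Unshelve. all: end_near. Qed.

(** An antiderivative of [(1 + e x) exp(- e x) cos (v x)]. *)
Definition weight_prim e v x : R :=
  expR (- (e * x)) *
  ((- (2 * e ^+ 3) / (e ^+ 2 + v ^+ 2) ^+ 2 - e ^+ 2 / (e ^+ 2 + v ^+ 2) * x)
     * cos (v * x) +
   (v / (e ^+ 2 + v ^+ 2) + 2 * v * e ^+ 2 / (e ^+ 2 + v ^+ 2) ^+ 2
     + e * v / (e ^+ 2 + v ^+ 2) * x) * sin (v * x)).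

Lemma is_derive_affine (a b x : R) : is_derive x (1 : R) (fun x => a + b * x) b.
Proof.
rewrite (_ : (fun _ => _) = cst a + b \*: id); last by apply/funext => y.
by apply: is_derive_eq; rewrite add0r /GRing.scale /= mulr1.
Qed.

Lemma is_derive_weight_prim e v x : 0 < e ->
  is_derive x (1 : R) (weight_prim e v) ((1 + e * x) * expR (- (e * x)) * cos (v * x)).
Proof.
move=> e0; have D0 : e ^+ 2 + v ^+ 2 != 0.
  by rewrite lt0r_neq0 // ltr_pwDl ?exprn_gt0 ?sqr_ge0.
rewrite /weight_prim.
set a := - _ / _; set b := e ^+ 2 / (e ^+ 2 + v ^+ 2); set a' := v / _ + _; set b' := e * v / _.
have dE : is_derive x (1 : R) (expR \o (fun x => 0 + (- e) * x)) (expR (- (e * x)) * (- e)).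
  have := is_derive_affine 0 (- e) x => d1.
  by apply: is_derive_eq; rewrite add0r mulNr.
have dC : is_derive x (1 : R) (cos \o (fun x => 0 + v * x)) (- sin (v * x) * v).
  have := is_derive_affine 0 v x => d1.
  by apply: is_derive_eq; rewrite add0r.
have dS : is_derive x (1 : R) (sin \o (fun x => 0 + v * x)) (cos (v * x) * v).
  have := is_derive_affine 0 v x => d1.
  by apply: is_derive_eq; rewrite add0r.
have d1 := is_derive_affine a (- b) x.
have d2 := is_derive_affine a' b' x.
rewrite (_ : (fun _ => _) = (expR \o (fun x => 0 + (- e) * x)) *
  ((fun x => a + (- b) * x) * (cos \o (fun x => 0 + v * x)) +
   (fun x => a' + b' * x) * (sin \o (fun x => 0 + v * x)))); last first.
  by apply/funext => y /=; rewrite !fctE /= !add0r !mulNr.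
apply: is_derive_eq; rewrite !fctE /= !add0r !mulNr /GRing.scale /=.
rewrite /a /b /a' /b'; move: (expR _) (cos _) (sin _) => E C S.
by field.
Qed.

Lemma weight_prim_cvg0 e v : 0 < e -> weight_prim e v x @[x --> +oo] --> (0 : R).
Proof.
move=> e0; rewrite /weight_prim.
set a := - _ / _; set b := e ^+ 2 / (e ^+ 2 + v ^+ 2); set a' := v / _ + _; set b' := e * v / _.
clearbody a b a' b'.
have E0 : expR (- (e * x)) @[x --> +oo] --> (0 : R).
  apply: (@cvg_comp _ _ _ (fun x => e * x) (fun y => expR (- y)) _ (pinfty_nbhs R));
    last exact: cvgr_expR.
  by apply: gt0_cvgMry => //; exact: cvg_id.
apply: (squeeze_cvgr
   (f := fun x => - ((`|a| + `|a'|) * expR (- (e * x)) +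
      (`|b| + `|b'|) * (x * expR (- (e * x)))))
   (h := fun x => (`|a| + `|a'|) * expR (- (e * x)) + (`|b| + `|b'|) * (x * expR (- (e * x))))).
- near=> x; have x0 : 0 < x by near: x; exact: nbhs_pinfty_gt.
  rewrite -ler_norml normrM ger0_norm ?expR_ge0 //.
  have -> : (`|a| + `|a'|) * expR (- (e * x)) + (`|b| + `|b'|) * (x * expR (- (e * x)))
    = expR (- (e * x)) * ((`|a| + `|b| * x) * 1 + (`|a'| + `|b'| * x) * 1) by ring.
  rewrite ler_wpM2l ?expR_ge0 //; apply: le_trans (ler_normD _ _) _.
  rewrite !normrM; apply: lerD; apply: ler_pM => //.
  + by apply: le_trans (ler_normB _ _) _; rewrite normrM (gtr0_norm x0).
  + by rewrite ler_norml cos_geN1 cos_le1.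
  + by apply: le_trans (ler_normD _ _) _; rewrite normrM (gtr0_norm x0).
  + by rewrite ler_norml sin_geN1 sin_le1.
- rewrite -oppr0; apply: cvgN.
  rewrite -[X in _ --> X](addr0) -[in X in _ --> X + _](mulr0 (`|a| + `|a'|))
    -[in X in _ --> _ + X](mulr0 (`|b| + `|b'|)).
  apply: cvgD; apply: cvgM; try exact: cvg_cst; first exact: E0.
  exact: expR_linear_cvg0.
- rewrite -[X in _ --> X](addr0) -[in X in _ --> X + _](mulr0 (`|a| + `|a'|))
    -[in X in _ --> _ + X](mulr0 (`|b| + `|b'|)).
  apply: cvgD; apply: cvgM; try exact: cvg_cst; first exact: E0.
  exact: expR_linear_cvg0.
Unshelve. all: end_near. Qed.

Lemma is_derive_continuous (f df : R -> R) :
  (forall x : R, is_derive x (1 : R) f (df x)) -> continuous f.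
Proof.
move=> fdf x; apply: differentiable_continuous; apply/derivable1_diffP.
by have [] := fdf x.
Qed.

Lemma continuous_trig v : continuous (fun x => cos (v * x)) /\ continuous (fun x => sin (v * x)).
Proof.
have vc : continuous (fun x : R => v * x) by exact: mulrl_continuous.
by split=> x; apply: continuous_comp (vc x) _;
  [exact: continuous_cos | exact: continuous_sin].
Qed.

Lemma continuous_half_weight e : continuous (fun x => (1 + e * x) * expR (- (e * x))).
Proof.
move=> x; apply: (@continuousM _ _ (fun x => 1 + e * x) (fun x => expR (- (e * x)))).
  by apply: continuousD; [exact: cst_continuous | exact: mulrl_continuous].
apply: continuous_comp; last exact: continuous_expR.
by apply: continuousN; exact: mulrl_continuous.
Qed.

Lemma continuous_weight e : continuous (weight e).
Proof.
move=> x.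
apply: (@continuous_comp _ _ _ (@Num.norm R R) (fun x => (1 + e * x) * expR (- (e * x)))).
  exact: norm_continuous.
exact: continuous_half_weight.
Qed.

Lemma weight_ge0 e x : 0 <= e -> 0 <= weight e x.
Proof.
by move=> e0; rewrite /weight mulr_ge0 ?expR_ge0 // addr_ge0 // mulr_ge0.
Qed.

Lemma weight_le1 e x : weight e x <= 1.
Proof.
by rewrite /weight expRN ler_pdivrMr ?expR_gt0 // mul1r expR_ge1Dx.
Qed.

Lemma weightN e x : weight e (- x) = weight e x.
Proof. by rewrite /weight normrN. Qed.

(** The fundamental theorem of calculus on a half-line asks for a nonnegative
    integrand, hence the summand [1]. *)
Lemma integral_weight_one_plus_cos e v : 0 < e ->
  (\int[leb]_x (weight e x * (1 + cos (v * x)))%:E = (4 / e + weight_ft e v)%:E)%E.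
Proof.
move=> e0; have [cc cs] := continuous_trig v.
have D0 : e ^+ 2 + v ^+ 2 != 0.
  by rewrite lt0r_neq0 // ltr_pwDl ?exprn_gt0 ?sqr_ge0.
have cf (g : R -> R) : continuous g -> continuous (fun x => g x * (1 + cos (v * x))).
  move=> cg x; apply: (@continuousM _ _ g (fun x => 1 + cos (v * x))); first exact: cg.
  by apply: continuousD; [exact: cst_continuous | exact: cc].
have f0 x : 0 <= 1 + cos (v * x) by have := cos_geN1 (v * x); lra.
have dG (x : R) : is_derive x (1 : R) (weight_prim e 0 + weight_prim e v)
    ((1 + e * x) * expR (- (e * x)) * (1 + cos (v * x))).
  have d1 := is_derive_weight_prim 0 x e0; have d2 := is_derive_weight_prim v x e0.
  by apply: is_derive_eq; rewrite mul0r cos0; ring.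
have half : (\int[leb]_(x in `[0%R, +oo[) (weight e x * (1 + cos (v * x)))%:E =
    (2 / e + 2 * e ^+ 3 / (e ^+ 2 + v ^+ 2) ^+ 2)%:E)%E.
  transitivity (\int[leb]_(x in `[0%R, +oo[)
      ((1 + e * x) * expR (- (e * x)) * (1 + cos (v * x)))%:E)%E.
    apply: eq_integral => x; rewrite inE /= in_itv /= andbT => x0.
    by rewrite /weight ger0_norm.
  rewrite (ge0_integral_half (G := weight_prim e 0 + weight_prim e v) (l := 0)).
  - congr EFin; rewrite sub0r !fctE /weight_prim !mulr0 oppr0 expR0 cos0 sin0.
    by field; rewrite (lt0r_neq0 e0) D0.
  - by move=> x x0; rewrite mulr_ge0 // mulr_ge0 ?expR_ge0 // addr_ge0 // mulr_ge0 // ltW.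
  - by apply: cf; exact: continuous_half_weight.
  - by rewrite -[0]addr0; apply: cvgD; exact: weight_prim_cvg0.
rewrite ge0_integral_fold.
- under [X in (_ + X)%E]eq_integral do rewrite weightN mulrN cosN.
  rewrite half -EFinD /weight_ft; congr EFin.
  by field; rewrite (lt0r_neq0 e0) D0.
- by move=> x; rewrite mulr_ge0 // weight_ge0 // ltW.
- by apply: cf; exact: continuous_weight.
Qed.

Lemma integrable_weight_bounded e (g : R -> R) : 0 < e -> continuous g ->
  (forall x, `|g x| <= 1) -> leb.-integrable setT (fun x => (weight e x * g x)%:E).
Proof.
move=> e0 cg g1; have i0 := integral_weight_one_plus_cos 0 e0.
have W0 x : 0 <= weight e x by rewrite weight_ge0 // ltW.
have intW : leb.-integrable setT (fun x => (weight e x * (1 + cos (0 * x)))%:E).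
  apply: ge0_integrable_line i0.
    by move=> x; rewrite mulr_ge0 // mul0r cos0; lra.
  move=> x; apply: (@continuousM _ _ (weight e) (fun x => 1 + cos (0 * x))).
    exact: continuous_weight.
  apply: continuousD; first exact: cst_continuous.
  by have [cc _] := continuous_trig 0; exact: cc.
have mf : measurable_fun [set: R] (fun x => weight e x * g x).
  apply: continuous_measurable_fun => x.
  by apply: (@continuousM _ _ (weight e) g); [exact: continuous_weight | exact: cg].
apply: le_integrable intW => //; first exact/measurable_EFinP.
move=> x _ /=; rewrite lee_fin mul0r cos0 !normrM ler_wpM2l //.
by rewrite (le_trans (g1 x)) // ger0_norm; lra.
Qed.

Lemma integrable_weight e : 0 < e -> leb.-integrable setT (fun x => (weight e x)%:E).
Proof.
move=> e0; under eq_fun do rewrite -[weight _ _]mulr1.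
apply: integrable_weight_bounded => //; first exact: cst_continuous.
by move=> x; rewrite normr1.
Qed.

Lemma integrable_weight_trig e v : 0 < e ->
  leb.-integrable setT (fun x => (weight e x * cos (v * x))%:E) /\
  leb.-integrable setT (fun x => (weight e x * sin (v * x))%:E).
Proof.
move=> e0; have [cc cs] := continuous_trig v; split.
  by apply: integrable_weight_bounded => // x; rewrite ler_norml cos_geN1 cos_le1.
by apply: integrable_weight_bounded => // x; rewrite ler_norml sin_geN1 sin_le1.
Qed.

(** The cosine transform, obtained by adding the constant to make the
    integrand nonnegative, and then subtracting the case [v = 0]. *)
Lemma Rintegral_weight_cos e v : 0 < e ->
  \int[leb]_x (weight e x * cos (v * x)) = weight_ft e v.
Proof.
move=> e0; have iW := integrable_weight e0.
have sum w : \int[leb]_x weight e x + \int[leb]_x (weight e x * cos (w * x)) =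
    4 / e + weight_ft e w.
  have [iC _] := integrable_weight_trig w e0.
  rewrite -RintegralD //; have := integral_weight_one_plus_cos w e0.
  under eq_integral do rewrite mulrDr mulr1.
  by rewrite /Rintegral => ->.
have W : \int[leb]_x weight e x = 4 / e.
  have := sum 0; under [X in _ + X = _ -> _]eq_Rintegral do rewrite mul0r cos0 mulr1.
  have -> : weight_ft e 0 = 4 / e.
    by rewrite /weight_ft expr0n addr0; field; rewrite (lt0r_neq0 e0).
  lra.
by have := sum v; rewrite W => /addrI.
Qed.

Lemma Rintegral_weight_sin e v : 0 < e -> \int[leb]_x (weight e x * sin (v * x)) = 0.
Proof.
move=> e0; have iW := integrable_weight e0.
have [_ iS] := integrable_weight_trig v e0.
have [_ cs] := continuous_trig v.
pose f x := weight e x * (1 + sin (v * x)).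
have fE : f = fun x => weight e x + weight e x * sin (v * x).
  by apply/funext => x; rewrite /f mulrDr mulr1.
have fNE : (fun x => f (- x)) = fun x => weight e x - weight e x * sin (v * x).
  by apply/funext => x; rewrite /f weightN mulrN sinN mulrDr mulr1 mulrN.
have f0 x : 0 <= f x.
  by rewrite mulr_ge0 ?weight_ge0 ?(ltW e0) //; have := sin_geN1 (v * x); lra.
have cf : continuous f.
  move=> x; apply: (@continuousM _ _ (weight e) (fun x => 1 + sin (v * x))).
    exact: continuous_weight.
  by apply: continuousD; [exact: cst_continuous | exact: cs].
have cfN : continuous (fun x => f (- x)).
  by move=> x; apply: continuous_comp; [exact: opp_continuous | exact: cf].
have : \int[leb]_x f x = \int[leb]_x f (- x).
  rewrite /Rintegral (ge0_integral_fold f0 cf) (ge0_integral_fold (fun x => f0 (- x)) cfN).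
  by rewrite addeC; congr (fine (_ + _)%E); apply: eq_integral => x _; rewrite opprK.
rewrite fNE fE RintegralD // RintegralB //; lra.
Qed.

Lemma weight_ft_ge0 e v : 0 <= e -> 0 <= weight_ft e v.
Proof.
by move=> e0; rewrite /weight_ft divr_ge0 ?sqr_ge0 // mulr_ge0 // exprn_ge0.
Qed.

(** The Poisson kernel, which dominates the second moment of [weight_ft]. *)
Definition poisson e v : R := e / (e ^+ 2 + v ^+ 2).

Lemma is_derive_atan_affine (a y x : R) :
  is_derive x (1 : R) (fun x => atan (a * (x - y))) (a / (1 + (a * (x - y)) ^+ 2)).
Proof.
have := is_derive_affine (- (a * y)) a x => d1.
rewrite (_ : (fun _ => _) = atan \o (fun x => - (a * y) + a * x)); last first.
  by apply/funext => z /=; congr atan; ring.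
apply: is_derive_eq; rewrite mulrC; congr (_ / (1 + _ ^+ 2)); ring.
Qed.

Lemma cvg_affine_pinfty (a b : R) : 0 < a -> a * (x - b) @[x --> +oo] --> +oo.
Proof.
move=> a0; apply: gt0_cvgMry => //.
by apply/cvgryPge => A; near=> x; rewrite lerBrDr; near: x; exact: nbhs_pinfty_ge.
Unshelve. all: end_near. Qed.

Lemma cvg_atan_affine (a y : R) : 0 < a ->
  atan (a * (x - y)) @[x --> +oo] --> pi / 2 /\
  atan (a * (- x - y)) @[x --> +oo] --> - (pi / 2 : R).
Proof.
move=> a0; split.
  exact: (@cvg_comp _ _ _ (fun x => a * (x - y)) (@atan R) _ (pinfty_nbhs R) _
    (cvg_affine_pinfty y a0) (@cvgy_atan R)).
under eq_fun => x.
  have -> : a * (- x - y) = - (a * (x - - y)) by ring.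
  rewrite atanN; over.
apply: cvgN.
exact: (@cvg_comp _ _ _ (fun x => a * (x - - y)) (@atan R) _ (pinfty_nbhs R) _
    (cvg_affine_pinfty (- y) a0) (@cvgy_atan R)).
Qed.

End Kernel.

(** * The transform of the weight as an approximate identity *)

Section KernelMass.
Context {R : realType}.
Local Notation leb := (@lebesgue_measure R).
Implicit Types e v x y : R.

Lemma frequency_ge1 : 1 <= 2 * pi :> R.
Proof. by have := pi_ge2 R; lra. Qed.

Lemma continuous_rational (k : nat) (a e : R) y : 0 < e ->
  continuous (fun x => a / (e ^+ 2 + (2 * pi * (y - x)) ^+ 2) ^+ k).
Proof.
move=> e0 x.
have cD : {for x, continuous (fun x => e ^+ 2 + (2 * pi * (y - x)) ^+ 2)}.
  apply: continuousD; first exact: cst_continuous.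
  apply: (@continuous_comp _ _ _ (fun x => 2 * pi * (y - x)) (fun z => z ^+ 2)).
    apply: continuousM; first exact: cst_continuous.
    by apply: continuousB; [exact: cst_continuous | exact: id].
  exact: exprn_continuous.
pose D x := (e ^+ 2 + (2 * pi * (y - x)) ^+ 2) ^+ k.
have cDk : {for x, continuous D}.
  apply: (@continuous_comp _ _ _ (fun x => e ^+ 2 + (2 * pi * (y - x)) ^+ 2)
    (fun z => z ^+ k) x cD).
  exact: exprn_continuous.
have D0 : D x != 0.
  by rewrite expf_neq0 // lt0r_neq0 // ltr_pwDl ?exprn_gt0 ?sqr_ge0.
apply: (@continuousM _ _ (cst a) (fun x => (D x)^-1)); first exact: cst_continuous.
exact: (@continuousV _ _ D x D0 cDk).
Qed.

Lemma integral_poisson e y : 0 < e ->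
  (\int[leb]_x (poisson e (2 * pi * (y - x)))%:E = (2^-1)%:E)%E.
Proof.
move=> e0; have p1 := frequency_ge1; have pp := pi_gt0 R.
pose a : R := 2 * pi / e; have a0 : 0 < a by rewrite divr_gt0 // mulr_gt0.
have [c1 c2] := cvg_atan_affine y a0.
have dG (x : R) : is_derive x (1 : R) ((2 * pi)^-1 \*: (fun x => atan (a * (x - y))))
    (poisson e (2 * pi * (y - x))).
  have d1 := is_derive_atan_affine a y x.
  apply: is_derive_eq; rewrite /GRing.scale /= /poisson /a.
  move: (pi : R) pp => p pp; field; rewrite ?(lt0r_neq0 e0) ?(lt0r_neq0 pp) ?andbT /=.
  by rewrite !lt0r_neq0 // ltr_pwDl ?exprn_gt0 ?sqr_ge0.
rewrite (ge0_integral_line (G := (2 * pi)^-1 \*: (fun x => atan (a * (x - y))))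
  (l := (2 * pi)^-1 * (pi / 2)) (m := (2 * pi)^-1 * (- (pi / 2)))).
- by congr EFin; move: (pi : R) pp => p pp; field; rewrite lt0r_neq0.
- by move=> x; rewrite divr_ge0 ?addr_ge0 ?sqr_ge0 // ltW.
- by have := @continuous_rational 1 e e y e0.
- by apply: cvgM; first exact: cvg_cst.
- by apply: cvgM; first exact: cvg_cst.
Qed.

Lemma integral_weight_ft e y : 0 < e ->
  (\int[leb]_x (weight_ft e (2 * pi * (y - x)))%:E = 1%:E)%E.
Proof.
move=> e0; have p1 := frequency_ge1; have pp := pi_gt0 R.
pose a : R := 2 * pi / e; have a0 : 0 < a by rewrite divr_gt0 // mulr_gt0.
have [c1 c2] := cvg_atan_affine y a0.
(* with [t = atan (a (x - y))] the integrand is [2 cos^2 t] times [t'], up to a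
   constant *)
pose h (t : R) := t + sin t * cos t.
pose G := pi^-1 \*: (h \o (fun x => atan (a * (x - y)))).
have dh (t : R) : is_derive t (1 : R) h (1 + (cos t * cos t - sin t * sin t)).
  rewrite (_ : h = id + (@sin R) * (@cos R)) //.
  by apply: is_derive_eq; rewrite /GRing.scale /=; ring.
have ch : continuous h := is_derive_continuous dh.
have dG (x : R) : is_derive x (1 : R) G (weight_ft e (2 * pi * (y - x))).
  have d1 := is_derive_atan_affine a y x.
  pose t := atan (a * (x - y)).
  rewrite /G; apply: is_derive_eq; rewrite /GRing.scale /=.
  have cE : cos t ^+ 2 = (1 + (a * (x - y)) ^+ 2)^-1.
    by rewrite /t cos_atan exprVn sqr_sqrtr // addr_ge0 ?sqr_ge0.
  have -> : 1 + (cos t * cos t - sin t * sin t) = 2 * cos t ^+ 2.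
    by have := cos2Dsin2 t; rewrite !expr2; lra.
  rewrite cE /weight_ft /a.
  move: (pi : R) pp => p pp; field; rewrite ?(lt0r_neq0 e0) ?(lt0r_neq0 pp) ?andbT /=.
  by rewrite !lt0r_neq0 // ltr_pwDl ?exprn_gt0 ?sqr_ge0.
have hp : h (pi / 2) = pi / 2 by rewrite /h cos_pihalf mulr0 addr0.
have hm : h (- (pi / 2)) = - (pi / 2) by rewrite /h cosN cos_pihalf mulr0 addr0.
rewrite (ge0_integral_line (G := G) (l := pi^-1 * (pi / 2)) (m := pi^-1 * (- (pi / 2)))).
- by congr EFin; move: (pi : R) pp => p pp; field; rewrite lt0r_neq0.
- by move=> x; rewrite weight_ft_ge0 // ltW.
- by have := @continuous_rational 2 (4 * e ^+ 3) e y e0.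
- apply: cvgM; first exact: cvg_cst.
  rewrite -{1}hp.
  exact: (cvg_comp (fun x => atan (a * (x - y))) h c1 (ch _)).
- apply: cvgM; first exact: cvg_cst.
  rewrite -{1}hm.
  exact: (cvg_comp (fun x => atan (a * (- x - y))) h c2 (ch _)).
Qed.

Lemma integrable_weight_ft e y : 0 < e ->
  leb.-integrable setT (fun x => (weight_ft e (2 * pi * (y - x)))%:E).
Proof.
move=> e0; apply: ge0_integrable_line (integral_weight_ft y e0).
  by move=> x; rewrite weight_ft_ge0 // ltW.
by have := @continuous_rational 2 (4 * e ^+ 3) e y e0.
Qed.

Lemma integrable_poisson e y : 0 < e ->
  leb.-integrable setT (fun x => (poisson e (2 * pi * (y - x)))%:E).
Proof.
move=> e0; apply: ge0_integrable_line (integral_poisson y e0).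
  by move=> x; rewrite divr_ge0 ?addr_ge0 ?sqr_ge0 // ltW.
by have := @continuous_rational 1 e e y e0.
Qed.

Lemma second_moment_le e y x : 0 < e ->
  (x - y) ^+ 2 * weight_ft e (2 * pi * (y - x)) <=
  4 * e ^+ 2 * poisson e (2 * pi * (y - x)).
Proof.
move=> e0; have p1 := frequency_ge1.
have -> : (x - y) ^+ 2 = (y - x) ^+ 2 by rewrite -sqrrN opprB.
set u := y - x; rewrite /weight_ft /poisson.
set D := e ^+ 2 + _.
have D0 : 0 < D by rewrite ltr_pwDl ?exprn_gt0 ?sqr_ge0.
have uD : u ^+ 2 <= D.
  rewrite /D exprMn; have u0 := sqr_ge0 u; have e20 := sqr_ge0 e.
  have : 1 <= (2 * pi : R) ^+ 2 by rewrite exprn_ege1.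
  nra.
have -> : 4 * e ^+ 2 * (e / D) = D * (4 * e ^+ 3 / D ^+ 2).
  by field; rewrite lt0r_neq0.
by rewrite ler_wpM2r // divr_ge0 ?sqr_ge0 // mulr_ge0 // exprn_ge0 // ltW.
Qed.

End KernelMass.

(** * Weighted integrals on the plane *)

Section PlaneWeight.
Context {R : realType}.
Local Notation leb := (@lebesgue_measure R).
Local Notation mu := (lebesgue2 R).
Local Notation plane := (measurableTypeR R * measurableTypeR R)%type.

Lemma normc_real (r : R) : Normc.normc (real_complex R r) = `|r|.
Proof. by rewrite /= expr0n addr0 sqrtr_sqr. Qed.

Definition weight2 (e : R) (x : R * R) : R := weight e x.1 * weight e x.2.

Lemma measurable_weight e : measurable_fun [set: R] (weight e).
Proof. by apply: continuous_measurable_fun; exact: continuous_weight. Qed.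

Lemma measurable_weight2 e : measurable_fun [set: plane] (weight2 e).
Proof.
have mw := @measurable_weight e.
by apply: measurable_funM;
  [exact: (measurableT_comp mw measurable_fst) | exact: (measurableT_comp mw measurable_snd)].
Qed.

Lemma weight2_ge0 e x : 0 <= e -> 0 <= weight2 e x.
Proof. by move=> e0; rewrite mulr_ge0 // weight_ge0. Qed.

Lemma weight2_le1 e x : 0 <= e -> weight2 e x <= 1.
Proof.
move=> e0; have := weight_le1 e x.1; have := weight_le1 e x.2.
have := weight_ge0 x.1 e0; have := weight_ge0 x.2 e0; rewrite /weight2; nra.
Qed.

Lemma cintegrable_weight2 (e : R) : 0 < e ->
  cintegrable (fun x => real_complex R (weight2 e x)).
Proof.
move=> e0; have iW := integrable_weight e0.
apply: (cintegrable_le (g := weight2 e)).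
- by apply: cmeasurable_real; exact: measurable_weight2.
- exact: (integrable_tensor (m1 := leb) (m2 := leb) iW iW).
- move=> x; rewrite normc_real ger0_norm //.
  by rewrite weight2_ge0 // ltW.
Qed.

Lemma cintegral_weight2_cis (e : R) (u : R * R) : 0 < e ->
  cintegral2 (fun x => cis (2 * pi * dot2 x u) * real_complex R (weight2 e x)) =
  real_complex R (weight_ft e (2 * pi * u.1) * weight_ft e (2 * pi * u.2)).
Proof.
move=> e0; set v1 := 2 * pi * u.1; set v2 := 2 * pi * u.2.
have [iC1 iS1] := integrable_weight_trig v1 e0.
have [iC2 iS2] := integrable_weight_trig v2 e0.
have tens f g (fi : leb.-integrable setT (fun x => (f x)%:E))
    (gi : leb.-integrable setT (fun x => (g x)%:E)) :
    mu.-integrable setT (fun x => (f x.1 * g x.2)%:E) :=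
  integrable_tensor (m1 := leb) (m2 := leb) fi gi.
have Rtens f g (fi : leb.-integrable setT (fun x => (f x)%:E))
    (gi : leb.-integrable setT (fun x => (g x)%:E)) :
    \int[mu]_x (f x.1 * g x.2) = (\int[leb]_x f x) * (\int[leb]_x g x) :=
  Rintegral_tensor (m1 := leb) (m2 := leb) fi gi.
have dE x : 2 * pi * dot2 x u = v1 * x.1 + v2 * x.2.
  by rewrite /dot2 /v1 /v2; ring.
rewrite /cintegral2 /real_complex_def; congr Complex.
  transitivity (\int[mu]_x ((weight e x.1 * cos (v1 * x.1)) * (weight e x.2 * cos (v2 * x.2))
     - (weight e x.1 * sin (v1 * x.1)) * (weight e x.2 * sin (v2 * x.2)))).
    by apply: eq_Rintegral => x _; rewrite dE /= cosD /weight2; ring.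
  rewrite RintegralB //; [|exact: (tens _ _ iC1 iC2)|exact: (tens _ _ iS1 iS2)].
  rewrite (Rtens _ _ iC1 iC2) (Rtens _ _ iS1 iS2).
  by rewrite !Rintegral_weight_cos // !Rintegral_weight_sin // mulr0 subr0.
transitivity (\int[mu]_x ((weight e x.1 * sin (v1 * x.1)) * (weight e x.2 * cos (v2 * x.2))
     + (weight e x.1 * cos (v1 * x.1)) * (weight e x.2 * sin (v2 * x.2)))).
  by apply: eq_Rintegral => x _; rewrite dE /= sinD /weight2; ring.
rewrite RintegralD //; [|exact: (tens _ _ iS1 iC2)|exact: (tens _ _ iC1 iS2)].
rewrite (Rtens _ _ iS1 iC2) (Rtens _ _ iC1 iS2).
by rewrite !Rintegral_weight_sin // mulr0 mul0r addr0.
Qed.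

Definition eps_ (n : nat) : R := n.+1%:R^-1.

Lemma eps_gt0 n : 0 < eps_ n. Proof. by rewrite /eps_ invr_gt0 ltr0n. Qed.

Lemma cvg_eps : eps_ n @[n --> \oo] --> (0 : R).
Proof. exact: cvg_harmonic. Qed.

Lemma cvg_weight (x : R) : weight (eps_ n) x @[n --> \oo] --> (1 : R).
Proof.
have c0 : eps_ n * `|x| @[n --> \oo] --> (0 : R).
  by rewrite -[X in _ --> X](mul0r `|x|); apply: cvgM; [exact: cvg_eps | exact: cvg_cst].
have -> : (1 : R) = (1 + 0) * expR (- 0) by rewrite addr0 oppr0 expR0 mulr1.
apply: cvgM; first by apply: cvgD; [exact: cvg_cst | exact: c0].
exact: (cvg_comp (fun n => - (eps_ n * `|x|)) (@expR R) (cvgN c0) (@continuous_expR R _)).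
Qed.

Lemma cvg_weight2 (x : R * R) : weight2 (eps_ n) x @[n --> \oo] --> (1 : R).
Proof.
by rewrite -[X in _ --> X](mulr1 1); apply: cvgM; exact: cvg_weight.
Qed.

Lemma Rintegral_weight2_defect (g : plane -> R) : (forall x, 0 <= g x) ->
  mu.-integrable setT (fun x => (g x)%:E) ->
  \int[mu]_x (g x * (1 - weight2 (eps_ n) x)) @[n --> \oo] --> (0 : R).
Proof.
move=> g0 ig; have mg : measurable_fun setT g.
  by move: ig => /measurable_int/measurable_EFinP.
have mf n : measurable_fun setT (fun x => g x * (1 - weight2 (eps_ n) x)).
  by apply: measurable_funM => //; apply: measurable_funB => //; exact: measurable_weight2.
have bnd n x : `|g x * (1 - weight2 (eps_ n) x)| <= g x.
  rewrite normrM (ger0_norm (g0 x)) ler_piMr //.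
  have := weight2_ge0 x (ltW (eps_gt0 n)).
  have := weight2_le1 x (ltW (eps_gt0 n)); rewrite ler_norml; lra.
have /= := @dominated_cvg _ _ _ mu setT measurableT
  (fun n x => (g x * (1 - weight2 (eps_ n) x))%:E) (cst 0%E) (fun x => (g x)%:E).
rewrite integral_cst //= mul0e => dcv.
have {}dcv : (\int[mu]_x (g x * (1 - weight2 (eps_ n) x))%:E)%E @[n --> \oo] --> (0 : R)%:E.
  apply: dcv => //.
  - by move=> n; exact/measurable_EFinP.
  - move=> x _; apply: cvg_EFin; first exact: nearW.
    rewrite -[X in _ --> X](mulr0 (g x)); apply: cvgM; first exact: cvg_cst.
    rewrite -[X in _ --> X](subrr (1 : R)); apply: cvgB; first exact: cvg_cst.
    exact: cvg_weight2.
  - by move=> n x _; rewrite /= lee_fin.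
exact: fine_cvg dcv.
Qed.

(** By dominated convergence: the weights are at most [1] and tend to [1]. *)
Lemma cintegral_weight2_limit (f : plane -> R[i]) (eta : R) : cintegrable f -> 0 < eta ->
  \forall n \near \oo, Normc.normc
    (cintegral2 (fun x => f x * real_complex R (weight2 (eps_ n) x)) - cintegral2 f)
      <= eta.
Proof.
move=> cf eta0; have ing := integrable_normc cf.
have mfw n : cmeasurable (fun x => f x * real_complex R (weight2 (eps_ n) x)).
  apply: cmeasurableM; first exact: cintegrable_measurable.
  by apply: cmeasurable_real; exact: measurable_weight2.
have nw n x : Normc.normc (real_complex R (weight2 (eps_ n) x)) = weight2 (eps_ n) x.
  rewrite normc_real ger0_norm //.
  by rewrite weight2_ge0 // ltW // eps_gt0.
have cfw n : cintegrable (fun x => f x * real_complex R (weight2 (eps_ n) x)).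
  apply: cintegrable_le (mfw n) ing _ => x.
  rewrite Normc.normcM nw ler_piMr ?normc_ge0 //.
  by rewrite weight2_le1 // ltW // eps_gt0.
have := Rintegral_weight2_defect (fun x => normc_ge0 (f x)) ing.
move/cvgrPdist_le => /(_ (eta / 2)); rewrite divr_gt0 // => /(_ isT).
apply: filterS => n; rewrite sub0r normrN => h.
have -> : cintegral2 (fun x => f x * real_complex R (weight2 (eps_ n) x)) - cintegral2 f
  = cintegral2 (fun x => f x * real_complex R (weight2 (eps_ n) x) + (-1) * f x).
  by rewrite cintegralD ?cintegralZ ?mulN1r //; exact: cintegrableZ.
have ind : mu.-integrable setT
    (fun x => (Normc.normc (f x) * (1 - weight2 (eps_ n) x))%:E).
  apply: integrable_le ing _.
    apply: measurable_funM; first exact/measurable_normc/cintegrable_measurable.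
    by apply: measurable_funB => //; exact: measurable_weight2.
  move=> x; have w0 := weight2_ge0 x (ltW (eps_gt0 n)).
  have w1 := weight2_le1 x (ltW (eps_gt0 n)).
  by rewrite normrM (ger0_norm (normc_ge0 _)) ler_piMr ?normc_ge0 // ler_norml; lra.
apply: le_trans (normc_cintegral_le _ ind _) _.
- by apply: cintegrableD => //; exact: cintegrableZ.
- move=> x; rewrite mulrC -mulrDl Normc.normcM mulrC ler_wpM2l ?normc_ge0 //.
  have w1 := weight2_le1 x (ltW (eps_gt0 n)).
  rewrite -[- 1](rmorphN1 (real_complex R)) -rmorphD normc_real -normrN opprD opprK.
  by rewrite ger0_norm; lra.
- have := ler_norm (\int[mu]_x (Normc.normc (f x) * (1 - weight2 (eps_ n) x))).
  lra.
Qed.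

End PlaneWeight.

(** * Fourier inversion *)

Section FourierInversion.
Context {R : realType}.
Local Notation leb := (@lebesgue_measure R).
Local Notation mu := (lebesgue2 R).
Local Notation plane := (measurableTypeR R * measurableTypeR R)%type.

Lemma eps_sqr_small (A eta : R) : 0 < eta ->
  \forall n \near \oo, A * eps_ n ^+ 2 <= eta.
Proof.
move=> eta0; have : A * (@eps_ R n * eps_ n) @[n --> \oo] --> A * (0 * 0).
  apply: cvgM; first exact: cvg_cst.
  by apply: cvgM; exact: cvg_eps.
rewrite !mulr0 => /cvgrPdist_le /(_ eta eta0); apply: filterS => n.
by rewrite sub0r normrN expr2; apply: le_trans; exact: ler_norm.
Qed.

Lemma eq0_of_normc_le (z : R[i]) : (forall eta : R, 0 < eta -> Normc.normc z <= eta) -> z = 0.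
Proof.
move=> h; apply: Normc.eq0_normc; apply/eqP; rewrite eq_le normc_ge0 andbT.
by apply/ler_addgt0Pl => e e0; rewrite addr0; exact: h.
Qed.

(** The transform of the weight on the plane, centred at [y]. *)
Definition avg_kernel (e : R) (y x : R * R) : R :=
  weight_ft e (2 * pi * (y.1 - x.1)) * weight_ft e (2 * pi * (y.2 - x.2)).

Lemma integrable_avg_kernel e y : 0 < e -> mu.-integrable setT (fun x => (avg_kernel e y x)%:E).
Proof.
move=> e0; exact: (integrable_tensor (m1 := leb) (m2 := leb)
  (integrable_weight_ft y.1 e0) (integrable_weight_ft y.2 e0)).
Qed.

Lemma avg_kernel_ge0 e y x : 0 <= e -> 0 <= avg_kernel e y x.
Proof. by move=> e0; rewrite mulr_ge0 // weight_ft_ge0. Qed.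

Lemma Rintegral_avg_kernel e y : 0 < e -> \int[mu]_x avg_kernel e y x = 1.
Proof.
move=> e0; transitivity (
  (\int[leb]_x weight_ft e (2 * pi * (y.1 - x))) *
  (\int[leb]_x weight_ft e (2 * pi * (y.2 - x)))).
  exact: (Rintegral_tensor (m1 := leb) (m2 := leb)
    (integrable_weight_ft y.1 e0) (integrable_weight_ft y.2 e0)).
by rewrite /Rintegral !integral_weight_ft //= mulr1.
Qed.

Lemma second_moment e (y : R) : 0 < e ->
  leb.-integrable setT (fun x => ((x - y) ^+ 2 * weight_ft e (2 * pi * (y - x)))%:E) /\
  \int[leb]_x ((x - y) ^+ 2 * weight_ft e (2 * pi * (y - x))) <= 2 * e ^+ 2.
Proof.
move=> e0; have ip := integrable_poisson y e0.
have ip4 : leb.-integrable setT (fun x => (4 * e ^+ 2 * poisson e (2 * pi * (y - x)))%:E).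
  by under eq_fun do rewrite EFinM; exact: integrableZl.
have im : leb.-integrable setT
    (fun x => ((x - y) ^+ 2 * weight_ft e (2 * pi * (y - x)))%:E).
  apply: le_integrable ip4 => //.
    apply/measurable_EFinP; apply: measurable_funM.
      by apply: measurable_funX; apply: measurable_funB.
    by move: (integrable_weight_ft y e0) => /measurable_int/measurable_EFinP.
  move=> x _ /=; rewrite lee_fin (ger0_norm (mulr_ge0 (sqr_ge0 _) (weight_ft_ge0 _ (ltW e0)))).
  by apply: le_trans (second_moment_le _ _ e0) _; exact: ler_norm.
split=> //; apply: le_trans (le_Rintegral _ im ip4 _) _ => //.
  by move=> x _; exact: second_moment_le.
by rewrite RintegralZl // /Rintegral integral_poisson //=; lra.
Qed.

Lemma integrable_avg_kernel_moment e y : 0 < e ->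
  mu.-integrable setT (fun x => (((x.1 - y.1) ^+ 2 + (x.2 - y.2) ^+ 2) * avg_kernel e y x)%:E) /\
  \int[mu]_x (((x.1 - y.1) ^+ 2 + (x.2 - y.2) ^+ 2) * avg_kernel e y x) <= 4 * e ^+ 2.
Proof.
move=> e0.
have [i1 b1] := second_moment y.1 e0; have [i2 b2] := second_moment y.2 e0.
have k1 := integrable_weight_ft y.1 e0; have k2 := integrable_weight_ft y.2 e0.
have t1 := integrable_tensor (m1 := leb) (m2 := leb) i1 k2.
have t2 := integrable_tensor (m1 := leb) (m2 := leb) k1 i2.
have fE x : ((x.1 - y.1) ^+ 2 + (x.2 - y.2) ^+ 2) * avg_kernel e y x =
  ((x.1 - y.1) ^+ 2 * weight_ft e (2 * pi * (y.1 - x.1))) * weight_ft e (2 * pi * (y.2 - x.2))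
  + weight_ft e (2 * pi * (y.1 - x.1)) * ((x.2 - y.2) ^+ 2 * weight_ft e (2 * pi * (y.2 - x.2))).
  by rewrite /avg_kernel; ring.
split; first by under eq_fun do rewrite fE EFinD; exact: integrableD.
under eq_Rintegral do rewrite fE.
rewrite RintegralD //.
have -> := Rintegral_tensor (m1 := leb) (m2 := leb) i1 k2.
have -> := Rintegral_tensor (m1 := leb) (m2 := leb) k1 i2.
by rewrite [X in _ * X + _]/Rintegral [X in _ + X * _]/Rintegral !integral_weight_ft //=; lra.
Qed.

(** Inserting the weights in the inversion integral turns it, by duality, into
    an average of [F] against an approximate identity at [y].  Continuity at [y]
    and boundedness of [F] are combined in a quadratic majorant of
    [F x - F y], whose average is small. *)
Theorem fourier_inversion (F : plane -> R[i]) (y : plane) (M : R) :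
  cintegrable F -> (forall x, Normc.normc (F x) <= M) ->
  (forall eta : R, 0 < eta -> exists2 d : R, 0 < d &
     forall x : plane, `|x.1 - y.1| < d -> `|x.2 - y.2| < d ->
     Normc.normc (F x - F y) <= eta) ->
  cintegrable (fourier2 F) -> inv_fourier2 (fourier2 F) y = F y.
Proof.
move=> iF FM cF iFF; apply/eqP; rewrite -subr_eq0; apply/eqP.
apply: eq0_of_normc_le => eta0 eta00.
(* [eta] for the limit, and [2 (eta + 4 eta)] for the average *)
pose eta := eta0 / 11; have etap : 0 < eta by rewrite divr_gt0.
have [d dp Fd] := cF eta etap.
pose A := 2 * M / d ^+ 2.
have A0 : 0 <= A.
  by rewrite divr_ge0 ?sqr_ge0 // mulr_ge0 // (le_trans (normc_ge0 (F y))).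
have maj x : Normc.normc (F x - F y) <= eta + A * ((x.1 - y.1) ^+ 2 + (x.2 - y.2) ^+ 2).
  have FxM : Normc.normc (F x - F y) <= 2 * M.
    apply: le_trans (le_normcD _ _) _; rewrite normcN.
    by have := FM x; have := FM y; lra.
  have far2 (t : R) : d <= `|t| -> 2 * M <= A * t ^+ 2.
    move=> dt; rewrite /A mulrAC ler_pdivlMr ?exprn_gt0 //.
    rewrite ler_wpM2l ?(le_trans (normc_ge0 _) FxM) //.
    by rewrite -(real_normK (num_real t)) lerXn2r ?nnegrE // ltW.
  have p1 : 0 <= A * (x.1 - y.1) ^+ 2 by rewrite mulr_ge0 ?sqr_ge0.
  have p2 : 0 <= A * (x.2 - y.2) ^+ 2 by rewrite mulr_ge0 ?sqr_ge0.
  rewrite mulrDr.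
  have [n1|f1] := ltP `|x.1 - y.1| d; last by have := far2 _ f1; lra.
  have [n2|f2] := ltP `|x.2 - y.2| d; last by have := far2 _ f2; lra.
  by have := Fd x n1 n2; lra.
pose f (xi : plane) := cis (2 * pi * dot2 y xi) * fourier2 F xi.
have cf : cintegrable f by exact: cintegrable_osc.
have lim := cintegral_weight2_limit cf etap.
have small := eps_sqr_small A etap.
have [n [l1 l2]] := filter_ex (filterI lim small).
set e := @eps_ R n in l1 l2; have e0 : 0 < e by exact: eps_gt0.
pose h (xi : plane) := cis (2 * pi * dot2 y xi) * real_complex R (weight2 e xi).
have ch : cintegrable h by apply: cintegrable_osc; exact: cintegrable_weight2.
have hE x : osc (- (2 * pi)) h x = real_complex R (avg_kernel e y x).
  apply: etrans (cintegral_weight2_cis (y - x) e0); rewrite /osc; congr cintegral2.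
  apply/funext => xi; rewrite /h mulrA -cisD; congr (cis _ * _).
  by rewrite /dot2 /=; ring.
have dual : cintegral2 (fun xi => f xi * real_complex R (weight2 e xi)) =
    cintegral2 (fun x => F x * real_complex R (avg_kernel e y x)).
  transitivity (cintegral2 (fun x => F x * osc (- (2 * pi)) h x)).
    rewrite -osc_duality //; congr cintegral2; apply/funext => xi.
    by rewrite /f /h fourier2E; ring.
  by congr cintegral2; apply/funext => x; rewrite hE.
have iK := integrable_avg_kernel y e0.
have [iK2 bK2] := integrable_avg_kernel_moment y e0.
have mK : cmeasurable (fun x : plane => real_complex R (avg_kernel e y x)).
  by apply: cmeasurable_real; move: iK => /measurable_int/measurable_EFinP.
have nK x : Normc.normc (real_complex R (avg_kernel e y x)) = avg_kernel e y x.
  by rewrite normc_real ger0_norm // avg_kernel_ge0 // ltW.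
have cK : cintegrable (fun x : plane => real_complex R (avg_kernel e y x)).
  by apply: cintegrable_le mK iK _ => x; rewrite nK.
have cFK : cintegrable (fun x => F x * real_complex R (avg_kernel e y x)).
  apply: (cintegrable_le (g := fun x => M * avg_kernel e y x)).
  - by apply: cmeasurableM mK; exact: cintegrable_measurable.
  - exact: integrable_scale.
  - by move=> x; rewrite Normc.normcM nK ler_wpM2r // avg_kernel_ge0 // ltW.
have cK1 : cintegral2 (fun x : plane => real_complex R (avg_kernel e y x)) = 1.
  rewrite /cintegral2 /= Rintegral_avg_kernel //; congr Complex.
  by rewrite /Rintegral integral0.
have diff : cintegral2 (fun x => F x * real_complex R (avg_kernel e y x)) - F y =
    cintegral2 (fun x => (F x - F y) * real_complex R (avg_kernel e y x)).
  have -> : (fun x => (F x - F y) * real_complex R (avg_kernel e y x)) =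
      (fun x => F x * real_complex R (avg_kernel e y x) +
        (- F y) * real_complex R (avg_kernel e y x)).
    by apply/funext => x; rewrite mulrDl.
  rewrite cintegralD //; last exact: cintegrableZ.
  by rewrite cintegralZ // cK1 mulr1.
have ib : mu.-integrable setT (fun x => (eta * avg_kernel e y x +
    A * (((x.1 - y.1) ^+ 2 + (x.2 - y.2) ^+ 2) * avg_kernel e y x))%:E).
  by under eq_fun do rewrite EFinD; apply: integrableD => //; exact: integrable_scale.
have bnd x : Normc.normc ((F x - F y) * real_complex R (avg_kernel e y x)) <=
    eta * avg_kernel e y x + A * (((x.1 - y.1) ^+ 2 + (x.2 - y.2) ^+ 2) * avg_kernel e y x).
  have -> : eta * avg_kernel e y x + A * (((x.1 - y.1) ^+ 2 + (x.2 - y.2) ^+ 2) * avg_kernel e y x)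
    = (eta + A * ((x.1 - y.1) ^+ 2 + (x.2 - y.2) ^+ 2)) * avg_kernel e y x by ring.
  by rewrite Normc.normcM nK ler_wpM2r ?avg_kernel_ge0 ?(ltW e0).
have avg : Normc.normc (cintegral2 (fun x => F x * real_complex R (avg_kernel e y x)) - F y)
    <= 2 * (eta + A * (4 * e ^+ 2)).
  rewrite diff; apply: le_trans (normc_cintegral_le _ ib bnd) _.
    apply: cintegrable_le ib bnd; apply: cmeasurableM mK.
    by apply: cmeasurableD; [exact: cintegrable_measurable | exact: cmeasurable_cst].
  rewrite ler_wpM2l // RintegralD //; [|exact: integrable_scale..].
  rewrite !RintegralZl // Rintegral_avg_kernel // mulr1 lerD2l.
  by rewrite ler_wpM2l.
have -> : inv_fourier2 (fourier2 F) y - F y =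
   - (cintegral2 (fun xi => f xi * real_complex R (weight2 e xi)) - cintegral2 f)
   + (cintegral2 (fun x => F x * real_complex R (avg_kernel e y x)) - F y).
  by rewrite dual /f /inv_fourier2; ring.
apply: le_trans (le_normcD _ _) _; rewrite normcN.
have eE : eta0 = 11 * eta by rewrite /eta; field.
move: avg l1 l2; rewrite eE; lra.
Qed.

End FourierInversion.

(** * Orthogonality of functions with separated frequencies *)

Section Orthogonality.
Context {R : realType}.
Local Notation mu := (lebesgue2 R).
Local Notation plane := (measurableTypeR R * measurableTypeR R)%type.
Implicit Types f h : plane -> R[i].

Lemma conjcM (z w : R[i]) : conjc (z * w) = conjc z * conjc w.
Proof. exact: rmorphM. Qed.

Lemma conjc_osc (s : R) f x : cintegrable f ->
  conjc (osc s f x) = osc (- s) (fun y => conjc (f y)) x.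
Proof.
move=> cf; rewrite /osc -cintegral_conj; last exact: cintegrable_osc.
by congr cintegral2; apply/funext => y; rewrite conjcM conjc_cis mulNr.
Qed.

Lemma normc_conjc (z : R[i]) : Normc.normc (conjc z) = Normc.normc z.
Proof. by case: z => a b /=; rewrite sqrrN. Qed.

Lemma cintegrable_conj f : cintegrable f -> cintegrable (fun y => conjc (f y)).
Proof.
move=> cf; apply: cintegrable_le (integrable_normc cf) _.
  exact/cmeasurable_conj/cintegrable_measurable.
by move=> x; rewrite normc_conjc.
Qed.

Lemma cintegrable_oscM (s : R) f h : cintegrable f -> cintegrable h ->
  cintegrable (fun x => osc s f x * h x).
Proof.
move=> cf ch.
apply: (cintegrable_le (g := fun x => 2 * (\int[mu]_y Normc.normc (f y)) * Normc.normc (h x))).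
- by apply: cmeasurableM; [exact: cmeasurable_osc | exact: cintegrable_measurable].
- exact/integrable_scale/integrable_normc.
- by move=> x; rewrite Normc.normcM ler_wpM2r ?normc_ge0 // normc_osc_le.
Qed.

Lemma osc_bound_plus f h (M : R) (eta : plane) : cintegrable f -> cintegrable h ->
  (forall y, f y != 0 -> Normc.normc
     (cintegral2 (fun x => cis (2 * pi * dot2 x (eta + y)) * h x)) <= M) ->
  Normc.normc (cintegral2 (fun x => cis (2 * pi * dot2 x eta) * (osc (2 * pi) f x * h x)))
    <= 2 * (\int[mu]_y Normc.normc (f y)) * M.
Proof.
move=> cf ch hM; apply: osc_multiplier_bound => // y fy.
apply: le_trans (hM y fy); rewrite le_eqVlt; apply/orP; left; apply/eqP.
congr Normc.normc; congr cintegral2; apply/funext => x; congr (cis _ * _).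
by rewrite /dot2 /=; ring.
Qed.

Lemma osc_bound_minus f h (M : R) (eta : plane) : cintegrable f -> cintegrable h ->
  (forall y, f y != 0 -> Normc.normc
     (cintegral2 (fun x => cis (2 * pi * dot2 x (eta - y)) * h x)) <= M) ->
  Normc.normc (cintegral2 (fun x => cis (2 * pi * dot2 x eta) *
      (conjc (osc (2 * pi) f x) * h x)))
    <= 2 * (\int[mu]_y Normc.normc (f y)) * M.
Proof.
move=> cf ch hM.
have -> : (fun x => cis (2 * pi * dot2 x eta) * (conjc (osc (2 * pi) f x) * h x)) =
  fun x => cis (2 * pi * dot2 x eta) * (osc (- (2 * pi)) (fun y => conjc (f y)) x * h x).
  by apply/funext => x; rewrite conjc_osc.
under eq_Rintegral do rewrite -normc_conjc.
apply: osc_multiplier_bound => // [|y fy]; first exact: cintegrable_conj.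
have {}fy : f y != 0 by move: fy; rewrite conjc_eq0.
apply: le_trans (hM y fy); rewrite le_eqVlt; apply/orP; left; apply/eqP.
congr Normc.normc; congr cintegral2; apply/funext => x; congr (cis _ * _).
by rewrite /dot2 /=; ring.
Qed.

Lemma weight_ft_le_far (e d v : R) : 0 < e -> 0 < d -> d <= `|v| ->
  weight_ft e v <= 4 * e ^+ 3 / d ^+ 4.
Proof.
move=> e0 d0 dv; have v2 : d ^+ 2 <= v ^+ 2.
  by rewrite -(real_normK (num_real v)) lerXn2r ?nnegrE // ltW.
have D0 : 0 < e ^+ 2 + v ^+ 2 by rewrite ltr_pwDl ?exprn_gt0 ?sqr_ge0.
rewrite /weight_ft ler_wpM2l ?mulr_ge0 ?exprn_ge0 ?(ltW e0) //.
rewrite lef_pV2 ?posrE ?exprn_gt0 // -[4%N]/(2 * 2)%N exprM.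
rewrite lerXn2r ?nnegrE ?exprn_ge0 ?(ltW d0) ?(ltW D0) //.
by have := sqr_ge0 e; lra.
Qed.

Lemma weight_ft_le (e v : R) : 0 < e -> weight_ft e v <= 4 / e.
Proof.
move=> e0; have D0 : 0 < e ^+ 2 + v ^+ 2 by rewrite ltr_pwDl ?exprn_gt0 ?sqr_ge0.
have -> : 4 / e = 4 * e ^+ 3 / (e ^+ 2) ^+ 2 by field; rewrite lt0r_neq0.
rewrite /weight_ft ler_wpM2l ?mulr_ge0 ?exprn_ge0 ?(ltW e0) //.
rewrite lef_pV2 ?posrE ?exprn_gt0 // lerXn2r ?nnegrE ?exprn_ge0 ?(ltW e0) ?(ltW D0) //.
by have := sqr_ge0 v; lra.
Qed.

Lemma weight_ft2_le (e d : R) (u : R * R) : 0 < e -> 0 < d ->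
  d <= `|u.1| \/ d <= `|u.2| ->
  weight_ft e (2 * pi * u.1) * weight_ft e (2 * pi * u.2) <= 16 / d ^+ 4 * e ^+ 2.
Proof.
move=> e0 d0 du; have p1 := frequency_ge1 (R := R).
have big (t : R) : d <= `|t| -> d <= `|2 * pi * t|.
  by move=> dt; rewrite normrM ger0_norm; [nra|lra].
have -> : 16 / d ^+ 4 * e ^+ 2 = (4 * e ^+ 3 / d ^+ 4) * (4 / e).
  by field; rewrite (lt0r_neq0 e0) (lt0r_neq0 d0).
have g0 v : 0 <= weight_ft e v by rewrite weight_ft_ge0 // ltW.
case: du => du; last rewrite mulrC.
  by apply: ler_pM => //; [exact/weight_ft_le_far/big | exact: weight_ft_le].
by apply: ler_pM => //; [exact/weight_ft_le_far/big | exact: weight_ft_le].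
Qed.

(** Insert the weight and peel off the four transforms.  What remains is the
    transform of the weight at [y1 + y2 - y3 - y4], which is [O(e^2)] because one
    of the two coordinates of this frequency is at least [d]. *)
Theorem biorthogonality (f1 f2 f3 f4 : plane -> R[i]) (d : R) : 0 < d ->
  cintegrable f1 -> cintegrable f2 -> cintegrable f3 -> cintegrable f4 ->
  (forall y1 y2 y3 y4, f1 y1 != 0 -> f2 y2 != 0 -> f3 y3 != 0 -> f4 y4 != 0 ->
     d <= `|y1.1 + y2.1 - y3.1 - y4.1| \/ d <= `|y1.2 + y2.2 - y3.2 - y4.2|) ->
  cintegrable (fun x => inv_fourier2 f1 x * inv_fourier2 f2 x *
    (conjc (inv_fourier2 f3 x) * conjc (inv_fourier2 f4 x))) ->
  cintegral2 (fun x => inv_fourier2 f1 x * inv_fourier2 f2 x *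
    (conjc (inv_fourier2 f3 x) * conjc (inv_fourier2 f4 x))) = 0.
Proof.
move=> d0 c1 c2 c3 c4 sep cPhi; rewrite !inv_fourier2E in cPhi *.
set Phi := (fun x => _) in cPhi *.
pose N1 f := 2 * \int[mu]_y Normc.normc (f y).
pose A := N1 f1 * (N1 f2 * (N1 f3 * (N1 f4 * (16 / d ^+ 4)))).
have bound e : 0 < e ->
  Normc.normc (cintegral2 (fun x => Phi x * real_complex R (weight2 e x))) <= A * e ^+ 2.
  move=> e0; have cw := cintegrable_weight2 e0.
  have -> : A * e ^+ 2 = N1 f1 * (N1 f2 * (N1 f3 * (N1 f4 * (16 / d ^+ 4 * e ^+ 2)))).
    by rewrite /A; ring.
  have -> : (fun x => Phi x * real_complex R (weight2 e x)) = fun x =>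
    cis (2 * pi * dot2 x 0) * (osc (2 * pi) f1 x * (osc (2 * pi) f2 x *
      (conjc (osc (2 * pi) f3 x) * (conjc (osc (2 * pi) f4 x) *
        real_complex R (weight2 e x))))).
    apply/funext => x; have -> : dot2 x 0 = 0 by rewrite /dot2 /= !mulr0 addr0.
    rewrite mulr0 /cis cos0 sin0 -[Complex 1 0]/(1 : R[i]) mul1r /Phi.
    by rewrite !mulrA.
  have cc f h (cf : cintegrable f) (ch : cintegrable h) :
      cintegrable (fun x => conjc (osc (2 * pi) f x) * h x).
    under eq_fun do rewrite conjc_osc //.
    by apply: cintegrable_oscM => //; exact: cintegrable_conj.
  have h4 := cc _ _ c4 cw; have h3 := cc _ _ c3 h4.
  have h2 := cintegrable_oscM (2 * pi) c2 h3.
  apply: osc_bound_plus => // y1 fy1; apply: osc_bound_plus => // y2 fy2.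
  apply: osc_bound_minus => // y3 fy3; apply: osc_bound_minus => // y4 fy4.
  rewrite cintegral_weight2_cis // normc_real ger0_norm; last first.
    by rewrite mulr_ge0 // weight_ft_ge0 // ltW.
  apply: weight_ft2_le => //=; rewrite !add0r; exact: sep.
apply: eq0_of_normc_le => eta0 eta00.
have etap : 0 < eta0 / 2 by rewrite divr_gt0.
have [n [l1 l2]] := filter_ex (filterI
  (cintegral_weight2_limit cPhi etap) (eps_sqr_small A etap)).
have := bound _ (eps_gt0 (R := R) n).
set I := cintegral2 (fun x => Phi x * _) in l1 *.
have -> : cintegral2 Phi = I - (I - cintegral2 Phi) by ring.
move=> b; apply: le_trans (le_normcD _ _) _; rewrite normcN; lra.
Qed.

End Orthogonality.

(** * The square function estimate for a biorthogonal family *)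

Section SquareFunction.
Context {R : realType}.
Local Notation mu := (lebesgue2 R).
Local Notation plane := (measurableTypeR R * measurableTypeR R)%type.

(** The Schur test: [2 a_i a_j <= a_i^2 + a_j^2], and by symmetry each index occurs
    at most [N] times on either side. *)
Lemma sparse_form_le (I : eqType) (s : seq I) (c : I -> I -> bool) (N : nat) (a : I -> R) :
  (forall i j, c i j = c j i) ->
  {in s, forall i, size [seq j <- s | c i j] <= N}%N ->
  \sum_(i <- s) \sum_(j <- s | c i j) a i * a j <= N%:R * \sum_(i <- s) a i ^+ 2.
Proof.
move=> csym cN.
have half : \sum_(i <- s) \sum_(j <- s | c i j) a i ^+ 2 <= N%:R * \sum_(i <- s) a i ^+ 2.
  rewrite mulr_sumr big_seq [leRHS]big_seq; apply: ler_sum => i si.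
  rewrite -big_filter big_const_seq count_predT iter_addr_0 -[leLHS]mulr_natl.
  by rewrite ler_wpM2r ?sqr_ge0 // ler_nat cN.
have swap : \sum_(i <- s) \sum_(j <- s | c i j) a j ^+ 2 =
    \sum_(i <- s) \sum_(j <- s | c i j) a i ^+ 2.
  under eq_bigr do rewrite big_mkcond.
  rewrite exchange_big /=; apply: eq_bigr => i _; rewrite [RHS]big_mkcond.
  by apply: eq_bigr => j _; rewrite csym.
apply: (@le_trans _ _ (\sum_(i <- s) \sum_(j <- s | c i j) (a i ^+ 2 + a j ^+ 2) / 2)).
  by apply: ler_sum => i _; apply: ler_sum => j _; have := sqr_ge0 (a i - a j); nra.
under eq_bigr do rewrite -mulr_suml big_split /=.
rewrite -mulr_suml big_split /= swap; lra.
Qed.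

(** Up to closeness, [p] and [q] are the same unordered pair. *)
Definition related (I : eqType) (c : I -> I -> bool) (p q : I * I) : bool :=
  c p.1 q.1 && c p.2 q.2 || c p.1 q.2 && c p.2 q.1.

(** Each of the two orders contributes the square of the quadratic form of [c]. *)
Lemma related_form_le (I : eqType) (s : seq I) (c : I -> I -> bool) (N : nat) (a : I -> R) :
  (forall i j, c i j = c j i) -> (forall i, 0 <= a i) ->
  {in s, forall i, size [seq j <- s | c i j] <= N}%N ->
  \sum_(p <- [seq (i, j) | i <- s, j <- s])
     \sum_(q <- [seq (i, j) | i <- s, j <- s] | related c p q)
       a p.1 * a p.2 * (a q.1 * a q.2)
  <= 2 * (N%:R * \sum_(i <- s) a i ^+ 2) ^+ 2.
Proof.
move=> csym a0 cN; set T := \sum_(i <- s) \sum_(j <- s | c i j) a i * a j.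
have T0 : 0 <= T by do 2 (apply: sumr_ge0 => ? _); rewrite mulr_ge0.
have TN : T <= N%:R * \sum_(i <- s) a i ^+ 2 by exact: sparse_form_le.
suff main : \sum_(p <- [seq (i, j) | i <- s, j <- s])
     \sum_(q <- [seq (i, j) | i <- s, j <- s] | related c p q)
       a p.1 * a p.2 * (a q.1 * a q.2) <= T ^+ 2 + T ^+ 2.
  apply: le_trans main _; rewrite [leRHS]mulr_natl mulr2n.
  by rewrite lerD // lerXn2r ?nnegrE // (le_trans T0).
have TE : T = \sum_(i <- s) \sum_(k <- s) (c i k)%:R * (a i * a k).
  rewrite /T; apply: eq_bigr => i _; rewrite big_mkcond; apply: eq_bigr => k _.
  by case: (c i k); rewrite ?mul1r ?mul0r.
have direct : T ^+ 2 = \sum_(p <- [seq (i, j) | i <- s, j <- s])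
    \sum_(q <- [seq (i, j) | i <- s, j <- s])
      (c p.1 q.1)%:R * (c p.2 q.2)%:R * (a p.1 * a p.2 * (a q.1 * a q.2)).
  rewrite expr2 {1 2}TE big_allpairs_dep big_distrlr /=.
  apply: eq_bigr => i _; apply: eq_bigr => j _.
  rewrite big_allpairs_dep big_distrlr /=.
  by apply: eq_bigr => k _; apply: eq_bigr => l _; ring.
have crossed : T ^+ 2 = \sum_(p <- [seq (i, j) | i <- s, j <- s])
    \sum_(q <- [seq (i, j) | i <- s, j <- s])
      (c p.1 q.2)%:R * (c p.2 q.1)%:R * (a p.1 * a p.2 * (a q.1 * a q.2)).
  rewrite expr2 {1 2}TE big_allpairs_dep big_distrlr /=.
  apply: eq_bigr => i _; apply: eq_bigr => j _.
  rewrite big_allpairs_dep big_distrlr /= exchange_big /=.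
  by apply: eq_bigr => k _; apply: eq_bigr => l _; ring.
rewrite {1}direct crossed -big_split /=; apply: ler_sum => p _.
rewrite -big_split /= big_mkcond /=; apply: ler_sum => q _.
have w0 : 0 <= a p.1 * a p.2 * (a q.1 * a q.2) by rewrite !mulr_ge0.
rewrite /related; case: (c p.1 q.1); case: (c p.2 q.2); case: (c p.1 q.2);
  case: (c p.2 q.1); rewrite /= ?mul1r ?mul0r ?mulr0 ?mul0r; lra.
Qed.

(** Expand [|sum F_i|^4] as a sum over pairs of pairs of indices: the integrals
    of the unrelated pairs vanish, and the related ones are bounded pointwise. *)
Lemma biorthogonal_square_function (I : eqType) (s : seq I) (c : I -> I -> bool)
    (N : nat) (f : I -> plane -> R[i]) (d : R) :
  0 < d -> {in s, forall i, cintegrable (f i)} ->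
  (forall i j, c i j = c j i) ->
  {in s, forall i, size [seq j <- s | c i j] <= N}%N ->
  (forall i1 i2 i3 i4 y1 y2 y3 y4, i1 \in s -> i2 \in s -> i3 \in s -> i4 \in s ->
     ~~ related c (i1, i2) (i3, i4) ->
     f i1 y1 != 0 -> f i2 y2 != 0 -> f i3 y3 != 0 -> f i4 y4 != 0 ->
     d <= `|y1.1 + y2.1 - y3.1 - y4.1| \/ d <= `|y1.2 + y2.2 - y3.2 - y4.2|) ->
  mu.-integrable setT
    (fun x => ((\sum_(i <- s) Normc.normc (inv_fourier2 (f i) x) ^+ 2) ^+ 2)%:E) ->
  mu.-integrable setT
    (fun x => (Normc.normc (\sum_(i <- s) inv_fourier2 (f i) x) ^+ 4)%:E) /\
  \int[mu]_x Normc.normc (\sum_(i <- s) inv_fourier2 (f i) x) ^+ 4 <=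
  2 * N%:R ^+ 2 *
    \int[mu]_x ((\sum_(i <- s) Normc.normc (inv_fourier2 (f i) x) ^+ 2) ^+ 2).
Proof.
move=> d0 cf csym cN sep iSF.
pose F i x := inv_fourier2 (f i) x; pose a x i := Normc.normc (F i x).
pose SF2 x := \sum_(i <- s) a x i ^+ 2; pose S x := \sum_(i <- s) F i x.
have a0 x i : 0 <= a x i by exact: normc_ge0.
have mF i : i \in s -> cmeasurable (F i : plane -> R[i]).
  by move=> si; apply: cmeasurable_osc; exact: cf.
have SF20 x : 0 <= SF2 x by apply: sumr_ge0 => i _; exact: sqr_ge0.
have aSF x i : i \in s -> a x i ^+ 2 <= SF2 x.
  move=> si; rewrite /SF2 (perm_big _ (perm_to_rem si)) /= big_cons lerDl.
  by apply: sumr_ge0 => j _; exact: sqr_ge0.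
pose s2 := [seq (i, j) | i <- s, j <- s].
have mems2 p : p \in s2 -> p.1 \in s /\ p.2 \in s.
  by move=> /allpairsP[[i j] [/= si sj ->]].
pose P p x := F p.1 x * F p.2 x.
have P2 x p : p \in s2 -> Normc.normc (P p x) <= SF2 x.
  move=> /mems2[s1 s2']; rewrite Normc.normcM -/(a x p.1) -/(a x p.2).
  by have := aSF x _ s1; have := aSF x _ s2'; have := sqr_ge0 (a x p.1 - a x p.2); nra.
have S2 x : S x * S x = \sum_(p <- s2) P p x.
  by rewrite /s2 big_allpairs_dep /S big_distrlr.
have mP p : p \in s2 -> cmeasurable (P p : plane -> R[i]).
  by move=> /mems2[s1 s2']; apply: cmeasurableM; exact: mF.
have cPQ p q : p \in s2 -> q \in s2 -> cintegrable (fun x : plane => P p x * conjc (P q x)).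
  move=> ps qs; apply: cintegrable_le iSF _.
    by apply: cmeasurableM; [exact: mP | apply: cmeasurable_conj; exact: mP].
  move=> x; rewrite Normc.normcM normc_conjc expr2.
  by rewrite ler_pM ?normc_ge0 // P2.
have cPP p : p \in s2 ->
    cintegrable (fun x : plane => \sum_(q <- s2) P p x * conjc (P q x)).
  by move=> ps; apply: cintegrable_sum => q qs; exact: cPQ.
have S4 x : real_complex R (Normc.normc (S x) ^+ 4) =
    \sum_(p <- s2) \sum_(q <- s2) P p x * conjc (P q x).
  have zz (z : R[i]) : real_complex R (Normc.normc z ^+ 4) = z * z * conjc (z * z).
    case: z => u v; rewrite -[4%N]/(2 * 2)%N exprM sqr_sqrtr ?addr_ge0 ?sqr_ge0 //=.
    by congr Complex; ring.
  rewrite zz S2 mulr_suml; apply: eq_bigr => p _.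
  by rewrite raddf_sum mulr_sumr.
have iS4 : mu.-integrable setT (fun x => (Normc.normc (S x) ^+ 4)%:E).
  have [] : cintegrable (fun x : plane => \sum_(p <- s2) \sum_(q <- s2) P p x * conjc (P q x)).
    by apply: cintegrable_sum => p ps; exact: cPP.
  by under eq_fun do rewrite -S4.
split=> //.
have int0 p q : p \in s2 -> q \in s2 -> ~~ related c p q ->
    cintegral2 (fun x => P p x * conjc (P q x)) = 0.
  move=> ps qs npq; have [p1 p2] := mems2 _ ps; have [q1 q2] := mems2 _ qs.
  have PE : (fun x => P p x * conjc (P q x)) = fun x =>
      inv_fourier2 (f p.1) x * inv_fourier2 (f p.2) x *
      (conjc (inv_fourier2 (f q.1) x) * conjc (inv_fourier2 (f q.2) x)).
    by apply/funext => x; rewrite /P conjcM.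
  have := cPQ _ _ ps qs; rewrite PE => iPQ.
  apply: (biorthogonality d0 (cf _ p1) (cf _ p2) (cf _ q1) (cf _ q2) _ iPQ).
  by move=> y1 y2 y3 y4; apply: (sep p.1 p.2 q.1 q.2).
pose rel p := [seq q <- s2 | related c p q].
have rels p q : q \in rel p -> q \in s2 by rewrite mem_filter => /andP[].
pose T x := \sum_(p <- s2) \sum_(q <- rel p) P p x * conjc (P q x).
have cT1 p : p \in s2 -> cintegrable (fun x : plane => \sum_(q <- rel p) P p x * conjc (P q x)).
  by move=> ps; apply: cintegrable_sum => q /rels qs; exact: cPQ.
have cT : cintegrable (T : plane -> R[i]) by apply: cintegrable_sum.
have intE : \int[mu]_x Normc.normc (S x) ^+ 4 = \int[mu]_x complex.Re (T x).
  have ST : cintegral2 (fun x => \sum_(p <- s2) \sum_(q <- s2) P p x * conjc (P q x)) =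
      cintegral2 T.
    rewrite !cintegral_sum // big_seq [RHS]big_seq; apply: eq_bigr => p ps.
    rewrite !cintegral_sum; first last.
    - by move=> q qs; exact: cPQ.
    - by move=> q /rels qs; exact: cPQ.
    rewrite big_filter [RHS]big_mkcond [LHS]big_seq [RHS]big_seq; apply: eq_bigr => q qs.
    by case: ifPn => // npq; rewrite int0.
  move/(f_equal (@complex.Re R)): ST; rewrite /cintegral2 /= => <-.
  by apply: eq_Rintegral => x _; rewrite -S4.
have iB : mu.-integrable setT (fun x => (2 * N%:R ^+ 2 * SF2 x ^+ 2)%:E).
  exact: integrable_scale.
rewrite intE -RintegralZl //; apply: le_Rintegral => //; first by have [] := cT.
move=> x _; apply: le_trans (_ : \sum_(p <- s2) \sum_(q <- rel p)
    a x p.1 * a x p.2 * (a x q.1 * a x q.2) <= _); last first.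
  under eq_bigr do rewrite big_filter.
  apply: le_trans (related_form_le csym (a0 x) cN) _.
  by rewrite exprMn mulrA.
apply: le_trans (ler_norm _) _; apply: le_trans (normr_Re_le _) _.
have tri (J : Type) (r : seq J) (z : J -> R[i]) (b : J -> R) :
    (forall j, Normc.normc (z j) <= b j) ->
    Normc.normc (\sum_(j <- r) z j) <= \sum_(j <- r) b j.
  move=> zb; elim: r => [|j r IH]; first by rewrite !big_nil Normc.normc0.
  by rewrite !big_cons; apply: le_trans (le_normcD _ _) _; exact: lerD.
apply: (tri) => p; apply: (tri) => q.
by rewrite Normc.normcM normc_conjc !Normc.normcM.
Qed.

End SquareFunction.

(** * Regularity of the functions involved *)

Section Regularity.
Context {R : realType}.
Local Notation leb := (@lebesgue_measure R).
Local Notation mu := (lebesgue2 R).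
Local Notation plane := (measurableTypeR R * measurableTypeR R)%type.

(** An open set is the countable union of the rational squares it contains. *)
Lemma open_measurable_plane (A : set (R * R)) : open A -> measurable (A : set plane).
Proof.
move=> oA.
pose r (k : nat) : R := k.+1%:R^-1.
have r0 k : 0 < r k by rewrite invr_gt0 ltr0n.
pose B (t : rat * rat * nat) : set plane :=
  `](ratr t.1.1 - r t.2), (ratr t.1.1 + r t.2)[%classic `*`
  `](ratr t.1.2 - r t.2), (ratr t.1.2 + r t.2)[%classic.
pose F t := if `[< B t `<=` A >] then B t else set0.
have -> : (A : set plane) = \bigcup_t F t.
  apply/seteqP; split=> [[x1 x2] Ax|x [t _]]; last first.
    by rewrite /F; case: asboolP => // BA /BA.
  have : nbhs ((x1, x2) : R * R) A by exact: open_nbhs_nbhs.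
  move=> [[U V] /= [nU nV] UVA].
  have /nbhs_ballP[d1 /= d10 dU] := nU; have /nbhs_ballP[d2 /= d20 dV] := nV.
  pose d := Num.min d1 d2; have dp : 0 < d by rewrite lt_min d10.
  pose k := Num.truncn (2 / d).
  have kd : 2 * r k < d.
    have : 2 / d < k.+1%:R := truncnS_gt _.
    by rewrite ltr_pdivrMr // /r ltr_pdivrMr ?ltr0n // mulrC.
  have xr (x : R) : exists q : rat, `|x - ratr q| < r k.
    have /rat_in_itvoo[q] : x - r k < x + r k by have := r0 k; lra.
    by rewrite in_itv /= => /andP[q1 q2]; exists q; rewrite ltr_norml; lra.
  have [q1 xq1] := xr x1; have [q2 xq2] := xr x2.
  exists (q1, q2, k) => //; rewrite /F.
  have inB : B (q1, q2, k) (x1, x2).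
    by rewrite /B; split; rewrite /= in_itv /=;
      [move: xq1 | move: xq2]; rewrite ltr_norml; lra.
  case: asboolP => // -[] [z1 z2] [] /=; rewrite !in_itv /= => h1 h2.
  apply: UVA; split => /=.
    apply: dU; rewrite /ball /= ltr_norml.
    move: xq1; rewrite ltr_norml => xq1.
    have : d <= d1 by rewrite ge_min lexx.
    lra.
  apply: dV; rewrite /ball /= ltr_norml.
  move: xq2; rewrite ltr_norml => xq2.
  have : d <= d2 by rewrite ge_min lexx orbT.
  lra.
apply: countable_bigcupT_measurable; first exact: countableP.
by move=> t; rewrite /F; case: asboolP => // _; apply: measurableX.
Qed.

Lemma continuous_measurable_plane (f : R * R -> R) : continuous f ->
  measurable_fun [set: plane] f.
Proof.
move=> /continuousP cf; apply: (measurability _ (RGenOpens.measurableE R)).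
move=> _ [_ [a [b ->] <-]]; rewrite setTI; apply: open_measurable_plane.
exact/cf/interval_open.
Qed.

Lemma csmooth2_cmeasurable (f : R * R -> R[i]) : csmooth2 f -> cmeasurable (f : plane -> R[i]).
Proof.
by move=> [sr si]; split; apply: continuous_measurable_plane;
  [have [] := sr [::] | have [] := si [::]].
Qed.

Lemma norm2_ge (x : R * R) : `|x.1| <= norm2 x /\ `|x.2| <= norm2 x.
Proof.
rewrite /norm2 /dot2 -!expr2 -!(sqrtr_sqr x.1) -!(sqrtr_sqr x.2).
by split; rewrite ler_wsqrtr // ?lerDl ?lerDr sqr_ge0.
Qed.

Lemma norm2_le (x : R * R) : norm2 x <= `|x.1| + `|x.2|.
Proof.
rewrite /norm2 /dot2 -[leRHS]ger0_norm ?addr_ge0 // -sqrtr_sqr ler_wsqrtr //.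
rewrite sqrrD !real_normK ?num_real //.
have := mulr_ge0 (normr_ge0 x.1) (normr_ge0 x.2); rewrite !expr2; lra.
Qed.

Lemma iter_cderive0 (f : R * R -> R[i]) x : iter_cderive [::] f x = f x.
Proof. by rewrite /iter_cderive /=; case: (f x). Qed.

(** The comparison function is a product of two Poisson kernels. *)
Lemma decay_cintegrable (f : plane -> R[i]) (M : R) : cmeasurable f ->
  (forall x, (1 + norm2 x) ^+ 4 * Normc.normc (f x) <= M) -> cintegrable f.
Proof.
move=> mf fM.
pose J (t : R) := poisson 1 (2 * pi * (0 - t)).
have iJ : leb.-integrable setT (fun t => (J t)%:E) by exact: integrable_poisson.
have iJJ := integrable_tensor (m1 := leb) (m2 := leb) iJ iJ.
pose P : R := 2 * pi; have P1 : 1 <= P by exact: frequency_ge1.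
apply: cintegrable_le mf (integrable_scale (M * P ^+ 4) iJJ) _ => x.
have n0 : 0 <= norm2 x by exact: sqrtr_ge0.
have M0 : 0 <= M.
  by apply: le_trans (fM x); rewrite mulr_ge0 ?normc_ge0 // exprn_ge0 // addr_ge0.
have J_le (t : R) : `|t| <= norm2 x -> (J t)^-1 <= (P * (1 + norm2 x)) ^+ 2.
  move=> tn; rewrite /J /poisson sub0r mul1r invrK expr1n mulrN sqrrN -/P.
  have : t ^+ 2 <= norm2 x ^+ 2.
    by rewrite -(real_normK (num_real t)) lerXn2r ?nnegrE.
  have : 1 <= P ^+ 2 by rewrite exprn_ege1.
  by rewrite !exprMn; have := sqr_ge0 (norm2 x); have := sqr_ge0 t; nra.
have J0 (t : R) : 0 < J t.
  by rewrite /J /poisson mul1r invr_gt0 ltr_pwDl ?exprn_gt0 ?sqr_ge0.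
have [n1 n2] := norm2_ge x; have h1 := J_le _ n1; have h2 := J_le _ n2.
have c0 : 0 < (1 + norm2 x) ^+ 4 by rewrite exprn_gt0 // ltr_pwDl.
have key : 1 <= P ^+ 4 * (J x.1 * J x.2) * (1 + norm2 x) ^+ 4.
  have JJ : 0 < J x.1 * J x.2 by rewrite mulr_gt0.
  have : (J x.1)^-1 * (J x.2)^-1 <= (P * (1 + norm2 x)) ^+ 4.
    rewrite -[4%N]/(2 + 2)%N exprD ler_pM // invr_ge0 ltW //.
  rewrite -invfM -[leLHS]mul1r ler_pdivrMr // exprMn; lra.
rewrite -(ler_pM2l c0); apply: le_trans (fM x) _.
have -> : (1 + norm2 x) ^+ 4 * (M * P ^+ 4 * (J x.1 * J x.2)) =
  M * (P ^+ 4 * (J x.1 * J x.2) * (1 + norm2 x) ^+ 4) by ring.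
by rewrite ler_peMr.
Qed.

Lemma box_cintegrable (f : plane -> R[i]) (b r : R) : cmeasurable f ->
  (forall x, Normc.normc (f x) <= b) ->
  (forall x, f x != 0 -> `|x.1| <= r /\ `|x.2| <= r) -> cintegrable f.
Proof.
move=> mf fb fr; apply: (decay_cintegrable (M := (1 + 2 * `|r|) ^+ 4 * b)) => // x.
have n0 : 0 <= norm2 x by exact: sqrtr_ge0.
have b0 : 0 <= b by exact: le_trans (normc_ge0 _) (fb x).
have [->|fx] := eqVneq (f x) 0.
  by rewrite Normc.normc0 mulr0 mulr_ge0 // exprn_ge0 // addr_ge0 // mulr_ge0.
have [x1 x2] := fr x fx.
rewrite ler_pM ?normc_ge0 ?exprn_ge0 ?addr_ge0 //.
have := norm2_le x; have := ler_norm r => h1 h2.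
by rewrite lerXn2r ?nnegrE ?addr_ge0 ?mulr_ge0 //; lra.
Qed.

Lemma schwartz2_cintegrable (F : R * R -> R[i]) : schwartz2 F ->
  cintegrable (F : plane -> R[i]).
Proof.
move=> [sF dF]; have [M hM] := dF 4%N [::].
apply: (decay_cintegrable (M := M)); first exact: csmooth2_cmeasurable.
by move=> x; have := hM x; rewrite iter_cderive0.
Qed.

Lemma schwartz2_bounded (F : R * R -> R[i]) : schwartz2 F ->
  exists M : R, forall x, Normc.normc (F x) <= M.
Proof.
move=> [sF dF]; have [M hM] := dF 0%N [::]; exists M => x.
by have := hM x; rewrite iter_cderive0 expr0 mul1r.
Qed.

Lemma schwartz2_continuous (F : R * R -> R[i]) (y : R * R) (eta : R) : schwartz2 F ->
  0 < eta -> exists2 d : R, 0 < d & forall x : R * R,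
    `|x.1 - y.1| < d -> `|x.2 - y.2| < d -> Normc.normc (F x - F y) <= eta.
Proof.
move=> [[sr si] _] eta0; have e2 : 0 < eta / 2 by rewrite divr_gt0.
have part (g : R * R -> R) : continuous g -> exists2 d : R, 0 < d & forall x : R * R,
    `|x.1 - y.1| < d -> `|x.2 - y.2| < d -> `|g x - g y| <= eta / 2.
  move=> /(_ y)/cvgrPdist_le /(_ _ e2)/nbhs_ballP[d /= d0 dg]; exists d => // x x1 x2.
  rewrite distrC; apply: dg; split; rewrite /ball /= distrC //.
have [d1 d10 h1] := part _ (sr [::]).1; have [d2 d20 h2] := part _ (si [::]).1.
exists (Num.min d1 d2); first by rewrite lt_min d10.
move=> x; rewrite !lt_min => /andP[a1 a2] /andP[b1 b2].
have := h1 x a1 b1; have := h2 x a2 b2 => /= q1 q2.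
apply: le_trans (normc_le_ReIm _) _.
have -> : complex.Re (F x - F y) = complex.Re (F x) - complex.Re (F y).
  by case: (F x); case: (F y).
have -> : complex.Im (F x - F y) = complex.Im (F x) - complex.Im (F y).
  by case: (F x); case: (F y).
lra.
Qed.

Lemma rect_bounded (k : nat) (C delta xi : R) : exists r : R,
  forall x, rect k C delta xi x -> `|x.1| <= r /\ `|x.2| <= r.
Proof.
pose L := rect_length k C delta xi / 2; pose W := rect_width C delta / 2.
exists (L + W + (`|xi| + `|xi ^+ k|)) => x; rewrite /rect /=; move: (xi ^+ k) => xk.
set p := (xi, xk); set t1 := (tangent k xi).1; set t2 := (tangent k xi).2.
rewrite /dot2 /normal /= -/t1 -/t2 -/L -/W.
have tt : t1 ^+ 2 + t2 ^+ 2 = 1.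
  rewrite /t1 /t2 /tangent /=; set d := k%:R * _.
  have n0 : 0 < 1 + d ^+ 2 by rewrite ltr_pwDl ?sqr_ge0.
  by rewrite !expr_div_n expr1n -mulrDl sqr_sqrtr ?ltW // divff // lt0r_neq0.
have t11 : `|t1| <= 1.
  by apply: ler_of_sqr; rewrite // real_normK ?num_real // expr1n; have := sqr_ge0 t2; lra.
have t21 : `|t2| <= 1.
  by apply: ler_of_sqr; rewrite // real_normK ?num_real // expr1n; have := sqr_ge0 t1; lra.
rewrite -[X in `|X * t1 + _|]/(x.1 - xi) -[X in `|_ + X * t2|]/(x.2 - xk).
rewrite -[X in `|X * - t2 + _|]/(x.1 - xi) -[X in `|_ + X * t1|]/(x.2 - xk).
set a := _ * t1 + _; set b := _ * - t2 + _; move=> [aL bW].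
have x1 : x.1 = a * t1 - b * t2 + xi.
  have -> : a * t1 - b * t2 = (x.1 - xi) * (t1 ^+ 2 + t2 ^+ 2) by rewrite /a /b; ring.
  by rewrite tt; ring.
have x2 : x.2 = a * t2 + b * t1 + xk.
  have -> : a * t2 + b * t1 = (x.2 - xk) * (t1 ^+ 2 + t2 ^+ 2) by rewrite /a /b; ring.
  by rewrite tt; ring.
have le1 (u t B : R) : `|u| <= B -> `|t| <= 1 -> `|u * t| <= B.
  by move=> uB t1'; rewrite normrM; apply: le_trans uB; rewrite ler_piMr.
split.
  rewrite x1; apply: le_trans (ler_normD _ _) _; apply: lerD; last by rewrite lerDl.
  by apply: le_trans (ler_normB _ _) _; apply: lerD; exact: le1.
rewrite x2; apply: le_trans (ler_normD _ _) _; apply: lerD; last by rewrite lerDr.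
by apply: le_trans (ler_normD _ _) _; apply: lerD; exact: le1.
Qed.

Lemma nbhd2_gammak_bounded (k : nat) (delta : R) (x : R * R) : delta < 1 ->
  nbhd2 delta (gammak R k) x -> `|x.1| <= 2 /\ `|x.2| <= 2.
Proof.
move=> d1 [p [xi /=]]; rewrite in_itv /= => xi1 <- xp.
have nxi : `|xi| <= 1 by rewrite ler_norml.
have nxik : `|xi ^+ k| <= 1 by rewrite normrX exprn_ile1.
have [/= h1 h2] := norm2_ge (x - (xi, xi ^+ k)).
split.
  have -> : x.1 = (x.1 - xi) + xi by ring.
  by apply: le_trans (ler_normD _ _) _; lra.
have -> : x.2 = (x.2 - xi ^+ k) + xi ^+ k by ring.
by apply: le_trans (ler_normD _ _) _; lra.
Qed.

Lemma eq0_notin_csupport (f : R * R -> R[i]) (A : set (R * R)) x :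
  csupport f `<=` A -> ~ A x -> f x = 0.
Proof.
move=> fA nA; apply/eqP; apply: contraT => fx; exfalso; apply: nA; apply: fA.
exact: (@subset_closure _ [set x | f x != 0]).
Qed.

Lemma normc_fourier2_le (F : plane -> R[i]) (x : R * R) : cintegrable F ->
  Normc.normc (fourier2 F x) <= 2 * \int[mu]_y Normc.normc (F y).
Proof. by move=> cF; rewrite fourier2E; exact: normc_osc_le. Qed.

Lemma cmeasurable_fourier2 (F : plane -> R[i]) : cintegrable F ->
  cmeasurable (fourier2 F : plane -> R[i]).
Proof. by move=> cF; rewrite fourier2E; exact: cmeasurable_osc. Qed.

End Regularity.

(** * Assembling the estimate *)

Section Assembly.
Context {R : realType}.
Local Notation mu := (lebesgue2 R).
Local Notation plane := (measurableTypeR R * measurableTypeR R)%type.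

Lemma L4normE (f : plane -> R) :
  L4norm f = ((\int[mu]_x (`|f x| ^+ 4)%:E) `^ 4^-1)%E.
Proof.
rewrite /L4norm unlock; congr (_ `^ _)%E; apply: eq_integral => x _.
by rewrite /= -(powR_mulrn 4 (normr_ge0 (f x))).
Qed.

(** When the right-hand side is infinite nothing has to be proved, so the
    estimate may assume [g] to be in [L^4]. *)
Lemma L4norm_le (f g : plane -> R) (A : R) : 0 < A ->
  (mu.-integrable setT (fun x => (`|g x| ^+ 4)%:E) ->
   (\int[mu]_x (`|f x| ^+ 4)%:E <= (A ^+ 4)%:E * \int[mu]_x (`|g x| ^+ 4)%:E)%E) ->
  measurable_fun setT g -> (L4norm f <= A%:E * L4norm g)%E.
Proof.
move=> A0 H mg; rewrite !L4normE.
set I := (\int[mu]_x (`|g x| ^+ 4)%:E)%E in H *.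
have f0 : (0 <= \int[mu]_x (`|f x| ^+ 4)%:E)%E.
  by apply: integral_ge0 => x _; rewrite lee_fin exprn_ge0.
have g0 : (0 <= I)%E by apply: integral_ge0 => x _; rewrite lee_fin exprn_ge0.
have [Ioo|Ifin] := eqVneq I +oo%E.
  by rewrite Ioo poweRyr ?invr_neq0 // gt0_muley ?lte_fin // leey.
have iI : mu.-integrable setT (fun x => (`|g x| ^+ 4)%:E).
  apply/integrableP; split.
    apply/measurable_EFinP; apply: measurable_funX.
    exact: (measurableT_comp (@normr_measurable R setT) mg).
  under eq_integral do rewrite gee0_abs ?lee_fin ?exprn_ge0 //.
  by rewrite ltey.
apply: (@le_trans _ _ (((A ^+ 4)%:E * I) `^ 4^-1)%E).
  apply: gt0_ler_poweR (H iI); rewrite ?invr_ge0 // in_itv /= ?leey ?andbT //.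
  by rewrite mule_ge0 // lee_fin exprn_ge0 // ltW.
rewrite poweRM ?lee_fin ?exprn_ge0 ?(ltW A0) // poweR_EFin.
rewrite -powR_mulrn ?(ltW A0) // -powRrM mulfV ?pnatr_eq0 // powRr1 //.
exact: ltW.
Qed.

Lemma measurable_sum_in (I : eqType) (s : seq I) (h : I -> plane -> R) :
  {in s, forall i, measurable_fun setT (h i)} ->
  measurable_fun setT (fun x => \sum_(i <- s) h i x).
Proof.
elim: s => [|i s IH] mh; first by under eq_fun do rewrite big_nil; exact: measurable_cst.
under eq_fun do rewrite big_cons; apply: measurable_funD.
  by apply: mh; exact: mem_head.
by apply: IH => j js; apply: mh; rewrite in_cons js orbT.
Qed.

Lemma sum3_pow4_le (a b c : R) : 0 <= a -> 0 <= b -> 0 <= c ->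
  (a + b + c) ^+ 4 <= 27 * (a ^+ 4 + b ^+ 4 + c ^+ 4).
Proof.
have sq3 (x y z : R) : (x + y + z) ^+ 2 <= 3 * (x ^+ 2 + y ^+ 2 + z ^+ 2).
  by have := sqr_ge0 (x - y); have := sqr_ge0 (y - z); have := sqr_ge0 (x - z); nra.
have p4 (x : R) : x ^+ 4 = (x ^+ 2) ^+ 2 by rewrite -exprM.
move=> a0 b0 c0; rewrite !p4.
apply: (@le_trans _ _ ((3 * (a ^+ 2 + b ^+ 2 + c ^+ 2)) ^+ 2)).
  by rewrite lerXn2r ?nnegrE ?sqr_ge0 ?mulr_ge0 ?addr_ge0 ?sqr_ge0.
have := sq3 (a ^+ 2) (b ^+ 2) (c ^+ 2); rewrite exprMn; lra.
Qed.

Lemma normc_sum_le (I : eqType) (s : seq I) (z : I -> R[i]) (b : R) :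
  {in s, forall i, Normc.normc (z i) <= b} ->
  Normc.normc (\sum_(i <- s) z i) <= (size s)%:R * b.
Proof.
elim: s => [|i s IH] zb; first by rewrite big_nil Normc.normc0 mul0r.
rewrite big_cons /= -[(size s).+1]addn1 natrD mulrDl mul1r addrC.
apply: le_trans (le_normcD _ _) _; apply: lerD.
  by apply: IH => j js; apply: zb; rewrite in_cons js orbT.
by apply: zb; exact: mem_head.
Qed.

(** Near the origin the number of rectangles is bounded; on either side of it
    they are biorthogonal.  The three contributions are estimated separately. *)
Lemma square_function_estimate (m : nat) (C c : R) : 1 <= C -> 0 < c ->
  exists2 A : R, 0 < A & forall (delta : R) (X : seq R) (B : nat -> nat -> R)
    (chi : R -> R * R -> R[i]) (F : R * R -> R[i]),
    0 < delta < 1 -> canonical_covering m.+2 C c delta X ->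
    adapted_partition m.+2 C delta X B chi -> schwartz2 F ->
    csupport (fourier2 F) `<=` nbhd2 delta (gammak R m.+2) ->
    measurable_fun [set: plane] (square_function X chi F) /\
    (mu.-integrable setT (fun x : plane => (`|square_function X chi F x| ^+ 4)%:E) ->
     (\int[mu]_x (`|Normc.normc (F x)| ^+ 4)%:E <=
      (A ^+ 4)%:E * \int[mu]_x (`|square_function X chi F x| ^+ 4)%:E)%E).
Proof.
move=> C1 c0; have [a Ca overlap] := sum_rect_overlap m C1.
have a1 : 1 <= a by exact: le_trans C1 Ca.
pose D := a * (1 + 2 ^+ m).
have D0 : 0 <= D by rewrite mulr_ge0 ?addr_ge0 ?exprn_ge0 //; lra.
have M1 : 1 <= 4 * a by lra.
have [N1 countN1] := count_close m D0.
have [N2 countN2] := count_not_far m M1 c0.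
pose A4 : R := 27 * (N2%:R ^+ 4 + 2 * N1%:R ^+ 2 + 2 * N1%:R ^+ 2).
have A40 : 0 <= A4 by rewrite mulr_ge0 // !addr_ge0 ?mulr_ge0 ?exprn_ge0.
exists (1 + A4); first lra.
move=> delta X B chi F d01 cov part sF suppF; have /andP[d0 d1] := d01.
have [chiP chi1] := part.
have cF : cintegrable (F : plane -> R[i]) by exact: schwartz2_cintegrable.
pose MF := 2 * \int[mu]_y Normc.normc (F y).
pose f xi (y : R * R) := chi xi y * fourier2 F y.
have mFF := cmeasurable_fourier2 cF.
have frect xi y : xi \in X -> f xi y != 0 -> rect m.+2 C delta xi y.
  move=> xiX; rewrite mulf_eq0 negb_or => /andP[chi0 _].
  have [_ sup _] := chiP xi xiX; apply: sup.
  exact: (@subset_closure _ [set x | chi xi x != 0]).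
have cf xi : xi \in X -> cintegrable (f xi).
  move=> xiX; have [schi _ adap] := chiP xi xiX.
  have [r hr] := rect_bounded m.+2 C delta xi.
  apply: (@box_cintegrable _ _ (B 0%N 0%N * MF) r).
  - by apply: cmeasurableM mFF; exact: csmooth2_cmeasurable.
  - move=> x; rewrite Normc.normcM ler_pM ?normc_ge0 //.
      by have := adap 0%N 0%N x; rewrite iter_cderive0.
    exact: normc_fourier2_le.
  - by move=> x fx; apply: hr; exact: frect.
have cFF : cintegrable (fourier2 F).
  apply: (@box_cintegrable _ _ MF 2) => // x; first exact: normc_fourier2_le.
  move=> Fx; apply: (nbhd2_gammak_bounded d1 (k := m.+2)); apply: contrapT => nx.
  by move/eqP: Fx; apply; exact: eq0_notin_csupport suppF nx.
pose P xi (x : R * R) := inv_fourier2 (f xi) x.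
(* Fourier inversion makes [F] the sum of its pieces *)
have FE x : F x = \sum_(xi <- X) P xi x.
  have [M hM] := schwartz2_bounded sF.
  rewrite -(fourier_inversion cF hM (fun eta => schwartz2_continuous x sF) cFF).
  rewrite /P /inv_fourier2 -cintegral_sum; last first.
    by move=> xi xiX; apply: cintegrable_osc; exact: cf.
  congr cintegral2; apply/funext => y; rewrite -mulr_sumr; congr (_ * _).
  rewrite /f -mulr_suml.
  have [yN|yN] := pselect (nbhd2 delta (gammak R m.+2) y); first by rewrite chi1 // mul1r.
  by rewrite (eq0_notin_csupport suppF yN) mulr0.
pose SF2 (s : seq R) x := \sum_(xi <- s) Normc.normc (P xi x) ^+ 2.
have SF20 s x : 0 <= SF2 s x by apply: sumr_ge0 => xi _; exact: sqr_ge0.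
have SFE x : square_function X chi F x ^+ 2 = SF2 X x.
  by rewrite /square_function sqr_sqrtr //; exact: (SF20 X x).
have SF0 x : 0 <= square_function X chi F x by exact: sqrtr_ge0.
have SF4E x : `|square_function X chi F x| ^+ 4 = SF2 X x ^+ 2.
  by rewrite ger0_norm // -SFE -exprM.
have mP xi : xi \in X -> measurable_fun [set: plane] (fun x => Normc.normc (P xi x)).
  by move=> xiX; apply: measurable_normc; apply: cmeasurable_osc; exact: cf.
have mSF2 s : {subset s <= X} -> measurable_fun [set: plane] (SF2 s).
  by move=> sX; apply: measurable_sum_in => xi /sX xiX; apply: measurable_funX; exact: mP.
split.
  have mX : measurable_fun [set: plane] (SF2 X) by exact: mSF2.
  apply: (@measurableT_comp _ _ _ _ _ _ (@Num.sqrt R)) => //.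
  by apply: continuous_measurable_fun; exact: sqrt_continuous.
under eq_fun do rewrite SF4E; move=> iSF.
have nn x : `|Normc.normc (F x)| ^+ 4 = Normc.normc (F x) ^+ 4.
  by rewrite ger0_norm ?normc_ge0.
rewrite (eq_integral (fun x : plane => (Normc.normc (F x) ^+ 4)%:E)); last first.
  by move=> x _; rewrite nn.
pose isfar xi := far m.+2 (4 * a) delta xi.
have group (p : pred R) :
    (forall x y, isfar x -> isfar y -> p x -> p y -> 0 < x * y) ->
    mu.-integrable setT (fun x : plane => (Normc.normc
      (\sum_(xi <- [seq xi <- X | isfar xi && p xi]) P xi x) ^+ 4)%:E) /\
    \int[mu]_x Normc.normc (\sum_(xi <- [seq xi <- X | isfar xi && p xi]) P xi x) ^+ 4
      <= 2 * N1%:R ^+ 2 * \int[mu]_x (SF2 X x ^+ 2).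
  move=> pp; set s := [seq xi <- X | _].
  have sX xi : xi \in s -> [/\ xi \in X, isfar xi & p xi].
    by rewrite mem_filter => /andP[/andP[-> ->] ->].
  have subX : {subset s <= X} by move=> xi /sX[].
  have leSF x : SF2 s x <= SF2 X x.
    rewrite /SF2 /s big_filter big_mkcond; apply: ler_sum => xi _.
    by case: ifP => // _; exact: sqr_ge0.
  have leSF2 x : SF2 s x ^+ 2 <= SF2 X x ^+ 2 by rewrite lerXn2r ?nnegrE.
  have iSFs : mu.-integrable setT (fun x : plane => (SF2 s x ^+ 2)%:E).
    apply: integrable_le iSF _; first by apply: measurable_funX; exact: mSF2.
    by move=> x; rewrite ger0_norm ?sqr_ge0.
  have cfs : {in s, forall xi, cintegrable (f xi)} by move=> xi /subX; exact: cf.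
  have count : {in s, forall xi, size [seq y <- s | close m.+2 D delta xi y] <= N1}%N.
    move=> xi /sX[xiX /and3P[xi0 _ _] _].
    have xin0 : xi != 0 by rewrite -normr_gt0.
    apply: leq_trans (countN1 C c delta X xi d0 cov xin0).
    rewrite !size_filter count_filter; apply: sub_count => y /=.
    by case/andP.
  have sep i1 i2 i3 i4 (y1 y2 y3 y4 : plane) :
      i1 \in s -> i2 \in s -> i3 \in s -> i4 \in s ->
      ~~ related (close m.+2 D delta) (i1, i2) (i3, i4) ->
      f i1 y1 != 0 -> f i2 y2 != 0 -> f i3 y3 != 0 -> f i4 y4 != 0 ->
      delta <= `|y1.1 + y2.1 - y3.1 - y4.1| \/ delta <= `|y1.2 + y2.2 - y3.2 - y4.2|.
    move=> /sX[X1 f1 p1] /sX[X2 f2 p2] /sX[X3 f3 p3] /sX[X4 f4 p4].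
    move=> nrel z1 z2 z3 z4.
    have [h1|h1] := leP delta `|y1.1 + y2.1 - y3.1 - y4.1|; first by left.
    have [h2|h2] := leP delta `|y1.2 + y2.2 - y3.2 - y4.2|; first by right.
    exfalso; move/negP: nrel; apply; rewrite /related /=.
    apply: (overlap delta i1 i2 i3 i4 y1 y2 y3 y4) => //; try exact: frect.
    exact: pp.
  have [i4 b4] := biorthogonal_square_function d0 cfs (close_sym _ _ _) count sep iSFs.
  split=> //; apply: le_trans b4 _; rewrite ler_wpM2l ?mulr_ge0 ?exprn_ge0 //.
  by apply: le_Rintegral => // x _; exact: leSF2.
have farN0 x : isfar x -> x != 0 by move=> /and3P[x0 _ _]; rewrite -normr_gt0.
have [ip bp] := group (fun x => 0 < x) (fun x y _ _ => @mulr_gt0 _ x y).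
have negneg x y : isfar x -> isfar y -> ~~ (0 < x) -> ~~ (0 < y) -> 0 < x * y.
  move=> /farN0 x0 /farN0 y0; rewrite -!leNgt !le_eqVlt (negbTE x0) (negbTE y0) /=.
  by move=> xn yn; rewrite nmulr_lgt0.
have [iq bq] := group (fun x => ~~ (0 < x)) negneg.
pose Fn x := \sum_(xi <- [seq xi <- X | ~~ isfar xi]) P xi x.
pose Fp x := \sum_(xi <- [seq xi <- X | isfar xi && (0 < xi)]) P xi x.
pose Fq x := \sum_(xi <- [seq xi <- X | isfar xi && ~~ (0 < xi)]) P xi x.
have split3 x : F x = Fn x + Fp x + Fq x.
  rewrite FE /Fn /Fp /Fq !big_filter (bigID isfar) /= (bigID (fun xi => 0 < xi)) /=.
  by rewrite addrC addrA.
have near_le x : Normc.normc (Fn x) ^+ 4 <= N2%:R ^+ 4 * SF2 X x ^+ 2.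
  have SFx : SF2 X x ^+ 2 = square_function X chi F x ^+ 4 by rewrite -SFE -exprM.
  rewrite SFx -exprMn lerXn2r ?nnegrE ?normc_ge0 ?mulr_ge0 //.
  apply: le_trans (normc_sum_le (b := square_function X chi F x) _) _.
    move=> xi; rewrite mem_filter => /andP[_ xiX].
    apply: ler_of_sqr; rewrite // SFE /SF2 (perm_big _ (perm_to_rem xiX)) /= big_cons.
    by rewrite lerDl; apply: sumr_ge0 => j _; exact: sqr_ge0.
  by rewrite ler_wpM2r // ler_nat; exact: countN2 d0 cov.
pose bnd x := 27 * (N2%:R ^+ 4 * SF2 X x ^+ 2 + Normc.normc (Fp x) ^+ 4
  + Normc.normc (Fq x) ^+ 4).
have F4 x : Normc.normc (F x) ^+ 4 <= bnd x.
  apply: (@le_trans _ _ ((Normc.normc (Fn x) + Normc.normc (Fp x) + Normc.normc (Fq x)) ^+ 4)).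
    rewrite lerXn2r ?nnegrE ?addr_ge0 ?normc_ge0 // split3.
    by apply: le_trans (le_normcD _ _) _; rewrite lerD2r; exact: le_normcD.
  apply: le_trans (sum3_pow4_le _ _ _) _; rewrite ?normc_ge0 //.
  by rewrite /bnd ler_wpM2l // !lerD2r.
have iN := integrable_scale (N2%:R ^+ 4) iSF.
have iNp : mu.-integrable setT (fun x : plane =>
    (N2%:R ^+ 4 * SF2 X x ^+ 2 + Normc.normc (Fp x) ^+ 4)%:E).
  by under eq_fun do rewrite EFinD; exact: integrableD.
have iNpq : mu.-integrable setT (fun x : plane =>
    (N2%:R ^+ 4 * SF2 X x ^+ 2 + Normc.normc (Fp x) ^+ 4 + Normc.normc (Fq x) ^+ 4)%:E).
  by under eq_fun do rewrite EFinD; exact: integrableD.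
have ibnd : mu.-integrable setT (fun x : plane => (bnd x)%:E) by exact: integrable_scale.
have iF4 : mu.-integrable setT (fun x : plane => (Normc.normc (F x) ^+ 4)%:E).
  apply: integrable_le ibnd _.
    apply: measurable_funX; apply: measurable_normc; exact: cintegrable_measurable cF.
  by move=> x; rewrite ger0_norm ?exprn_ge0 ?normc_ge0.
rewrite -[X in (X <= _)%E]fineK; last exact: integrable_fin_num iF4.
rewrite -[X in (_ <= _ * X)%E]fineK; last exact: integrable_fin_num iSF.
rewrite -EFinM lee_fin -/(\int[mu]_x Normc.normc (F x) ^+ 4) -/(\int[mu]_x (SF2 X x ^+ 2)).
apply: le_trans (le_Rintegral _ iF4 ibnd _) _ => //.
rewrite RintegralZl // RintegralD // RintegralD // RintegralZl //.
set I := \int[mu]_x (SF2 X x ^+ 2) in bp bq *.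
have I0 : 0 <= I by apply: Rintegral_ge0 => x _; exact: sqr_ge0.
apply: (@le_trans _ _ (A4 * I)); first by move: bp bq; rewrite /A4 -/Fp -/Fq; lra.
rewrite ler_wpM2r // -[leLHS]expr1.
by apply: le_trans (_ : (1 + A4) ^+ 1 <= _); rewrite ?expr1 ?lerDr // ler_eXnr //; lra.
Qed.

End Assembly.

Theorem theorem1p1 (R : realType) (k : nat) (hk : (2 <= k)%N)
    (C c : R) (hC : 1 <= C) (hc : 0 < c) (B : nat -> nat -> R) :
  exists A : R,
  forall (delta : R) (X : seq R) (chi : R -> R * R -> R[i])
         (F : R * R -> R[i]),
    0 < delta < 1 ->
    canonical_covering k C c delta X ->
    adapted_partition k C delta X B chi ->
    schwartz2 F ->
    csupport (fourier2 F) `<=` nbhd2 delta (gammak R k) ->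
    (L4norm (fun x => Normc.normc (F x))
       <= A%:E * L4norm (square_function X chi F))%E.
Proof.
case: k hk => [|[|m]] // _.
have [A A0 HA] := square_function_estimate m hC hc.
exists A => delta X chi F d01 cov part sF suppF.
have [mS est] := HA delta X B chi F d01 cov part sF suppF.
exact: (L4norm_le A0 est mS).
Qed.
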